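(* Let $1\le p<\infty$, let $\alpha>-1$ and let $g\in\mathcal{D}$. Suppose that $T_g:\mathcal{A}^p_\alpha\to\mathcal{A}^p_\alpha$ is bounded. Then $g\in\mathrm{Bloch}(\mathbb{C}_{1/2})$, i.e. $g$ is (extends to) an analytic function in $\mathbb{C}_{1/2}$ and $$\sup_{\sigma>1/2,\ t\in\mathbb{R}}\left(\sigma-\tfrac12\right)|g'(\sigma+it)|<\infty .$$
   Context: Notation: $\mathbb{C}_\theta=\{s\in\mathbb{C}:\mathrm{Re}(s)>\theta\}$. $\mathcal{D}$ is the set of Dirichlet series $\sum_{n\ge1}a_nn^{-s}$ converging in some half-plane. For $\alpha>-1$, $\mu_\alpha$ is the probability measure on $(0,\infty)$ given by $$d\mu_\alpha(\sigma)=\frac{2^{\alpha+1}}{\Gamma(\alpha+1)}\sigma^\alpha e^{-2\sigma}\,d\sigma .$$ For a Dirichlet polynomial $P(s)=\sum a_nn^{-s}$, its Bohr lift is the polynomial $\mathcal{B}P$ obtained by replacing $n^{-s}$, $n=p_1^{\alpha_1}\cdots p_r^{\alpha_r}$ ($p_j$ the $j$-th prime), by $z_1^{\alpha_1}\cdots z_r^{\alpha_r}$; $\|P\|_{\mathcal{H}^p}=\|\mathcal{B}P\|_{L^p(\mathbb{T}^\infty,m_\infty)}$ with $m_\infty$ the normalized Haar measure of the infinite polytorus $\mathbb{T}^\infty$. With $P_\sigma(s)=P(s+\sigma)$, set $\|P\|_{\mathcal{A}^p_\alpha}=\left(\int_0^\infty\|P_\sigma\|_{\mathcal{H}^p}^p\,d\mu_\alpha(\sigma)\right)^{1/p}$;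 $\mathcal{A}^p_\alpha$ is the completion of the Dirichlet polynomials in this norm, which is a Banach space of Dirichlet series on $\mathbb{C}_{1/2}$. For $g\in\mathcal{D}$ and a convergent Dirichlet series $f$, the Volterra operator is $T_gf(s)=-\int_s^\infty f(w)g'(w)\,dw$ (integration along the horizontal half-line, $\mathrm{Re}(s)$ large), again a convergent Dirichlet series. $T_g$ is bounded on a space $X$ if $T_gf\in X$ for all $f\in X$ and $\|T_gf\|_X\lesssim\|f\|_X$. *)

(* Defs.v *)
From HB Require Import structures.
From mathcomp Require Import all_boot all_order all_algebra.
From mathcomp Require Import all_classical all_reals all_analysis.
From mathcomp Require Import complex.
Set Implicit Arguments.
Unset Strict Implicit.
Unset Printing Implicit Defensive.
Import Order.TTheory GRing.Theory Num.Theory.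
Import numFieldNormedType.Exports.
Local Open Scope ring_scope.
Local Open Scope classical_set_scope.
Local Open Scope complex_scope.

(* The complex numbers, as a numFieldType: the generic instances on numFieldType
   provide the topology and the normed-space structure, which are not inferred
   on R[i] itself. *)
Definition Cplx (R : realType) : numFieldType := R[i].

(** * The infinite polytorus and its Haar measure *)

Definition circle (R : realType) := set_type [set z : Cplx R | `|z| = 1].
HB.instance Definition _ (R : realType) := Topological.on (circle R).

Section Circle.
Variable R : realType.
Implicit Types z w : circle R.

Lemma circle1_subproof : (1 : Cplx R) \in [set z : Cplx R | `|z| = 1].
Proof. by rewrite inE /= normr1. Qed.

Definition circle1 : circle R := SigSub circle1_subproof.

HB.instance Definition _ := isPointed.Build (circle R) circle1.

Lemma circleM_subproof z w :
  set_val z * set_val w \in [set z : Cplx R | `|z| = 1].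
Proof.
case: z w => [z hz] [w hw]; rewrite !set_valE /= inE /=.
by move: hz hw; rewrite !inE /= normrM => -> ->; rewrite mulr1.
Qed.

Definition circleM z w : circle R := SigSub (circleM_subproof z w).

End Circle.

(* T^oo with its Borel sigma-algebra (product topology). *)
Definition polytorus (R : realType) :=
  g_sigma_algebraType (@open {ptws nat -> circle R}).

(* The normalized Haar measure m_oo: Borel probability measures on a compact
   metrizable group are regular, so invariance characterizes it. *)
Definition is_haar (R : realType) (m : probability (polytorus R) R) : Prop :=
  forall (w : polytorus R) (A : set (polytorus R)), measurable A ->
    m [set z : polytorus R | A (fun j => circleM (w j) (z j))] = m A.

(** * Dirichlet series and Dirichlet polynomials *)

Section DirichletSeries.
Variable R : realType.
Implicit Types (s : Cplx R) (a f g : nat -> Cplx R) (P : {poly Cplx R}).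

Definition cmod (z : Cplx R) : R := ComplexField.Normc.normc z.

(* n^{-s}, for n >= 1. *)
Definition natpowN (n : nat) s : Cplx R :=
  let r := (n%:R : R) `^ (- complex.Re s) in
  let t := complex.Im s * ln (n%:R : R) in
  (r * cos t) -i* (r * sin t).

(* A Dirichlet series is its coefficient sequence; indices are shifted by one,
   so that [a n] is the coefficient of (n+1)^{-s}. *)
Definition dpartial a s : nat -> Cplx R :=
  series (fun n => a n * natpowN n.+1 s).

Definition dsum a s : Cplx R := limn (dpartial a s).

Definition converges_on (theta : R) a : Prop :=
  forall s, theta < complex.Re s -> cvgn (dpartial a s).

Definition dirichlet a : Prop := exists theta : R, converges_on theta a.

(* Dirichlet polynomials, with the same shift: P`_n is the coefficient of
   (n+1)^{-s}. *)
Definition dpoly_eval P s : Cplx R :=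
  \sum_(n < size P) P`_n * natpowN n.+1 s.

(* P_sigma(s) = P(s + sigma). *)
Definition dpoly_shift P (sigma : R) : {poly Cplx R} :=
  \poly_(n < size P) (P`_n * natpowN n.+1 sigma%:C).

(* The number of primes below q: the zero-based rank of the prime q. *)
Definition prime_rank (q : nat) : nat := count prime (iota 0 q).

Definition bohr_lift P (z : polytorus R) : Cplx R :=
  \sum_(n < size P) P`_n *
    \prod_(q <- primes n.+1) set_val (z (prime_rank q)) ^+ logn q n.+1.

End DirichletSeries.

(** * The spaces A^p_alpha *)

Section BergmanSpace.
Variables (R : realType) (m : probability (polytorus R) R) (p alpha : R).
Implicit Types (P : {poly Cplx R}) (f g h : nat -> Cplx R).

Definition Hnorm P : \bar R :=
  Lnorm m p%:E (fun z => (cmod (bohr_lift P z))%:E).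

Definition Gamma (x : R) : R :=
  \int[lebesgue_measure]_(t in `]0, +oo[) (t `^ (x - 1) * expR (- t)).

(* Density of mu_alpha with respect to Lebesgue measure on ]0, +oo[. *)
Definition mu_density (sigma : R) : R :=
  2 `^ (alpha + 1) / Gamma (alpha + 1) * sigma `^ alpha * expR (- (2 * sigma)).

Definition Anorm P : \bar R :=
  ((\int[lebesgue_measure]_(sigma in `]0%R, +oo[)
      (Hnorm (dpoly_shift P sigma) `^ p * (mu_density sigma)%:E)) `^ p^-1)%E.

Definition Anorm_cauchy (P : nat -> {poly Cplx R}) : Prop :=
  forall e : R, 0 < e -> exists K : nat, forall k l : nat,
    (K <= k)%N -> (K <= l)%N -> (Anorm (P k - P l) < e%:E)%E.

(* f belongs to A^p_alpha and has norm N there. An element of the completion,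
   i.e. the class of a Cauchy sequence of Dirichlet polynomials, is identified
   with its pointwise limit on C_{1/2}, which is the sum of a Dirichlet
   series. *)
Definition Ap_has_norm f (N : R) : Prop :=
  converges_on (1 / 2) f /\
  exists P : nat -> {poly Cplx R},
    [/\ Anorm_cauchy P,
        (forall s : Cplx R, 1 / 2 < complex.Re s ->
          (fun k => dpoly_eval (P k) s) @ \oo --> dsum f s) &
        (fun k => Anorm (P k)) @ \oo --> N%:E].

End BergmanSpace.

(** * Volterra operators and the Bloch space *)

Section Volterra.
Variable R : realType.
Implicit Types f g h : nat -> Cplx R.

(* Integral of F along the half-line { s + x : x >= 0 }. *)
Definition ray_integral (F : Cplx R -> Cplx R) (s : Cplx R) : Cplx R :=
  (\int[lebesgue_measure]_(x in `[0, +oo[) complex.Re (F (s + x%:C))) +i*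
  (\int[lebesgue_measure]_(x in `[0, +oo[) complex.Im (F (s + x%:C))).

(* The Dirichlet series h is T_g f. *)
Definition is_volterra g f h : Prop :=
  exists theta : R,
    [/\ converges_on theta f, converges_on theta g, converges_on theta h &
        forall s : Cplx R, theta < complex.Re s ->
          dsum h s =
          - ray_integral (fun w => dsum f w * derive1 (dsum g) w) s].

Definition volterra_bounded (m : probability (polytorus R) R) (p alpha : R) g
    : Prop :=
  exists C : R, forall f (N : R), Ap_has_norm m p alpha f N ->
    exists h (M : R),
      [/\ is_volterra g f h, Ap_has_norm m p alpha h M & M <= C * N].

(* g, wherever it converges, extends to an analytic function on C_{1/2} in the
   Bloch space. *)
Definition bloch g : Prop :=
  exists G : Cplx R -> Cplx R,
    [/\ (forall theta : R, converges_on theta g -> forall s : Cplx R,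
           theta < complex.Re s -> 1 / 2 < complex.Re s -> G s = dsum g s),
        (forall s : Cplx R, 1 / 2 < complex.Re s -> derivable G s 1) &
        has_ubound [set (complex.Re s - 1 / 2) * cmod (derive1 G s) |
                     s in [set s : Cplx R | 1 / 2 < complex.Re s]]].

End Volterra.

(* Main.v *)
(** Fix s = 1/2 + delta + it, let k be about 1/delta and f(w) = 2^{-kw} F(w), where F is a
    product over primes q of quadratic truncations of (1 - q^{-conj s} q^{-w})^{-2/p}.
    For h = T_g f we have h' = f g', so V(w) = 2^{kw} h(w) satisfies
    V' - (k ln 2) V = F g' and |F(s) g'(s)| is at most C/delta times the supremum of |V|
    near s.  Only the frequencies divisible by 2^k matter for V, and for these
    |V(w)|^p <= (C/delta) 2^{kp eps} ||h(. + eps)||_{H^p}^p for 0 < eps < delta/4: the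
    primes are treated one at a time, and Haar invariance turns the integral over one
    coordinate into an average over roots of unity, to which a truncated Poisson kernel
    applies.  Integrating over eps gives |V(w)|^p <= C delta^{-(alpha+2)} ||h||^p.
    On the other hand the weight 2^{-k eps} gives ||f||^p <= C delta^{alpha+1} e^S, where
    S is the sum of q^{-1-2 delta}, while |F(s)|^p >= c e^{2S} and e^S is about 1/delta;
    altogether |g'(s)| <= C/delta.  Elements of A^p_alpha are reached from Dirichlet
    polynomials by a Vitali-type theorem: if the polynomials are bounded on a half-plane
    and their coefficients tend to 0, then so do their values. *)
Require Import Defs.
From mathcomp Require Import all_boot all_order all_algebra.
From mathcomp Require Import all_classical all_reals all_analysis.
From mathcomp Require Import complex.
From mathcomp Require Import measurable_realfun.
From mathcomp Require Import ring lra zify.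
Import Order.TTheory GRing.Theory Num.Theory.
Import numFieldNormedType.Exports.
Local Open Scope ring_scope.
Set Implicit Arguments.
Unset Strict Implicit.
Unset Printing Implicit Defensive.

Local Open Scope classical_set_scope.
Local Open Scope complex_scope.

(** * Complex analysis of Dirichlet polynomials *)

(** The exponents have to match exactly. Since e^S is of order 1/delta, a bound exp(c S) with c > 1
    in place of c = 1 would lose a power of delta; so the one-variable estimates keep the
    coefficient of r^2 = q^{-2 Re s} sharp and allow only errors of order r^3, which are summable
    because r <= q^{-1/2}. This is why quadratic truncations are enough and why finitely many small
    primes may be treated crudely. The factor 2^{-kw} confines the mass of f to shifts eps of order
    delta, which gains delta^{alpha+1} without changing the exponent 2/p in F. Dividing by it at w
    would cost at least 2^{k/2}; on the polytorus, however, the division is by z_1^k, of modulus 1,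
    so it is carried out there, before the variable of the prime 2 is evaluated. Everything goes
    through coefficients and polynomials: h' = f g' is first an identity of coefficients, obtained
    far to the right, and reaches the point s by the Vitali-type theorem. *)

Section ComplexModulus.
Variable R : realType.
Local Notation C := (Cplx R).
Implicit Types (z w : C).

(** The norm of a [numFieldType] takes values in the field itself; [cmod] is its real-valued form,
    in which the estimates below are stated. *)
Lemma normE z : `|z| = (cmod z)%:C :> C.
Proof. by []. Qed.

Lemma cmod_ge0 z : 0 <= cmod z.
Proof. by case: z => a b; rewrite /cmod /=; exact: sqrtr_ge0. Qed.

Lemma cmodM z w : cmod (z * w) = cmod z * cmod w.
Proof. by apply: complexI; rewrite -normE normrM !normE -rmorphM. Qed.

Lemma ler_cmodD z w : cmod (z + w) <= cmod z + cmod w.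
Proof. by rewrite -lecR rmorphD /= -!normE ler_normD. Qed.

Lemma cmodN z : cmod (- z) = cmod z.
Proof. by apply: complexI; rewrite -!normE normrN. Qed.

Lemma ler_cmodB z w : cmod (z - w) <= cmod z + cmod w.
Proof. by rewrite -(cmodN w) ler_cmodD. Qed.

Lemma cmod_distC z w : cmod (z - w) = cmod (w - z).
Proof. by rewrite -cmodN opprB. Qed.

Lemma cmod0 : cmod (0 : C) = 0.
Proof. by apply: complexI; rewrite -normE normr0. Qed.

Lemma cmod1 : cmod (1 : C) = 1.
Proof. by apply: complexI; rewrite -normE normr1. Qed.

Lemma cmod_eq0 z : (cmod z == 0) = (z == 0).
Proof.
by rewrite -(inj_eq (@complexI R)) -normE normr_eq0.
Qed.

Lemma cmodX z n : cmod (z ^+ n) = cmod z ^+ n.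
Proof. by elim: n => [|n IH]; rewrite ?expr0 ?cmod1 // !exprS cmodM IH. Qed.

Lemma cmodV z : cmod (z^-1) = (cmod z)^-1.
Proof.
have [->|z0] := eqVneq z 0; first by rewrite invr0 cmod0 invr0.
have h : cmod z != 0 by rewrite cmod_eq0.
by apply: (mulIf h); rewrite -cmodM !mulVf // cmod1.
Qed.

Lemma cmod_real (x : R) : cmod (x%:C : C) = `|x|.
Proof. by rewrite /cmod /= expr0n /= addr0 sqrtr_sqr. Qed.

Lemma cmod_nat n : cmod (n%:R : C) = n%:R.
Proof. by rewrite -(rmorph_nat (@real_complex R)) cmod_real ger0_norm. Qed.

Lemma cmod_sum (I : Type) (r : seq I) (P : pred I) (F : I -> C) :
  cmod (\sum_(i <- r | P i) F i) <= \sum_(i <- r | P i) cmod (F i).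
Proof.
elim/big_ind2: _ => //; first by rewrite cmod0.
by move=> a b c d h1 h2; apply: (le_trans (ler_cmodD _ _)); exact: lerD.
Qed.

Lemma cmodE z : cmod z = Num.sqrt (complex.Re z ^+ 2 + complex.Im z ^+ 2).
Proof. by case: z. Qed.

Lemma cmod_sqr z : cmod z ^+ 2 = complex.Re z ^+ 2 + complex.Im z ^+ 2.
Proof. by rewrite cmodE sqr_sqrtr // addr_ge0 // sqr_ge0. Qed.

Lemma Re_le_cmod z : `|complex.Re z| <= cmod z.
Proof. by rewrite cmodE -sqrtr_sqr ler_wsqrtr // lerDl sqr_ge0. Qed.

Lemma Im_le_cmod z : `|complex.Im z| <= cmod z.
Proof. by rewrite cmodE -sqrtr_sqr ler_wsqrtr // lerDr sqr_ge0. Qed.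

Lemma complex_eta z : z = (complex.Re z)%:C + 'i%C * (complex.Im z)%:C.
Proof. by case: z => a b; apply/eqP; rewrite eq_complex /=; apply/andP; split; apply/eqP; ring. Qed.

Lemma cmod_i : cmod ('i%C : C) = 1.
Proof. by rewrite cmodE /= expr0n /= add0r expr1n sqrtr1. Qed.

Lemma cmod_le_ReIm z : cmod z <= `|complex.Re z| + `|complex.Im z|.
Proof.
by rewrite {1}(complex_eta z) (le_trans (ler_cmodD _ _)) // cmodM cmod_i mul1r !cmod_real.
Qed.

Lemma ReD z w : complex.Re (z + w) = complex.Re z + complex.Re w.
Proof. by case: z; case: w. Qed.
Lemma ImD z w : complex.Im (z + w) = complex.Im z + complex.Im w.
Proof. by case: z; case: w. Qed.
Lemma ReB z w : complex.Re (z - w) = complex.Re z - complex.Re w.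
Proof. by case: z; case: w. Qed.
Lemma ImB z w : complex.Im (z - w) = complex.Im z - complex.Im w.
Proof. by case: z; case: w. Qed.
Lemma ReM z w : complex.Re (z * w) =
  complex.Re z * complex.Re w - complex.Im z * complex.Im w.
Proof. by case: z; case: w. Qed.
Lemma ImM z w : complex.Im (z * w) =
  complex.Re z * complex.Im w + complex.Im z * complex.Re w.
Proof. by case: z; case: w => a b c d; rewrite /= addrC //. Qed.
Lemma Re_sum (I : Type) (r : seq I) (P : pred I) (F : I -> C) :
  complex.Re (\sum_(i <- r | P i) F i) = \sum_(i <- r | P i) complex.Re (F i).
Proof. exact: (big_morph _ ReD). Qed.
Lemma Im_sum (I : Type) (r : seq I) (P : pred I) (F : I -> C) :
  complex.Im (\sum_(i <- r | P i) F i) = \sum_(i <- r | P i) complex.Im (F i).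
Proof. exact: (big_morph _ ImD). Qed.

Lemma cvg_cmodP (T : Type) (F : set_system T) (f : T -> C) (l : C) :
  Filter F ->
  (f @ F --> l) <-> (forall e : R, 0 < e -> \forall x \near F, cmod (l - f x) < e).
Proof.
move=> FF; split=> [h e e0|h].
  have e0' : 0 < e%:C :> C by rewrite ltcR.
  have /cvgrPdist_lt /(_ _ e0') := h.
  by apply: filterS => x; rewrite normE ltcR.
apply/cvgrPdist_lt => e e0.
(* A positive element of [C] is real, so real radii suffice. *)
have eE : e = (complex.Re e)%:C by case: e e0 => a b /=; rewrite ltcE /= => /andP[/eqP -> _].
have e0' : 0 < complex.Re e by rewrite -ltcR -eE.
by have := h _ e0'; apply: filterS => x; rewrite normE eE ltcR.
Qed.

Lemma ler_cmod_dist z w : `|cmod z - cmod w| <= cmod (z - w).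
Proof.
have h (a b : C) : cmod a - cmod b <= cmod (a - b).
  by rewrite lerBlDr; apply: le_trans (ler_cmodD _ _); rewrite subrK.
by rewrite ler_norml h lerNl opprB cmod_distC h.
Qed.

Lemma cvg_cmod (T : Type) (F : set_system T) (f : T -> C) (l : C) :
  Filter F -> f @ F --> l -> (fun x => cmod (f x)) @ F --> cmod l.
Proof.
move=> FF /cvg_cmodP h; apply/cvgrPdist_lt => e e0.
have := h _ e0; apply: filterS => x; apply: le_lt_trans.
exact: ler_cmod_dist.
Qed.

Lemma cvg_cmod0P (u : nat -> C) (l : C) :
  (u @ \oo --> l) <-> ((fun n => cmod (u n - l)) @ \oo --> (0 : R)).
Proof.
split=> [/cvg_cmodP h|/cvgrPdist_lt h].
  apply/cvgrPdist_lt => e e0; have := h e e0; apply: filterS => n.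
  by rewrite sub0r normrN ger0_norm ?cmod_ge0 // cmod_distC.
apply/cvg_cmodP => e e0; have := h e e0; apply: filterS => n.
by rewrite sub0r normrN ger0_norm ?cmod_ge0 // cmod_distC.
Qed.

Lemma cvg_ReIm (u : nat -> C) (a b : R) :
  (fun n => complex.Re (u n)) @ \oo --> a ->
  (fun n => complex.Im (u n)) @ \oo --> b -> u @ \oo --> (a +i* b : C).
Proof.
move=> ha hb; apply/cvg_cmodP => e e0.
have e2 : 0 < e / 2 by rewrite divr_gt0.
move/cvgrPdist_lt/(_ _ e2): ha => ha; move/cvgrPdist_lt/(_ _ e2): hb => hb.
near=> n; apply: le_lt_trans (cmod_le_ReIm _) _.
rewrite ReB ImB /= [e]splitr; apply: ltrD; [near: n; exact: ha|near: n; exact: hb].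
Unshelve. all: end_near.
Qed.

Lemma cvg_Re (u : nat -> C) (l : C) :
  u @ \oo --> l -> (fun n => complex.Re (u n)) @ \oo --> complex.Re l.
Proof.
move=> /cvg_cmodP h; apply/cvgrPdist_lt => e e0.
by have := h _ e0; apply: filterS => n; rewrite -ReB; apply: le_lt_trans; exact: Re_le_cmod.
Qed.

Lemma cvg_Im (u : nat -> C) (l : C) :
  u @ \oo --> l -> (fun n => complex.Im (u n)) @ \oo --> complex.Im l.
Proof.
move=> /cvg_cmodP h; apply/cvgrPdist_lt => e e0.
by have := h _ e0; apply: filterS => n; rewrite -ImB; apply: le_lt_trans; exact: Im_le_cmod.
Qed.

Lemma cauchy_complex (u : nat -> C) :
  (forall e : R, 0 < e -> exists K : nat, forall k l : nat,
    (K <= k)%N -> (K <= l)%N -> cmod (u k - u l) < e) -> exists l : C, u @ \oo --> l.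
Proof.
move=> h.
have key (f : C -> R) : (forall z w, `|f z - f w| <= cmod (z - w)) ->
    cvgn (f \o u).
  move=> hf; apply: cauchy_cvg; apply: cauchy_exP => e e0.
  have [K hK] := h e e0.
  exists (f (u K)); exists K => // n /= Kn.
  by apply: le_lt_trans (hf _ _) _; exact: hK.
have hre := key (@complex.Re R); have him := key (@complex.Im R).
exists (lim ((@complex.Re R \o u) @ \oo) +i* lim ((@complex.Im R \o u) @ \oo)).
apply: cvg_ReIm; [apply: hre|apply: him] => z w.
  by rewrite -ReB Re_le_cmod.
by rewrite -ImB Im_le_cmod.
Qed.

(** A quadratic bound on the Taylor remainder survives pointwise limits, unlike a limit of
    difference quotients; complex differentiability is therefore obtained in this form. *)
Lemma derivable_quadratic (G : C -> C) (s L : C) (K r : R) : 0 < r ->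
  (forall z, cmod z <= r -> cmod (G (s + z) - G s - z * L) <= K * cmod z ^+ 2) ->
  derivable G s 1 /\ derive1 G s = L.
Proof.
move=> r0 h.
have hc : (fun z : C => z^-1 *: (G (z + s) - G s)) @ 0^' --> L.
  apply/cvg_cmodP => e e0.
  near=> z.
  have z0 : z != 0 by near: z; exact: nbhs_dnbhs_neq.
  have zc : 0 < cmod z by rewrite lt_neqAle eq_sym cmod_eq0 z0 cmod_ge0.
  have zr : cmod z < Num.min r (e / (`|K| + 1)).
    near: z.
    have m0 : 0 < Num.min r (e / (`|K| + 1)).
      by rewrite lt_min r0 divr_gt0 // ltr_wpDl.
    apply: nbhs_dnbhs.
    have := (cvg_id : (fun z : C => z) @ (0 : C) --> (0 : C)).
    by move/cvg_cmodP => /(_ _ m0); apply: filterS => z; rewrite sub0r cmodN.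
  move: zr; rewrite lt_min => /andP[zr ze].
  rewrite -(ltr_pM2l zc) -cmodM.
  have -> : z * (L - z^-1 *: (G (z + s) - G s)) = - (G (s + z) - G s - z * L).
    have E (y : C) : z * (z^-1 *: y) = y.
      by rewrite -[z^-1 *: y]/(z^-1 * y) mulrA mulfV // mul1r.
    by rewrite mulrBr E (addrC z s); ring.
  rewrite cmodN (le_lt_trans (h _ (ltW zr))) // expr2 mulrA mulrC ltr_pM2l //.
  rewrite (le_lt_trans (_ : _ <= (`|K| + 1) * cmod z)) //.
    by rewrite ler_wpM2r ?cmod_ge0 // (le_trans (ler_norm _)) // lerDl.
  by rewrite mulrC -ltr_pdivlMr // ltr_wpDl.
have hd : is_derive s 1 G L.
  apply: DeriveDef.
    apply: (cvgP L); move: hc; apply: cvg_trans; apply: near_eq_cvg; near=> z.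
    by rewrite /= /GRing.scale /= mulr1.
  apply/cvg_lim => //.
  move: hc; apply: cvg_trans; apply: near_eq_cvg; near=> z.
  by rewrite /= /GRing.scale /= mulr1.
split; first by apply: ex_derive.
rewrite derive1E; exact: derive_val.
Unshelve. all: end_near.
Qed.

End ComplexModulus.


(** * The complex exponential, its Taylor remainder, and roots of unity *)

Section ComplexExponential.
Variable R : realType.
Local Notation C := (Cplx R).
Implicit Types (z w : C) (t : R).

Definition cexp z : C :=
  (expR (complex.Re z) * cos (complex.Im z)) +i*
  (expR (complex.Re z) * sin (complex.Im z)).

Lemma cexpD z w : cexp (z + w) = cexp z * cexp w.
Proof.
rewrite {1}/cexp ReD ImD expRD cosD sinD.
apply/eqP; rewrite eq_complex ReM ImM /=.
by apply/andP; split; apply/eqP; ring.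
Qed.

Lemma cexp0 : cexp 0 = 1.
Proof. by rewrite /cexp /= expR0 cos0 sin0 mulr1 mulr0. Qed.

Lemma cmod_cexp z : cmod (cexp z) = expR (complex.Re z).
Proof.
rewrite cmodE /= !exprMn -mulrDr cos2Dsin2 mulr1 sqrtr_sqr ger0_norm //.
Qed.

Lemma cexp_mulrn z n : cexp (z *+ n) = cexp z ^+ n.
Proof. by elim: n => [|n IH]; rewrite ?mulr0n ?cexp0 // mulrS cexpD IH exprS. Qed.

Lemma ge0_derive_ndecr01 (f df : R -> R) : (forall x : R, is_derive x 1 f (df x)) ->
  (forall x, 0 <= x <= 1 -> 0 <= df x) -> forall t, 0 <= t <= 1 -> f 0 <= f t.
Proof.
move=> fd df0 t /andP[t0 t1].
have [|c] := @MVT_segment _ f df 0 t t0 (fun x _ => fd x).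
- apply: continuous_subspaceT => x; apply: differentiable_continuous.
  exact/derivable1_diffP.
rewrite in_itv /= => /andP[c0 ct] h.
rewrite -subr_ge0 h subr0 mulr_ge0 // df0 // c0 /=; exact: le_trans ct t1.
Qed.

(** Keeping the coefficients apart from t^j / j! turns differentiation in [t] into a shift of
    [c]. *)
Definition taylor_sum (c : nat -> R) J t := \sum_(j < J) c j * (t ^+ j / j`!%:R).

Lemma is_derive_monomial (k : R) n t :
  is_derive t 1 (fun u : R => k * u ^+ n.+1) (k * n.+1%:R * t ^+ n).
Proof.
have h : is_derive t 1 (fun u : R => u ^+ n.+1) (n.+1%:R * t ^+ n).
  rewrite (_ : (fun u : R => _) = (@id R) ^+ n.+1); last first.
    by apply/funext => u; rewrite exprfctE.
  have := @is_deriveX R R id n.+1 t 1 1 (is_derive_id _ _).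
  by rewrite /GRing.scale /= mulr1.
by rewrite -mulrA; exact: (@is_deriveZ _ _ _ (fun u : R => u ^+ n.+1) k).
Qed.

Lemma is_derive_taylor_sum c J t :
  is_derive t 1 (taylor_sum c J.+1) (taylor_sum (fun j => c j.+1) J t).
Proof.
elim: J => [|J IH].
  rewrite /taylor_sum big_ord0.
  rewrite (_ : (fun t => _) = cst (c 0%N)); first exact: is_derive_cst.
  by apply/funext => u; rewrite big_ord1 expr0 divr1 mulr1.
rewrite (_ : taylor_sum c J.+2 = taylor_sum c J.+1 +
   (fun u : R => c J.+1 / (J.+1)`!%:R * u ^+ J.+1)); last first.
  apply/funext => u; rewrite /taylor_sum big_ord_recr /= !fctE; congr (_ + _).
  by ring.
rewrite {2}/taylor_sum big_ord_recr /= -/(taylor_sum _ _ _).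
apply: is_deriveD; apply: (is_derive_eq (is_derive_monomial _ _ _)).
rewrite factS natrM invfM.
have h : (J.+1%:R^-1 * J.+1%:R : R) = 1 by rewrite mulVf // pnatr_eq0.
have H (a b x d e : R) : a * b = 1 -> e * (a * x) * b * d = e * (d * x).
  by move=> E; transitivity (e * (d * x) * (a * b)); [ring|rewrite E mulr1].
by rewrite H.
Qed.

(** Real and imaginary parts of exp(tz) as functions of the real variable [t]; together they satisfy
    a linear differential system. *)
Let expcos z t := expR (t * complex.Re z) * cos (t * complex.Im z).
Let expsin z t := expR (t * complex.Re z) * sin (t * complex.Im z).

Lemma is_derive_expcos z t : is_derive t 1 (expcos z)
  (complex.Re z * expcos z t - complex.Im z * expsin z t).
Proof.
rewrite /expcos /expsin; apply: is_derive_eq.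
rewrite /GRing.scale /= !mulr1; ring.
Qed.

Lemma is_derive_expsin z t : is_derive t 1 (expsin z)
  (complex.Re z * expsin z t + complex.Im z * expcos z t).
Proof.
rewrite /expcos /expsin; apply: is_derive_eq.
rewrite /GRing.scale /= !mulr1; ring.
Qed.

(** Induction on [J]: the remainders of order [J.+1] vanish at 0, and their derivatives combine the
    remainders of order [J] with coefficients Re z and Im z. Each coefficient is at most |z|, whence
    the base 2|z|; monotonicity on [0, 1] replaces integration. *)
Lemma cexp_taylor_bound z J t : 0 <= t <= 1 ->
  `|expcos z t - taylor_sum (fun j => complex.Re (z ^+ j)) J t| <=
    expR (cmod z) * ((2 * cmod z) ^+ J * (t ^+ J / J`!%:R)) /\
  `|expsin z t - taylor_sum (fun j => complex.Im (z ^+ j)) J t| <=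
    expR (cmod z) * ((2 * cmod z) ^+ J * (t ^+ J / J`!%:R)).
Proof.
elim: J t => [|J IH] t t01.
  rewrite /taylor_sum !big_ord0 !subr0 !expr0 divr1 !mulr1.
  have h : expR (t * complex.Re z) <= expR (cmod z).
    rewrite ler_expR; apply: le_trans (ler_norm _) _.
    case/andP: t01 => t0 t1; rewrite normrM (ger0_norm t0).
    by rewrite (le_trans _ (Re_le_cmod z)) // ler_piMl.
  have g (x : R) : `|x| <= 1 -> `|expR (t * complex.Re z) * x| <= expR (cmod z).
    move=> x1; rewrite normrM ger0_norm ?expR_ge0 // (le_trans _ h) //.
    by rewrite ler_piMr ?expR_ge0.
  by split; apply: g; [exact: cos_max|exact: sin_max].
set c := cmod z in IH *.
have c0 : 0 <= c by exact: cmod_ge0.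
pose rho k u := expR c * ((2 * c) ^+ k * (u ^+ k / k`!%:R)).
have drho (u : R) : is_derive u 1 (rho J.+1) (2 * c * rho J u).
  rewrite (_ : rho J.+1 = fun u : R => (expR c * (2 * c) ^+ J.+1 / (J.+1)`!%:R) * u ^+ J.+1).
    apply: (is_derive_eq (is_derive_monomial _ _ _)); rewrite /rho factS natrM invfM exprS.
    have h : (J.+1%:R^-1 * J.+1%:R : R) = 1 by rewrite mulVf // pnatr_eq0.
    have H (a b x d e : R) : a * b = 1 -> e * (a * x) * b * d = e * (d * x).
      by move=> E; transitivity (e * (d * x) * (a * b)); [ring|rewrite E mulr1].
    rewrite (H _ _ _ _ _ h).
    by move: (expR c) ((2 * c) ^+ J) (u ^+ J) (J`!%:R^-1) => A B D E; ring.
  by apply/funext => v; rewrite /rho; ring.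
have rho0 : rho J.+1 0 = 0 by rewrite /rho expr0n /= !mul0r !mulr0.
have key (f df : R -> R) : (forall u : R, is_derive u 1 f (df u)) -> f 0 = 0 ->
    (forall u, 0 <= u <= 1 -> `|df u| <= 2 * c * rho J u) ->
    `|f t| <= rho J.+1 t.
  move=> fd f0 hdf; rewrite ler_norml; apply/andP; split.
    have := @ge0_derive_ndecr01 (rho J.+1 + f) (fun u => 2 * c * rho J u + df u) _ _ t t01.
    rewrite !fctE f0 rho0 addr0 lerNl => h; rewrite -subr_ge0 opprK; apply: h.
    by move=> u /hdf; rewrite ler_norml => /andP[]; rewrite -subr_ge0 opprK addrC.
  have := @ge0_derive_ndecr01 (rho J.+1 - f) (fun u => 2 * c * rho J u - df u) _ _ t t01.
  rewrite !fctE f0 rho0 subr0 => h; rewrite -subr_ge0; apply: h.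
  by move=> u /hdf; rewrite ler_norml => /andP[_]; rewrite subr_ge0.
have z2 (a b : R) u : `|a| <= rho J u -> `|b| <= rho J u ->
    `|complex.Re z * a| + `|complex.Im z * b| <= 2 * c * rho J u.
  move=> ha hb; rewrite !normrM (_ : 2 * c * rho J u = c * rho J u + c * rho J u); last by ring.
  by apply: lerD; apply: ler_pM => //; [exact: Re_le_cmod|exact: Im_le_cmod].
split.
- pose a k u := expcos z u - taylor_sum (fun j => complex.Re (z ^+ j)) k u.
  pose b k u := expsin z u - taylor_sum (fun j => complex.Im (z ^+ j)) k u.
  apply: (key (a J.+1) (fun u => complex.Re z * a J u - complex.Im z * b J u)).
  + move=> u; rewrite /a.
    have E : is_derive u 1 (expcos z - taylor_sum (fun j => complex.Re (z ^+ j)) J.+1)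
      (complex.Re z * expcos z u - complex.Im z * expsin z u - taylor_sum (fun j => complex.Re (z ^+ j.+1)) J u).
      by apply: is_deriveB; [exact: is_derive_expcos|exact: is_derive_taylor_sum].
    apply: (is_derive_eq E); rewrite /b !mulrBr.
    rewrite (_ : taylor_sum _ J u = complex.Re z * taylor_sum (fun j => complex.Re (z ^+ j)) J u -
       complex.Im z * taylor_sum (fun j => complex.Im (z ^+ j)) J u); first ring.
    rewrite /taylor_sum !mulr_sumr -sumrB; apply: eq_bigr => j _.
    by rewrite exprS ReM; ring.
  + rewrite /a /expcos !mul0r expR0 cos0 mulr1 /taylor_sum big_ord_recl /= !expr0 divr1 mulr1 big1 ?addr0 ?subrr //.
    by move=> i _; rewrite expr0n /= mul0r mulr0.
  + move=> u /IH[ha hb]; apply: le_trans (ler_normB _ _) _; exact: z2.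
- pose a k u := expcos z u - taylor_sum (fun j => complex.Re (z ^+ j)) k u.
  pose b k u := expsin z u - taylor_sum (fun j => complex.Im (z ^+ j)) k u.
  apply: (key (b J.+1) (fun u => complex.Re z * b J u + complex.Im z * a J u)).
  + move=> u; rewrite /b.
    have E : is_derive u 1 (expsin z - taylor_sum (fun j => complex.Im (z ^+ j)) J.+1)
      (complex.Re z * expsin z u + complex.Im z * expcos z u - taylor_sum (fun j => complex.Im (z ^+ j.+1)) J u).
      by apply: is_deriveB; [exact: is_derive_expsin|exact: is_derive_taylor_sum].
    apply: (is_derive_eq E); rewrite /a !mulrBr.
    rewrite (_ : taylor_sum _ J u = complex.Re z * taylor_sum (fun j => complex.Im (z ^+ j)) J u +
       complex.Im z * taylor_sum (fun j => complex.Re (z ^+ j)) J u); first ring.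
    rewrite /taylor_sum !mulr_sumr -big_split; apply: eq_bigr => j _ /=.
    by rewrite exprS ImM; ring.
  + rewrite /b /expsin !mul0r expR0 sin0 mulr0 /taylor_sum big_ord_recl /= !expr0 divr1 mulr1 big1 ?addr0 ?subrr //.
    by move=> i _; rewrite expr0n /= mul0r mulr0.
  + move=> u /IH[ha hb]; apply: le_trans (ler_normD _ _) _; exact: z2.
Qed.

Lemma cexp_taylor z J :
  cmod (cexp z - \sum_(j < J) z ^+ j / j`!%:R) <=
    2 * expR (cmod z) * (2 * cmod z) ^+ J / J`!%:R.
Proof.
have [|h1 h2] := @cexp_taylor_bound z J 1; first by rewrite ler01 lexx.
apply: le_trans (cmod_le_ReIm _) _.
have E (f : C -> R) (c : nat -> R) : (forall j, f (z ^+ j / j`!%:R) = c j / j`!%:R) ->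
   \sum_(j < J) f (z ^+ j / j`!%:R) = taylor_sum c J 1.
  by move=> h; apply: eq_bigr => j _; rewrite h expr1n mul1r.
have inv (j : nat) : (j`!%:R : C)^-1 = (j`!%:R^-1)%:C by rewrite fmorphV rmorph_nat.
rewrite ReB ImB Re_sum Im_sum.
rewrite (E _ (fun j => complex.Re (z ^+ j))); last by move=> j; rewrite inv ReM /= mulr0 subr0.
rewrite (E _ (fun j => complex.Im (z ^+ j))); last by move=> j; rewrite inv ImM /= mulr0 add0r mulrC.
move: h1 h2; rewrite /expcos /expsin !mul1r /= => h1 h2.
apply: le_trans (lerD h1 h2) _; rewrite expr1n mul1r.
by rewrite le_eqVlt; apply/orP; left; apply/eqP; ring.
Qed.

Lemma natpowNE n (s : C) : (0 < n)%N ->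
  natpowN n s = cexp (- (s * (ln (n%:R : R))%:C)).
Proof.
move=> n0; rewrite /natpowN /cexp.
have -> : complex.Re (- (s * (ln (n%:R : R))%:C)) = - complex.Re s * ln (n%:R : R).
  by case: s => a b /=; ring.
have -> : complex.Im (- (s * (ln (n%:R : R))%:C)) = - (complex.Im s * ln (n%:R : R)).
  by case: s => a b /=; ring.
rewrite cosN sinN mulrN /powR pnatr_eq0.
by case: eqP n0 => // ->.
Qed.

Lemma cos_mulr2n_neq1 (x : R) : 0 < x < pi -> cos (x *+ 2) != 1.
Proof.
move=> /sin_gt0_pi sx; rewrite cos_mulr2n cos2sin2.
have h : 0 < sin x ^+ 2 by rewrite exprn_gt0.
by apply/eqP => e; move: h; lra.
Qed.

Lemma root_of_unity N : (0 < N)%N ->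
  exists w : C, [/\ cmod w = 1, w ^+ N = 1 & forall j, (0 < j < N)%N -> w ^+ j != 1].
Proof.
move=> N0; have [P PE] : exists P : R, P = pi by exists pi.
have P0 : 0 < P by rewrite PE pi_gt0.
pose th : R := P *+ 2 / N%:R.
have pw j : cexp (0 +i* th) ^+ j = cos (th *+ j) +i* sin (th *+ j).
  rewrite -cexp_mulrn /cexp.
  have -> : (0 +i* th : C) *+ j = 0 +i* (th *+ j).
    elim: j => [|j IH]; rewrite ?mulr0n // !mulrS IH.
    by apply/eqP; rewrite eq_complex /= add0r !eqxx.
  by rewrite /= expR0 !mul1r.
have NR : (N%:R : R) != 0 by rewrite pnatr_eq0 -lt0n.
exists (cexp (0 +i* th)); split.
- by rewrite cmod_cexp expR0.
- by rewrite pw -mulr_natr divfK // PE cos2pi sin2pi.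

move=> j /andP[j0 jN]; rewrite pw; apply/negP; rewrite eq_complex /= => /andP[/eqP h _].
have xE : th *+ j = (P * j%:R / N%:R) *+ 2.
  by rewrite /th -(mulr_natr _ 2) -(mulr_natr _ j) -(mulr_natr _ 2); ring.
have xp : 0 < (P * j%:R / N%:R : R) < P.
  rewrite divr_gt0 ?mulr_gt0 ?P0 ?ltr0n //=.
  by rewrite ltr_pdivrMr ?ltr0n // ltr_pM2l // ltr_nat.
rewrite PE in xp.
by move: h; rewrite xE PE => /eqP; rewrite (negPf (cos_mulr2n_neq1 xp)).
Qed.

Lemma sum_root_of_unity N (w : C) j : (0 < N)%N -> w ^+ N = 1 ->
  (forall j, (0 < j < N)%N -> w ^+ j != 1) ->
  \sum_(k < N) (w ^+ k) ^+ j = if (N %| j)%N then N%:R else 0.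
Proof.
move=> N0 wN wj; case: ifPn => [/dvdnP[q ->]|ndvd].
  rewrite (eq_bigr (fun=> 1)); first by rewrite sumr_const card_ord.
  by move=> k _; rewrite -exprM mulnA exprM -exprM mulnC exprM wN expr1n.
have v1 : w ^+ j != 1.
  rewrite (divn_eq j N) exprD mulnC exprM wN expr1n mul1r; apply: wj.
  by rewrite ltn_mod N0 andbT lt0n; move: ndvd; rewrite /dvdn.
rewrite (eq_bigr (fun k : 'I_N => (w ^+ j) ^+ k)); last first.
  by move=> k _; rewrite -!exprM mulnC.
have h : w ^+ j - 1 != 0 by rewrite subr_eq0.
by apply: (mulfI h); rewrite -subrX1 -exprM mulnC exprM wN expr1n subrr mulr0.
Qed.

Lemma sum_expr_cmod_le (w : C) L : cmod w = 1 -> w != 1 ->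
  cmod (\sum_(k < L) w ^+ k) <= 2 / cmod (w - 1).
Proof.
move=> w1 wn1; have h : 0 < cmod (w - 1) by rewrite lt_neqAle eq_sym cmod_eq0 subr_eq0 wn1 cmod_ge0.
rewrite ler_pdivlMr // -cmodM mulrC -subrX1.
by apply: le_trans (ler_cmodB _ _) _; rewrite cmodX w1 expr1n cmod1.
Qed.

End ComplexExponential.


(** * Cauchy estimates for finite exponential sums *)

Section ExponentialSums.
Variable R : realType.
Local Notation C := (Cplx R).
Implicit Types (z w s : C) (t : R) (c : nat -> C) (lam : nat -> R).

(** With logarithms for [lam], a Dirichlet polynomial recentred at a point. [expsum_coef] gives its
    Taylor coefficients at 0, and [expsum_err] bounds the Taylor remainder on the disc of radius
    [rho]. *)
Definition expsum N c lam z : C :=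
  \sum_(n < N) c n * cexp (- (z * (lam n)%:C)).

Definition expsum_coef N c lam m : C :=
  \sum_(n < N) c n * ((- lam n)%:C ^+ m / m`!%:R).

Definition expsum_err N c lam (rho : R) J : R :=
  \sum_(n < N) cmod (c n) *
    (2 * expR (rho * `|lam n|) * (2 * (rho * `|lam n|)) ^+ J / J`!%:R).

Lemma expsum_err_cvg N c lam rho : expsum_err N c lam rho @ \oo --> (0 : R).
Proof.
rewrite /expsum_err.
have h (n : 'I_N) : (fun J => cmod (c n) *
    (2 * expR (rho * `|lam n|) * (2 * (rho * `|lam n|)) ^+ J / J`!%:R)) @ \oo --> (0 : R).
  rewrite -[X in _ --> X](mulr0 (cmod (c n) * (2 * expR (rho * `|lam n|)))).
  under eq_fun do rewrite -mulrA mulrA.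
  apply: cvgMr.
  exact: (cvg_series_cvg_0 (is_cvg_series_exp_coeff _)).
rewrite -[X in _ --> X](_ : \sum_(n < N) 0 = 0); last by rewrite big1.
rewrite -[X in X @ _ --> _](_ : \sum_(n < N) (fun J => cmod (c n) *
    (2 * expR (rho * `|lam n|) * (2 * (rho * `|lam n|)) ^+ J / J`!%:R)) = _); last first.
  by apply/funext => J; rewrite fct_sumE.
elim/big_ind2: _ => //; first exact: cvg_cst.
by move=> f a g b fa gb; exact: cvgD.
Qed.

Lemma expsum_taylor N c lam rho z J : cmod z <= rho ->
  cmod (expsum N c lam z - \sum_(m < J) expsum_coef N c lam m * z ^+ m) <=
    expsum_err N c lam rho J.
Proof.
move=> zr.
have -> : \sum_(m < J) expsum_coef N c lam m * z ^+ m =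
    \sum_(n < N) c n * \sum_(m < J) (- (z * (lam n)%:C)) ^+ m / m`!%:R.
  under eq_bigr do rewrite mulr_suml.
  rewrite exchange_big /=; apply: eq_bigr => n _; rewrite mulr_sumr.
  apply: eq_bigr => m _; rewrite -mulrN exprMn rmorphN.
  by rewrite -!mulrA; congr (_ * _); rewrite mulrCA mulrC -mulrA mulrCA mulrC -mulrA.
rewrite -sumrB; apply: le_trans (cmod_sum _ _ _) _; apply: ler_sum => n _.
rewrite -mulrBr cmodM ler_wpM2l ?cmod_ge0 //.
apply: le_trans (cexp_taylor _ _) _.
have h : cmod (- (z * (lam n)%:C)) <= rho * `|lam n|.
  by rewrite cmodN cmodM cmod_real ler_wpM2r.
rewrite ler_wpM2r ?invr_ge0 //; apply: ler_pM.
- by rewrite mulr_ge0 ?expR_ge0.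
- by rewrite exprn_ge0 // mulr_ge0 // cmod_ge0.
- by rewrite ler_wpM2l // ler_expR.
- have h0 := le_trans (cmod_ge0 _) h.
  by rewrite lerXn2r ?nnegrE ?ler_wpM2l // mulr_ge0 // cmod_ge0.
Qed.

(** The contour integral of Cauchy's formula is replaced by the average over [J]-th roots of unity
    on the circle of radius [r]: on the Taylor polynomial of degree below [J] it isolates the
    coefficient [m] exactly, and the remainder vanishes as [J] grows. *)
Lemma expsum_cauchy N c lam (r M : R) m : 0 <= r ->
  (forall z, cmod z <= r -> cmod (expsum N c lam z) <= M) ->
  cmod (expsum_coef N c lam m) * r ^+ m <= M.
Proof.
move=> r0 hM; apply/ler_addgt0Pr => e e0.
have /cvgrPdist_lt /(_ _ e0) h := expsum_err_cvg N c lam r.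
near \oo => J.
have Jm : (m < J)%N by near: J; exact: nbhs_infty_gt.
have J0 : (0 < J)%N by exact: leq_ltn_trans Jm.
have eJ : expsum_err N c lam r J < e.
  have : `|0 - expsum_err N c lam r J| < e by near: J.
  by rewrite sub0r normrN; apply: le_lt_trans; exact: ler_norm.
have [w [w1 wJ wj]] := root_of_unity R J0.
have wk k : cmod (w ^+ k) = 1 by rewrite cmodX w1 expr1n.
have w0 : w != 0 by rewrite -cmod_eq0 w1 oner_eq0.
pose z k : C := w ^+ k * r%:C.
have zr k : cmod (z k) <= r by rewrite cmodM wk mul1r cmod_real ger0_norm.
(* [w ^+ (J - m)] plays the role of the inverse of [w ^+ m]. *)
have E : \sum_(k < J) (w ^+ k) ^+ (J - m) *
    \sum_(i < J) expsum_coef N c lam i * z k ^+ i = J%:R * (expsum_coef N c lam m * r%:C ^+ m).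
  under eq_bigr do rewrite mulr_sumr.
  rewrite exchange_big /= (bigD1 (Ordinal Jm)) //= [X in _ + X]big1; last first.
    move=> i im; transitivity ((expsum_coef N c lam i * r%:C ^+ i) * \sum_(k < J) (w ^+ k) ^+ (J - m + i)).
      rewrite mulr_sumr; apply: eq_bigr => k _.
      by rewrite /z exprMn exprD; ring.
    rewrite sum_root_of_unity // ifN ?mulr0 //.
    have iJ := ltn_ord i; apply/negP => /dvdnP[q hq].
    have im' : (i : nat) <> m by move=> e'; move/eqP: im; apply; exact: val_inj.
    (* [J] is the only multiple of [J] in this range, and it forces [i = m]. *)
    have : (0 < J - m + i < J.*2)%N by rewrite -addnn; lia.
    by rewrite hq; case: q hq => [|[|q]] hq; rewrite ?mul0n //; lia.
  rewrite addr0.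
  transitivity (\sum_(k < J) expsum_coef N c lam m * r%:C ^+ m).
      apply: eq_bigr => k _.
      have E1 : (w ^+ k) ^+ (J - m) * (w ^+ k) ^+ m = 1.
        by rewrite -exprD subnK ?(ltnW Jm) // -exprM mulnC exprM wJ expr1n.
      by rewrite /z exprMn -[RHS]mul1r -E1; ring.
    by rewrite sumr_const card_ord mulr_natl.
have JR : 0 < (J%:R : R) by rewrite ltr0n.
rewrite -(ler_pM2l JR).
have -> : J%:R * (cmod (expsum_coef N c lam m) * r ^+ m) =
    cmod (J%:R * (expsum_coef N c lam m * r%:C ^+ m)).
  by rewrite !cmodM cmodX cmod_real cmod_nat (ger0_norm r0).
rewrite -E; apply: le_trans (cmod_sum _ _ _) _.
rewrite mulr_natl -[X in _ *+ X]card_ord -sumr_const; apply: ler_sum => k _.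
rewrite cmodM cmodX wk expr1n mul1r.
set S := \sum_(i < J) _.
rewrite (_ : S = expsum N c lam (z k) - (expsum N c lam (z k) - S)); last by ring.
apply: le_trans (ler_cmodB _ _) _; apply: lerD; first exact: hM.
by apply: le_trans (expsum_taylor _ _ _ _ (zr k)) _; exact: ltW.
Unshelve. all: end_near.
Qed.

(** Cauchy's estimate bounds the terms from [J] to a large [K] by a geometric sequence of ratio |z|
    / r; what lies beyond [K] is below any [e]. *)
Lemma expsum_tail N c lam (r M : R) z J : cmod z < r ->
  (forall z, cmod z <= r -> cmod (expsum N c lam z) <= M) ->
  cmod (expsum N c lam z - \sum_(m < J) expsum_coef N c lam m * z ^+ m) <=
    M * (cmod z / r) ^+ J / (1 - cmod z / r).
Proof.
move=> zr hM; have r0 : 0 < r by exact: le_lt_trans (cmod_ge0 z) zr.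
have M0 : 0 <= M by apply: le_trans (cmod_ge0 _) (hM 0 _); rewrite cmod0 ltW.
set q := cmod z / r.
have q0 : 0 <= q by rewrite divr_ge0 ?cmod_ge0 // ltW.
have q1 : q < 1 by rewrite ltr_pdivrMr // mul1r.
have q1' : 0 < 1 - q by rewrite subr_gt0.
apply/ler_addgt0Pr => e e0.
have /cvgrPdist_lt /(_ _ e0) h := expsum_err_cvg N c lam r.
near \oo => K.
have JK : (J <= K)%N by near: K; exact: nbhs_infty_ge.
have eK : expsum_err N c lam r K < e.
  have : `|0 - expsum_err N c lam r K| < e by near: K.
  by rewrite sub0r normrN; apply: le_lt_trans; exact: ler_norm.
rewrite -(big_mkord xpredT (fun m => expsum_coef N c lam m * z ^+ m)).
have E : expsum N c lam z - \sum_(0 <= m < J) expsum_coef N c lam m * z ^+ m =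
  (\sum_(J <= m < K) expsum_coef N c lam m * z ^+ m) +
  (expsum N c lam z - \sum_(0 <= m < K) expsum_coef N c lam m * z ^+ m).
  by rewrite [in RHS](big_cat_nat (leq0n J) JK) /=; ring.
rewrite E; apply: le_trans (ler_cmodD _ _) _; apply: lerD; last first.
  by rewrite big_mkord; apply: le_trans (expsum_taylor _ _ _ _ (ltW zr)) _; exact: ltW.
apply: le_trans (cmod_sum _ _ _) _.
apply: (@le_trans _ _ (\sum_(J <= m < K) M * q ^+ m)).
  apply: ler_sum => m _; rewrite cmodM cmodX /q expr_div_n mulrA ler_pdivlMr ?exprn_gt0 //.
  rewrite mulrAC ler_wpM2r ?exprn_ge0 ?cmod_ge0 //.
  by apply: expsum_cauchy hM; exact: ltW.
rewrite -mulr_sumr -mulrA ler_wpM2l // ler_pdivlMr //.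
rewrite -{1}(add0n J) big_addn big_mkord.
under eq_bigr do rewrite exprD.
rewrite -mulr_suml -mulrA mulrC -mulrA.
have -> : (1 - q) * (\sum_(i < K - J) q ^+ i) = 1 - q ^+ (K - J).
  by rewrite -[RHS]opprB subrX1; ring.
by rewrite ler_piMr ?exprn_ge0 // lerBlDr lerDl exprn_ge0.
Unshelve. all: end_near.
Qed.

Lemma expsum_deriv N c lam (r M : R) z : 0 < r -> cmod z <= r / 2 ->
  (forall z, cmod z <= r -> cmod (expsum N c lam z) <= M) ->
  cmod (expsum N c lam z - expsum N c lam 0 - z * expsum_coef N c lam 1) <=
    2 * M / r ^+ 2 * cmod z ^+ 2.
Proof.
move=> r0 zr hM.
have zr' : cmod z < r by apply: le_lt_trans zr _; rewrite ltr_pdivrMr // ltr_pMr // ltr1n.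
have := @expsum_tail N c lam r M z 2 zr' hM.
rewrite !big_ord_recl big_ord0 addr0 /= expr0 mulr1 expr1.
have -> : expsum_coef N c lam 0 = expsum N c lam 0.
  by apply: eq_bigr => n _; rewrite mul0r oppr0 cexp0 expr0 divr1.
rewrite opprD addrA [expsum_coef _ _ _ _ * z]mulrC => /le_trans; apply.
have M0 : 0 <= M by apply: le_trans (cmod_ge0 _) (hM 0 _); rewrite cmod0 ltW.
have q : cmod z / r <= 2^-1 by rewrite ler_pdivrMr // mulrC.
have q1 : 0 < 1 - cmod z / r by lra.
rewrite ler_pdivrMr // expr_div_n.
have h : 1 <= 2 * (1 - cmod z / r) by lra.
have h2 : 0 <= M * (cmod z ^+ 2 / r ^+ 2) by rewrite mulr_ge0 // divr_ge0 // exprn_ge0 ?cmod_ge0 // ltW.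
move: (ler_wpM2l h2 h); rewrite mulr1 => /le_trans; apply.
by rewrite le_eqVlt; apply/orP; left; apply/eqP; ring.
Qed.

End ExponentialSums.


(** * Dirichlet polynomials: derivatives and locally uniform limits *)

Section DirichletPolynomials.
Variable R : realType.
Local Notation C := (Cplx R).
Implicit Types (z w s : C) (P Q : {poly C}) (a b : nat -> C).

Lemma natpowND n s z : natpowN n.+1 (s + z) = natpowN n.+1 s * natpowN n.+1 z.
Proof. by rewrite !natpowNE // mulrDl opprD cexpD. Qed.

Lemma cmod_natpowN n s : cmod (natpowN n.+1 s) = n.+1%:R `^ (- complex.Re s).
Proof.
rewrite natpowNE // cmod_cexp /powR pnatr_eq0 /=; congr expR.
by case: s => x y /=; ring.
Qed.

Lemma natpowNM m n s : natpowN (m.+1 * n.+1) s = natpowN m.+1 s * natpowN n.+1 s.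
Proof.
by rewrite !natpowNE // natrM lnM ?posrE ?ltr0n // rmorphD mulrDr opprD cexpD.
Qed.

Lemma natpowN1 s : natpowN 1 s = 1.
Proof. by rewrite natpowNE // ln1 mulr0 oppr0 cexp0. Qed.

Lemma dpoly_evalE P N s : (size P <= N)%N ->
  dpoly_eval P s = \sum_(n < N) P`_n * natpowN n.+1 s.
Proof.
move=> h; rewrite /dpoly_eval -(subnKC h) big_split_ord /= [X in _ + X]big1 ?addr0 //.
by move=> i _; rewrite nth_default ?mul0r // leq_addr.
Qed.

Lemma dpartialE a s N : dpartial a s N = \sum_(n < N) a n * natpowN n.+1 s.
Proof. by rewrite /dpartial /series /= big_mkord. Qed.

Lemma dpoly_dpartial P N s : (size P <= N)%N ->
  dpartial (fun n => P`_n) s N = dpoly_eval P s.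
Proof. by move=> h; rewrite (dpoly_evalE _ h) dpartialE. Qed.

Lemma cvg_dpoly P s : dpartial (fun n => P`_n) s @ \oo --> dpoly_eval P s.
Proof.
apply/cvg_cmod0P; apply: cvg_near_cst; near=> N.
rewrite dpoly_dpartial ?subrr ?cmod0 //; near: N; exact: nbhs_infty_ge.
Unshelve. all: end_near.
Qed.

Lemma cvg_unique_C (u : nat -> C) (l l' : C) : u @ \oo --> l -> u @ \oo --> l' -> l = l'.
Proof. by move=> h1 h2; exact: (cvg_unique _ h1 h2). Qed.

Lemma cvgDC (u v : nat -> C) (k l : C) : u @ \oo --> k -> v @ \oo --> l ->
  (fun n => u n + v n) @ \oo --> k + l.
Proof. by move=> h1 h2; exact: (@cvgD C C nat \oo _ u v k l h1 h2). Qed.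

Lemma cvgBC (u v : nat -> C) (k l : C) : u @ \oo --> k -> v @ \oo --> l ->
  (fun n => u n - v n) @ \oo --> k - l.
Proof. by move=> h1 h2; exact: (@cvgB C C nat \oo _ u v k l h1 h2). Qed.

Lemma cvgMC (u v : nat -> C) (k l : C) : u @ \oo --> k -> v @ \oo --> l ->
  (fun n => u n * v n) @ \oo --> k * l.
Proof. by move=> h1 h2; exact: (@cvgM C nat \oo _ u v k l h1 h2). Qed.

Lemma cvg_cmod_le (u : nat -> C) (l : C) (M : R) : u @ \oo --> l ->
  (\forall n \near \oo, cmod (u n) <= M) -> cmod l <= M.
Proof.
move=> hu hM; have h := cvg_cmod eventually_filter hu.
rewrite -(cvg_lim _ h) //; apply: limr_le => //; exact: (cvgP _ h).
Qed.

Lemma dsum_cvg a s (l : C) : dpartial a s @ \oo --> l -> dsum a s = l.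
Proof. by move=> h; apply/cvg_lim => //. Qed.

Lemma dsum_dpoly P s : dsum (fun n => P`_n) s = dpoly_eval P s.
Proof. exact/dsum_cvg/cvg_dpoly. Qed.

Lemma dpoly_evalD P Q s : dpoly_eval (P + Q) s = dpoly_eval P s + dpoly_eval Q s.
Proof.
have h := size_polyD P Q; rewrite (dpoly_evalE _ h).
rewrite (dpoly_evalE s (leq_maxl (size P) (size Q))).
rewrite (dpoly_evalE s (leq_maxr (size P) (size Q))) -big_split /=.
by apply: eq_bigr => i _; rewrite coefD mulrDl.
Qed.

Lemma dpoly_evalN P s : dpoly_eval (- P) s = - dpoly_eval P s.
Proof.
rewrite /dpoly_eval size_polyN -sumrN; apply: eq_bigr => i _.
by rewrite coefN mulNr.
Qed.

Lemma dpoly_evalB P Q s : dpoly_eval (P - Q) s = dpoly_eval P s - dpoly_eval Q s.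
Proof. by rewrite dpoly_evalD dpoly_evalN. Qed.

Lemma dpoly_evalZ (k : C) P s : dpoly_eval (k *: P) s = k * dpoly_eval P s.
Proof.
rewrite (dpoly_evalE s (size_scale_leq k P)) /dpoly_eval mulr_sumr.
by apply: eq_bigr => i _; rewrite coefZ mulrA.
Qed.

Lemma dpoly_eval_poly N a s : dpoly_eval (\poly_(n < N) a n) s = dpartial a s N.
Proof.
rewrite dpartialE (dpoly_evalE s (size_poly N a)); apply: eq_bigr => i _.
by rewrite coef_poly ltn_ord.
Qed.

Definition dderiv P : {poly C} :=
  \poly_(n < size P) (P`_n * (- ln (n.+1%:R : R))%:C).

Lemma dderiv_coef P n : (dderiv P)`_n = P`_n * (- ln (n.+1%:R : R))%:C.
Proof. by rewrite coef_poly; case: ltnP => // h; rewrite nth_default // mul0r. Qed.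

Lemma dderivB P Q : dderiv (P - Q) = dderiv P - dderiv Q.
Proof. by apply/polyP => n; rewrite coefB !dderiv_coef coefB mulrBl. Qed.

Let tcoef P s n : C := P`_n * natpowN n.+1 s.
Let lnS n : R := ln (n.+1%:R : R).

Lemma dpoly_eval_expsum P s z :
  dpoly_eval P (s + z) = expsum (size P) (tcoef P s) lnS z.
Proof.
apply: eq_bigr => n _; rewrite natpowND mulrA; congr (_ * _).
by rewrite natpowNE.
Qed.

Lemma dderiv_expsum P s :
  dpoly_eval (dderiv P) s = expsum_coef (size P) (tcoef P s) lnS 1.
Proof.
rewrite (dpoly_evalE s (size_poly _ _)); apply: eq_bigr => n _.
by rewrite dderiv_coef /tcoef expr1 divr1 mulrAC.
Qed.

Lemma dderiv_le P s (r M : R) : 0 < r ->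
  (forall z, cmod z <= r -> cmod (dpoly_eval P (s + z)) <= M) ->
  cmod (dpoly_eval (dderiv P) s) <= M / r.
Proof.
move=> r0 h; rewrite ler_pdivlMr // dderiv_expsum -[r]expr1.
by apply: expsum_cauchy; [exact: ltW|move=> z zr; rewrite -dpoly_eval_expsum h].
Qed.

Lemma dderiv_approx P s (r M : R) z : 0 < r -> cmod z <= r / 2 ->
  (forall z, cmod z <= r -> cmod (dpoly_eval P (s + z)) <= M) ->
  cmod (dpoly_eval P (s + z) - dpoly_eval P s - z * dpoly_eval (dderiv P) s) <=
    2 * M / r ^+ 2 * cmod z ^+ 2.
Proof.
move=> r0 zr h; rewrite dderiv_expsum dpoly_eval_expsum -{2}[s]addr0 dpoly_eval_expsum.
by apply: expsum_deriv => // w wr; rewrite -dpoly_eval_expsum h.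
Qed.

Lemma natr_powR_le (n : nat) (x y : R) : x <= y -> (n.+1%:R : R) `^ x <= n.+1%:R `^ y.
Proof. by move=> xy; apply: ler_powR => //; rewrite ler1n. Qed.

Lemma dpoly_eval_le P s (sigma : R) : sigma <= complex.Re s ->
  cmod (dpoly_eval P s) <= \sum_(n < size P) cmod P`_n * n.+1%:R `^ (- sigma).
Proof.
move=> h; apply: le_trans (cmod_sum _ _ _) _; apply: ler_sum => n _.
by rewrite cmodM cmod_natpowN ler_wpM2l ?cmod_ge0 // natr_powR_le // lerN2.
Qed.

(** Every [Q k] satisfies a second-order Taylor estimate whose constant depends only on a bound on
    the disc, so the estimate passes to the limit [G]. *)
Lemma weierstrass_dpoly (Q : nat -> {poly C}) (G : C -> C) s (r : R) : 0 < r ->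
  (forall z, cmod z <= r -> (fun k => dpoly_eval (Q k) (s + z)) @ \oo --> G (s + z)) ->
  (forall e : R, 0 < e -> exists K : nat, forall k l : nat, (K <= k)%N -> (K <= l)%N ->
     forall z, cmod z <= r -> cmod (dpoly_eval (Q k) (s + z) - dpoly_eval (Q l) (s + z)) <= e) ->
  derivable G s 1 /\ (fun k => dpoly_eval (dderiv (Q k)) s) @ \oo --> derive1 G s.
Proof.
move=> r0 hG hC.
have [L hL] : exists L : C, (fun k => dpoly_eval (dderiv (Q k)) s) @ \oo --> L.
  apply: cauchy_complex => e e0.
  have e2 : 0 < e / 2 * r by rewrite mulr_gt0 // divr_gt0.
  have [K hK] := hC _ e2; exists K => k l Kk Kl.
  rewrite -dpoly_evalB -dderivB.
  apply: (@le_lt_trans _ _ (e / 2 * r / r)); last by rewrite mulfK ?gt_eqF // ltr_pdivrMr // ltr_pMr // ltr1n.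
  by apply: dderiv_le => // z zr; rewrite dpoly_evalB hK.
have [K hK] := hC 1 ltr01.
(* From [K] on, all polynomials are within 1 of [Q K], which is bounded on the disc by the absolute
   sum at the leftmost abscissa. *)
pose M := \sum_(n < size (Q K)) cmod (Q K)`_n * n.+1%:R `^ (- (complex.Re s - r)) + 1.
have hM k z : (K <= k)%N -> cmod z <= r -> cmod (dpoly_eval (Q k) (s + z)) <= M.
  move=> Kk zr.
  rewrite -[dpoly_eval (Q k) _](subrK (dpoly_eval (Q K) (s + z))) addrC.
  apply: le_trans (ler_cmodD _ _) _; apply: lerD; last exact: hK.
  apply: dpoly_eval_le; rewrite ReD lerD2l lerNl.
  apply: le_trans zr; apply: le_trans (Re_le_cmod z); rewrite -normrN; exact: ler_norm.
have h z : cmod z <= r / 2 ->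
    cmod (G (s + z) - G s - z * L) <= 2 * M / r ^+ 2 * cmod z ^+ 2.
  move=> zr; have zr' : cmod z <= r by apply: le_trans zr _; rewrite ler_pdivrMr // ler_peMr ?ler1n // ltW.
  have c0 : (fun k => dpoly_eval (Q k) s) @ \oo --> G s.
    by have := hG 0; rewrite cmod0 addr0; apply; exact: ltW.
  have hc : (fun k => dpoly_eval (Q k) (s + z) - dpoly_eval (Q k) s -
      z * dpoly_eval (dderiv (Q k)) s) @ \oo --> G (s + z) - G s - z * L.
    have h1 := cvgBC (hG z zr') c0.
    have h2 : (fun k : nat => z) @ \oo --> z by exact: cvg_cst.
    exact: cvgBC h1 (cvgMC h2 hL).
  apply: (cvg_cmod_le hc).
  near=> k; apply: dderiv_approx => // w wr; apply: hM => //.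
  near: k; exact: nbhs_infty_ge.
have [d1 d2] := @derivable_quadratic _ G s L _ _ (divr_gt0 r0 (ltr0Sn R 1)) h.
split; first exact: d1.
exact: (eq_ind_r (fun l : C => (fun k => dpoly_eval (dderiv (Q k)) s) @ \oo --> l) hL d2).
Unshelve. all: end_near.
Qed.

End DirichletPolynomials.


(** * Coefficients of polynomial growth and their recovery from vertical lines *)

Section CoefficientGrowth.
Variable R : realType.
Local Notation C := (Cplx R).
Implicit Types (z w s : C) (P Q : {poly C}) (a b : nat -> C) (tau sigma B M : R).

(** The working form of convergence: it yields absolute convergence for [tau + 2 <= Re s], with
    tails bounded uniformly in [s]. *)
Definition dgrowth a tau B := forall n, cmod (a n) <= B * n.+1%:R `^ tau.

Lemma exists_natr_gt (x : R) : exists n : nat, x < n%:R.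
Proof.
exists (Num.bound `|x|); apply: le_lt_trans (ler_norm x) _.
by apply: archi_boundP.
Qed.

Lemma dgrowth_ge0 a tau B : dgrowth a tau B -> 0 <= B.
Proof. by move=> /(_ 0%N); rewrite powR1 mulr1; apply: le_trans; exact: cmod_ge0. Qed.

Lemma sum_inv_sqr_tail N K : (N <= K)%N ->
  \sum_(N <= n < K) (n.+1%:R : R) `^ (- 2) <= 2 / N.+1%:R.
Proof.
move=> NK; apply: (@le_trans _ _ (\sum_(N <= n < K) (- (2 / n.+2%:R) - - (2 / n.+1%:R)))).
  apply: ler_sum => n _; rewrite powRN -[2]/(2%:R) powR_mulrn ?ler0n // opprK.
  have n1 : 1 <= (n.+1%:R : R) by rewrite ler1n.
  have -> : (n.+2%:R : R) = n.+1%:R + 1 by rewrite -natr1.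
  move: (n.+1%:R : R) n1 => x x1; have x0 : 0 < x by exact: lt_le_trans x1.
  have -> : - (2 / (x + 1)) + 2 / x = 2 / (x * (x + 1)) by field; lra.
  rewrite -[X in X <= _]mul1r ler_pdivrMr ?exprn_gt0 //.
  rewrite mulrAC ler_pdivlMr ?mulr_gt0 //; nra.
rewrite telescope_sumr // opprK addrC lerBlDr lerDl.
by rewrite divr_ge0.
Qed.

Lemma dgrowth_term a tau B s n : dgrowth a tau B -> tau + 2 <= complex.Re s ->
  cmod (a n * natpowN n.+1 s) <= B * n.+1%:R `^ (- 2).
Proof.
move=> h hs; rewrite cmodM cmod_natpowN.
apply: (@le_trans _ _ (B * n.+1%:R `^ tau * n.+1%:R `^ (- (tau + 2)))).
  apply: ler_pM; rewrite ?cmod_ge0 ?powR_ge0 //.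
  by apply: natr_powR_le; rewrite lerN2.
rewrite -mulrA -powRD; last by rewrite pnatr_eq0 implybT.
by rewrite opprD addrA subrr add0r.
Qed.

Lemma dpartial_tail a tau B s N K : dgrowth a tau B -> tau + 2 <= complex.Re s ->
  (N <= K)%N -> cmod (dpartial a s K - dpartial a s N) <= 2 * B / N.+1%:R.
Proof.
move=> h hs NK; rewrite /dpartial /series /= (big_cat_nat (leq0n N) NK) /= [X in X - _]addrC addrK.
apply: le_trans (cmod_sum _ _ _) _.
apply: (@le_trans _ _ (\sum_(N <= n < K) B * (n.+1%:R : R) `^ (- 2))).
  by apply: ler_sum => n _; exact: dgrowth_term hs.
rewrite -mulr_sumr (mulrC 2 B) -mulrA ler_wpM2l ?(dgrowth_ge0 h) //.
exact: sum_inv_sqr_tail.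
Qed.

Lemma dgrowth_cvg a tau B s : dgrowth a tau B -> tau + 2 <= complex.Re s ->
  dpartial a s @ \oo --> dsum a s.
Proof.
move=> h hs.
suff [l hl] : exists l : C, dpartial a s @ \oo --> l by move: (hl); rewrite -{1}(dsum_cvg hl).
apply: cauchy_complex => e e0.
have B0 := dgrowth_ge0 h.
have [K hK] : exists K : nat, 4 * B / K.+1%:R < e.
  have [K hK] := exists_natr_gt (4 * B / e).
  exists K; rewrite ltr_pdivrMr ?ltr0n // [e * _]mulrC -ltr_pdivrMr //.
  by apply: lt_trans hK _; rewrite ltr_nat.
exists K => k l Kk Kl.
rewrite (_ : _ - _ = (dpartial a s k - dpartial a s K) - (dpartial a s l - dpartial a s K)); last by ring.
apply: le_lt_trans (ler_cmodB _ _) _.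
apply: le_lt_trans hK; rewrite (_ : 4 * B / _ = 2 * B / K.+1%:R + 2 * B / K.+1%:R); last by ring.
by apply: lerD; apply: dpartial_tail h hs _.
Qed.

Lemma dsum_tail a tau B s N : dgrowth a tau B -> tau + 2 <= complex.Re s ->
  cmod (dsum a s - dpartial a s N) <= 2 * B / N.+1%:R.
Proof.
move=> h hs; have h1 : (fun k : nat => dpartial a s N) @ \oo --> dpartial a s N by exact: cvg_cst.
apply: (cvg_cmod_le (cvgBC (dgrowth_cvg h hs) h1)).
near=> k; apply: dpartial_tail h hs _; near: k; exact: nbhs_infty_ge.
Unshelve. all: end_near.
Qed.

(* Averaging over the vertical line isolates one coefficient. *)
Lemma dsum_coef_le a tau B sigma M n : dgrowth a tau B -> tau + 2 <= sigma ->
  (forall t : R, cmod (dsum a (sigma +i* t)) <= M) ->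
  cmod (a n) * n.+1%:R `^ (- sigma) <= M.
Proof.
move=> ha hs hM; have B0 := dgrowth_ge0 ha.
apply/ler_addgt0Pr => e e0.
have e2 : 0 < e / 2 by rewrite divr_gt0.
have [N0 hN0] := exists_natr_gt (2 * B / (e / 2)).
pose N := (maxn N0 n).+1.
have hN : 2 * B / N.+1%:R <= e / 2.
  rewrite ler_pdivrMr ?ltr0n // [e / 2 * _]mulrC -ler_pdivrMr //.
  by apply: le_trans (ltW hN0) _; rewrite ler_nat /N; lia.
have nN : (n < N)%N by rewrite /N; lia.
(* the frequencies [ln (m / n)], [m < N], become distinct modulo the step [d] *)
pose d : R := (ln (N.+1%:R : R) + 1)^-1.
have lnN0 : 0 <= ln (N.+1%:R : R) by rewrite ln_ge0 // ler1n.
have d0 : 0 < d by rewrite invr_gt0 ltr_wpDl.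
pose x m : R := ln (m.+1%:R : R) - ln (n.+1%:R).
pose u m : C := cexp (0 +i* (- (x m * d))).
have u1 m : cmod (u m) = 1 by rewrite cmod_cexp expR0.
have uE m : m != n -> (m < N)%N -> u m != 1.
  move=> mn mN; apply/negP; rewrite /u /cexp /= expR0 !mul1r eq_complex /= => /andP[/eqP hc _].
  have xn0 : x m != 0.
    rewrite subr_eq0; apply/negP => /eqP /ln_inj; rewrite !posrE !ltr0n => /(_ isT isT) /eqP.
    by rewrite eqr_nat eqSS (negPf mn).
  have xle : `|x m| <= ln (N.+1%:R : R).
    have g k : (k < N)%N -> 0 <= ln (k.+1%:R : R) <= ln (N.+1%:R : R).
      move=> kN; rewrite ln_ge0 ?ler1n //= ler_ln ?posrE ?ltr0n // ler_nat; lia.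
    have /andP[g1 g2] := g _ mN; have /andP[g3 g4] := g _ nN.
    rewrite ler_norml /x; apply/andP; split; lra.
  (* Since [d] times any difference of logarithms has modulus at most 1, the half-angle is nonzero
     and below pi. *)
  have yb : 0 < `|x m * d / 2| < (pi : R).
    rewrite normr_gt0 (mulf_neq0 (mulf_neq0 xn0 (lt0r_neq0 d0))) ?invr_eq0 ?pnatr_eq0 //=.
    rewrite !normrM (gtr0_norm d0).
    have q1 : `|x m| * d <= 1.
      rewrite /d ler_pdivrMr ?mul1r; last by rewrite ltr_wpDl.
      by rewrite (le_trans xle) // lerDl.
    have pi2 := @pi_ge2 R; rewrite (@ger0_norm _ (2^-1 : R)) ?invr_ge0 //.
    have : `|x m| * d / 2 <= 1 / 2 by rewrite ler_wpM2r.
    by move=> h; apply: le_lt_trans h _; apply: lt_le_trans pi2; lra.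
  have := cos_mulr2n_neq1 yb.
  suff -> : cos (`|x m * d / 2| *+ 2) = cos (- (x m * d)) by rewrite hc eqxx.
  rewrite -normrMn (_ : (x m * d / 2) *+ 2 = x m * d) ?cos_norm ?cosN //.
  by rewrite -[LHS]mulr_natr divfK ?pnatr_eq0.
(* A bound, independent of [L], for the geometric sums of the other frequencies; averaging over [L]
   sample points divides it by [L]. *)
pose K' := \sum_(m < N | m != n :> nat) cmod (a m) * m.+1%:R `^ (- sigma) * (2 / cmod (u m - 1)).
have K'0 : 0 <= K'.
  by apply: sumr_ge0 => m _; rewrite !mulr_ge0 ?cmod_ge0 ?powR_ge0 // invr_ge0 cmod_ge0.
have [L0 hL0] := exists_natr_gt (K' / (e / 2)).
pose L := L0.+1.
have LR : 0 < (L%:R : R) by rewrite ltr0n.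
pose t k : R := d *+ k.
pose v k : C := cexp (0 +i* (t k * ln (n.+1%:R : R))).
have v1 k : cmod (v k) = 1 by rewrite cmod_cexp expR0.
have term m k : v k * natpowN m.+1 (sigma +i* t k) = (m.+1%:R `^ (- sigma))%:C * u m ^+ k.
  rewrite natpowNE // /v /u -cexp_mulrn -cexpD.
  have -> : (m.+1%:R `^ (- sigma))%:C = cexp ((- sigma * ln (m.+1%:R : R))%:C).
    by rewrite /cexp /= cos0 sin0 mulr1 mulr0 /powR pnatr_eq0.
  rewrite -cexpD; congr cexp.
  have -> : (0 +i* (- (x m * d)) : C) *+ k = 0 +i* (- (x m * t k)).
    have -> : x m * t k = (x m * d) *+ k by rewrite /t mulrnAr.
    elim: k => [|k IH]; first by rewrite !mulr0n oppr0.
    by rewrite !mulrS IH; apply/eqP; rewrite eq_complex /= addr0 opprD !eqxx.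
  by apply/eqP; rewrite eq_complex /= /x; apply/andP; split; apply/eqP; ring.
have avg : cmod (\sum_(k < L) v k * dpartial a (sigma +i* t k) N) <= L%:R * (M + e / 2).
  apply: le_trans (cmod_sum _ _ _) _.
  rewrite mulr_natl -[X in _ *+ X]card_ord -sumr_const; apply: ler_sum => k _.
  rewrite cmodM v1 mul1r.
  rewrite (_ : dpartial _ _ _ = dsum a (sigma +i* t k) - (dsum a (sigma +i* t k) - dpartial a (sigma +i* t k) N)); last by ring.
  apply: le_trans (ler_cmodB _ _) _; apply: lerD; first exact: hM.
  by apply: le_trans (dsum_tail _ ha _) hN.
have E : \sum_(k < L) v k * dpartial a (sigma +i* t k) N =
   \sum_(m < N) a m * (m.+1%:R `^ (- sigma))%:C * \sum_(k < L) u m ^+ k.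
  under eq_bigr do rewrite dpartialE mulr_sumr.
  rewrite exchange_big /=; apply: eq_bigr => m _; rewrite mulr_sumr.
  by apply: eq_bigr => k _; rewrite mulrCA term mulrA.
rewrite E (bigD1 (Ordinal nN)) //= in avg.
have un : u n = 1 by rewrite /u /x subrr mul0r oppr0 cexp0.
rewrite un in avg.
have S1 : \sum_(k < L) (1 : C) ^+ k = L%:R.
  by under eq_bigr do rewrite expr1n; rewrite sumr_const card_ord.
rewrite S1 in avg.
set T := (X in cmod (_ + X)) in avg.
have hT : cmod T <= K'.
  apply: le_trans (cmod_sum _ _ _) _; apply: ler_sum => m mn.
  rewrite !cmodM cmod_real ger0_norm ?powR_ge0 // ler_wpM2l ?mulr_ge0 ?cmod_ge0 ?powR_ge0 //.
  by apply: sum_expr_cmod_le => //; apply: uE.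
have hK' : K' <= L%:R * (e / 2).
  rewrite -ler_pdivrMr //; apply: le_trans (ltW hL0) _; by rewrite ler_nat.
rewrite -(ler_pM2l LR).
have -> : L%:R * (cmod (a n) * n.+1%:R `^ (- sigma)) = cmod (a n * (n.+1%:R `^ (- sigma))%:C * L%:R).
  by rewrite !cmodM cmod_real cmod_nat ger0_norm ?powR_ge0 // mulrC.
rewrite -(addrK T (_ * _)); apply: le_trans (ler_cmodB _ _) _.
apply: (@le_trans _ _ (L%:R * (M + e / 2) + L%:R * (e / 2))).
  by apply: lerD => //; exact: le_trans hT hK'.
by rewrite -mulrDr -addrA -splitr.
Qed.

End CoefficientGrowth.


(** * Dirichlet convolution and the Vitali-type theorem *)

Section DirichletConvolution.
Variable R : realType.
Local Notation C := (Cplx R).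
Implicit Types (z w s : C) (P Q : {poly C}) (a b c g h : nat -> C) (tau sigma B M : R).

Lemma dgrowth_dpoly P tau : exists B, dgrowth (fun n => P`_n) tau B.
Proof.
exists (\sum_(n < size P) cmod P`_n * n.+1%:R `^ (- tau)) => n.
have p0 : 0 < (n.+1%:R : R) `^ tau by rewrite powR_gt0 // ltr0n.
have [h|h] := ltnP n (size P); last first.
  rewrite nth_default // cmod0 mulr_ge0 ?powR_ge0 // sumr_ge0 // => i _.
  by rewrite mulr_ge0 ?cmod_ge0 ?powR_ge0.
rewrite -ler_pdivrMr // -powRN (bigD1 (Ordinal h)) //= lerDl sumr_ge0 // => i _.
by rewrite mulr_ge0 ?cmod_ge0 ?powR_ge0.
Qed.

(** A polynomial satisfies [dgrowth] for every exponent, in particular [sigma - 2], so the averaging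
    is available on every vertical line. *)
Lemma dpoly_coef_le P sigma M n : (forall t : R, cmod (dpoly_eval P (sigma +i* t)) <= M) ->
  cmod P`_n * n.+1%:R `^ (- sigma) <= M.
Proof.
move=> h; have [B hB] := dgrowth_dpoly P (sigma - 2).
apply: (dsum_coef_le n hB); first by rewrite subrK.
by move=> t; rewrite dsum_dpoly.
Qed.

(** The growth bound makes the tails uniformly small on the half-plane; finitely many coefficients
    remain, each tending to 0 in [j]. *)
Lemma dpoly_uniformly_small (Z : nat -> {poly C}) tau M : 0 <= tau ->
  (forall j, dgrowth (fun n => (Z j)`_n) tau M) ->
  (forall n, (fun j => (Z j)`_n) @ \oo --> (0 : C)) ->
  forall e, 0 < e -> \forall j \near \oo, forall w, tau + 2 <= complex.Re w ->
    cmod (dpoly_eval (Z j) w) <= e.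
Proof.
move=> tau0 hZ h0 e e0.
have [N hN] := exists_natr_gt (2 * M / (e / 2)).
have e2 : 0 < e / 2 by rewrite divr_gt0.
have hN' : 2 * M / N.+1%:R <= e / 2.
  rewrite ler_pdivrMr ?ltr0n // [e / 2 * _]mulrC -ler_pdivrMr //.
  by apply: le_trans (ltW hN) _; rewrite ler_nat.
have hs : (fun j => \sum_(n < N) cmod (Z j)`_n) @ \oo --> (0 : R).
  rewrite -[X in X @ _ --> _](_ : \sum_(n < N) (fun j => cmod (Z j)`_n) = _); last first.
    by apply/funext => j; rewrite fct_sumE.
  rewrite -[X in _ --> X](_ : \sum_(n < N) 0 = 0); last by rewrite big1.
  elim/big_ind2: _ => //; first exact: cvg_cst.
    by move=> f x k y fx ky; exact: cvgD.
  by move=> i _; rewrite -(cmod0 R); apply: cvg_cmod; exact: h0.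
move/cvgrPdist_lt/(_ _ e2): hs => hs.
near=> j; move=> w hw; rewrite -dsum_dpoly.
rewrite -[dsum _ _](subrK (dpartial (fun n => (Z j)`_n) w N)).
apply: le_trans (ler_cmodD _ _) _; rewrite [e]splitr; apply: lerD.
  by apply: le_trans (dsum_tail _ (hZ j) hw) hN'.
have /ltW : `|0 - \sum_(n < N) cmod (Z j)`_n| < e / 2 by near: j.
rewrite sub0r normrN; apply: le_trans; apply: le_trans (ler_norm _).
rewrite dpartialE; apply: le_trans (cmod_sum _ _ _) _; apply: ler_sum => n _.
rewrite cmodM cmod_natpowN ler_piMr ?cmod_ge0 //.
rewrite -[leRHS](@powRr0 R n.+1%:R); apply: natr_powR_le; rewrite oppr_le0.
by apply: le_trans hw; rewrite addr_ge0.
Unshelve. all: end_near.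
Qed.

(* Coefficientwise convergence propagates from the region of absolute convergence
   by one Taylor expansion on a disc internally tangent to the boundary line. *)
Lemma vitali_dpoly (Z : nat -> {poly C}) theta M :
  (forall j w, theta <= complex.Re w -> cmod (dpoly_eval (Z j) w) <= M) ->
  (forall n, (fun j => (Z j)`_n) @ \oo --> (0 : C)) ->
  forall s, theta < complex.Re s -> (fun j => dpoly_eval (Z j) s) @ \oo --> (0 : C).
Proof.
move=> hM h0 s hs.
pose tau := Num.max 0 theta.
have tau0 : 0 <= tau by rewrite /tau le_max lexx.
have tauth : theta <= tau by rewrite /tau le_max lexx orbT.
have M0 : 0 <= M by apply: le_trans (cmod_ge0 _) (hM 0%N s (ltW hs)).
have hg j : dgrowth (fun n => (Z j)`_n) tau M.
  move=> n; have p0 : 0 < (n.+1%:R : R) `^ tau by rewrite powR_gt0 // ltr0n.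
  rewrite -ler_pdivrMr // -powRN.
  apply: dpoly_coef_le => t; exact: hM.
(* Abscissa of the centre [s0]: the unit disc about [s0] lies in Re w >= tau + 2, where the values
   are small, and the disc of radius [X - theta] touches the line Re w = theta and contains [s]. *)
pose X := tau + 3 + `|complex.Re s|.
have XRe : complex.Re s < X.
  by rewrite /X ltr_pwDl ?ler_norm // ltr_wpDl.
pose s0 : C := X +i* complex.Im s.
pose r := X - theta.
have zE : s = s0 + (complex.Re s - X)%:C.
  by apply/eqP; rewrite eq_complex ReD ImD /=; apply/andP; split; apply/eqP; ring.
set z : C := (complex.Re s - X)%:C in zE.
have zc : cmod z = X - complex.Re s by rewrite cmod_real distrC gtr0_norm // subr_gt0.
have zr : cmod z < r by rewrite zc /r ltrD2l ltrN2.
have r0 : 0 < r by exact: le_lt_trans (cmod_ge0 z) zr.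
have Redisc (rho : R) (w : C) : cmod w <= rho -> X - rho <= complex.Re (s0 + w).
  move=> wr; rewrite ReD /= lerD2l lerNl; apply: le_trans wr.
  by apply: le_trans (Re_le_cmod w); rewrite -normrN ler_norm.
set q := cmod z / r.
have q0 : 0 <= q by rewrite divr_ge0 ?cmod_ge0 // ltW.
have q1 : q < 1 by rewrite ltr_pdivrMr // mul1r.
have q1' : 0 < 1 - q by rewrite subr_gt0.
apply/cvg_cmodP => e e0.
have e2 : 0 < e / 2 by rewrite divr_gt0.
have [J hJ] : exists J : nat, M * q ^+ J / (1 - q) < e / 2.
  have hc : (fun J => M * q ^+ J / (1 - q)) @ \oo --> M * 0 / (1 - q).
    apply: cvgMl; apply: cvgMr; apply: cvg_expr; by rewrite ger0_norm.
  move: hc; rewrite mulr0 mul0r => /cvgrPdist_lt/(_ _ e2) [J _ /(_ J (leqnn J))] hJ.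
  by exists J; move: hJ; rewrite sub0r normrN; apply: le_lt_trans; exact: ler_norm.
pose S := \sum_(m < J) cmod z ^+ m.
have S0 : 0 <= S by apply: sumr_ge0 => m _; rewrite exprn_ge0 // cmod_ge0.
have d0 : 0 < e / 2 / (S + 1) by rewrite divr_gt0 // ltr_wpDl.
have hsm := dpoly_uniformly_small tau0 hg h0 d0.
near=> j; rewrite sub0r cmodN zE dpoly_eval_expsum.
set E := expsum _ _ _ _.
have hE : forall w, cmod w <= r -> cmod (expsum (size (Z j))
    (fun n => (Z j)`_n * natpowN n.+1 s0) (fun n => ln (n.+1%:R : R)) w) <= M.
  move=> w wr; rewrite -dpoly_eval_expsum; apply: hM.
  by apply: le_trans (Redisc _ _ wr); rewrite /r; lra.
have hE1 : forall w, cmod w <= 1 -> cmod (expsum (size (Z j))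
    (fun n => (Z j)`_n * natpowN n.+1 s0) (fun n => ln (n.+1%:R : R)) w) <= e / 2 / (S + 1).
  move=> w wr; rewrite -dpoly_eval_expsum.
  have h : forall w, tau + 2 <= complex.Re w -> cmod (dpoly_eval (Z j) w) <= e / 2 / (S + 1) by near: j.
  apply: h; apply: le_trans (Redisc _ _ wr).
  by rewrite /X; have := normr_ge0 (complex.Re s); lra.
have hT := expsum_tail J zr hE.
rewrite -[E](subrK (\sum_(m < J) expsum_coef (size (Z j)) (fun n => (Z j)`_n * natpowN n.+1 s0)
    (fun n => ln (n.+1%:R : R)) m * z ^+ m)).
apply: le_lt_trans (ler_cmodD _ _) _; rewrite [e]splitr; apply: ltr_leD.
  by apply: le_lt_trans hT _.
apply: le_trans (cmod_sum _ _ _) _.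
apply: (@le_trans _ _ (\sum_(m < J) e / 2 / (S + 1) * cmod z ^+ m)).
  apply: ler_sum => m _; rewrite cmodM cmodX ler_wpM2r ?exprn_ge0 ?cmod_ge0 //.
  by have := expsum_cauchy m ler01 hE1; rewrite expr1n mulr1.
rewrite -mulr_sumr -/S -mulrA ler_piMr ?(ltW e2) // mulrC ler_pdivrMr ?mul1r ?lerDl // ltr_wpDl //.
Unshelve. all: end_near.
Qed.

(** Dirichlet convolution of the coefficients, under the shift of indices by one. *)
Definition dconv P b n : C :=
  \sum_(d < size P | (d.+1 %| n.+1)%N) P`_d * b (n.+1 %/ d.+1).-1.

Lemma dpartialS a s N : dpartial a s N.+1 = dpartial a s N + a N * natpowN N.+1 s.
Proof. by rewrite !dpartialE big_ord_recr. Qed.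

(** Grouping by the divisor leaves partial sums of [b], so the product converges wherever [b] does,
    absolutely or not. *)
Lemma dpartial_dconv P b s N : dpartial (dconv P b) s N =
  \sum_(d < size P) P`_d * natpowN d.+1 s * dpartial b s (N %/ d.+1).
Proof.
elim: N => [|N IH].
  rewrite dpartialE big_ord0 big1 // => d _.
  by rewrite div0n dpartialE big_ord0 mulr0.
rewrite dpartialS IH /dconv mulr_suml [X in _ + X]big_mkcond -big_split /=.
apply: eq_bigr => d _; rewrite divnS //; case: ifPn => hd; last by rewrite addr0.
rewrite add1n dpartialS mulrDr; congr (_ + _).
have E : N.+1 = (d.+1 * (N %/ d.+1).+1)%N.
  by rewrite -{1}(divnK hd) divnS // hd mulnC.
by rewrite hd [in LHS]E natpowNM /=; ring.
Qed.

Lemma cvg_sumC n (u : 'I_n -> nat -> C) (l : 'I_n -> C) :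
  (forall i, u i @ \oo --> l i) ->
  (fun j => \sum_(i < n) u i j) @ \oo --> \sum_(i < n) l i.
Proof.
elim: n u l => [|n IH] u l h.
  rewrite big_ord0 (_ : (fun j => _) = fun=> 0); first exact: cvg_cst.
  by apply/funext => j; rewrite big_ord0.
rewrite big_ord_recr (_ : (fun j => _) =
    fun j => (\sum_(i < n) u (widen_ord (leqnSn n) i) j) + u ord_max j).
  apply: cvgDC; last exact: h.
  exact: (IH (fun i => u (widen_ord (leqnSn n) i)) (fun i => l (widen_ord (leqnSn n) i))).
by apply/funext => j; rewrite big_ord_recr.
Qed.

Lemma cvg_dconv P b s (l : C) : dpartial b s @ \oo --> l ->
  dpartial (dconv P b) s @ \oo --> dpoly_eval P s * l.
Proof.
move=> hb; rewrite /dpoly_eval mulr_suml.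
have -> : dpartial (dconv P b) s = fun N => \sum_(d < size P)
    (P`_d * natpowN d.+1 s) * dpartial b s (N %/ d.+1).
  by apply/funext => N; rewrite dpartial_dconv.
apply: (cvg_sumC (u := fun (d : 'I_(size P)) N => P`_d * natpowN d.+1 s * dpartial b s (N %/ d.+1))
  (l := fun d : 'I_(size P) => P`_d * natpowN d.+1 s * l)) => d.
apply: (@cvgMC _ (fun=> P`_d * natpowN d.+1 s)); first exact: cvg_cst.
have hd : (fun N => (N %/ d.+1)%N) @ \oo --> \oo.
  move=> A [K _ hK]; exists (K * d.+1)%N => // N /= hN; apply: hK => /=.
  by rewrite leq_divRL.
exact: cvg_comp hd hb.
Qed.

Lemma dgrowth_dconv P b tau B : 0 <= tau -> dgrowth b tau B ->
  dgrowth (dconv P b) tau ((\sum_(d < size P) cmod P`_d) * B).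
Proof.
move=> tau0 hb n; have B0 := dgrowth_ge0 hb.
apply: le_trans (cmod_sum _ _ _) _; rewrite !mulr_suml big_mkcond /=.
apply: ler_sum => d _; case: ifPn => hd; last by rewrite !mulr_ge0 ?cmod_ge0 ?powR_ge0.
rewrite cmodM -mulrA ler_wpM2l ?cmod_ge0 //; apply: le_trans (hb _) _.
rewrite ler_wpM2l //; apply: ge0_ler_powR; rewrite ?nnegrE ?ler0n // ler_nat prednK.
  by rewrite leq_div.
by rewrite divn_gt0 // dvdn_leq.
Qed.

(** The products (d + 1)(e + 1) of occurring indices are at most [size P * size Q], so nothing is
    cut off. *)
Definition dmul P Q : {poly C} :=
  \poly_(n < size P * size Q) dconv P (fun n => Q`_n) n.

Lemma dmul_coef P Q n : (dmul P Q)`_n = dconv P (fun n => Q`_n) n.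
Proof.
rewrite coef_poly; case: ltnP => // h; rewrite /dconv big1 // => d hd.
rewrite [Q`__]nth_default ?mulr0 //.
have /dvdnP[q hq] := hd; rewrite hq mulnK //.
have h1 : (size P * size Q < q * d.+1)%N by rewrite -hq ltnS.
have h2 := ltn_ord d.
case: q hq h1 => [|q] _ // h1; rewrite /= -ltnS.
rewrite -(ltn_pmul2r (ltn0Sn d)); apply: leq_ltn_trans h1; by rewrite mulnC leq_mul2r h2 orbT.
Qed.

Lemma dmul_eval P Q s : dpoly_eval (dmul P Q) s = dpoly_eval P s * dpoly_eval Q s.
Proof.
apply: (@cvg_unique_C _ (dpartial (fun n => (dmul P Q)`_n) s)); first exact: cvg_dpoly.
rewrite (_ : (fun n => (dmul P Q)`_n) = dconv P (fun n => Q`_n)).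
  exact/cvg_dconv/cvg_dpoly.
by apply/funext => n; rewrite dmul_coef.
Qed.

(** The terms of a convergent series tend to 0, here at the real point [tau]; finitely many
    coefficients are left to account for. *)
Lemma converges_dgrowth theta a : converges_on theta a ->
  exists tau B, 0 <= tau /\ dgrowth a tau B.
Proof.
move=> h; pose tau := `|theta| + 1.
have tau0 : 0 <= tau by rewrite addr_ge0.
have hs : theta < complex.Re (tau%:C : C).
  by rewrite /= /tau (le_lt_trans (ler_norm _)) // ltrDl.
have /cvg_ex[l hl] := h _ hs.
have hl' : (fun n => dpartial a tau%:C n.+1) @ \oo --> l by rewrite (cvg_shiftS _).
have := cvgBC hl' hl; rewrite subrr => /cvg_cmodP/(_ _ ltr01) [K _ hK].
exists tau, (1 + \sum_(n < K) cmod (a n)); split=> // n.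
have p1 : 1 <= (n.+1%:R : R) `^ tau.
  by rewrite -[leLHS](@powRr0 R n.+1%:R); exact: natr_powR_le.
have p0 : 0 < (n.+1%:R : R) `^ tau by exact: lt_le_trans p1.
have S0 : 0 <= \sum_(n < K) cmod (a n) by apply: sumr_ge0 => i _; exact: cmod_ge0.
have [nK|Kn] := ltnP n K.
  apply: (@le_trans _ _ (\sum_(n < K) cmod (a n))).
    by rewrite (bigD1 (Ordinal nK)) //= lerDl sumr_ge0 // => i _; exact: cmod_ge0.
  by rewrite -[leLHS]mulr1; apply: ler_pM => //; rewrite lerDr.
have := hK n Kn; rewrite /= sub0r cmodN dpartialS [X in X - _]addrC addrK.
rewrite cmodM cmod_natpowN /= powRN ltr_pdivrMr // => /ltW ht.
apply: (le_trans ht).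
by rewrite ler_wpM2r ?powR_ge0 // lerDl.
Qed.

Lemma ln_le_id (n : nat) : 0 <= ln (n.+1%:R : R) <= n.+1%:R.
Proof.
by rewrite ln_ge0 ?ler1n //= ltW // ln_sublinear.
Qed.

Lemma dgrowth_ln a tau B : dgrowth a tau B ->
  dgrowth (fun n => a n * (- ln (n.+1%:R : R))%:C) (tau + 1) B.
Proof.
move=> h n; have /andP[l0 l1] := ln_le_id n.
rewrite cmodM cmod_real normrN ger0_norm // powRD ?pnatr_eq0 ?implybT //.
by rewrite powRr1 // mulrA; apply: ler_pM => //; exact: cmod_ge0.
Qed.

Lemma dsum_derive1 a tau B s : dgrowth a tau B -> tau + 3 <= complex.Re s ->
  derive1 (dsum a) s = dsum (fun n => a n * (- ln (n.+1%:R : R))%:C) s.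
Proof.
move=> h hs; have B0 := dgrowth_ge0 h.
have hd z : cmod z <= 1 -> tau + 2 <= complex.Re (s + z).
  move=> z1; rewrite ReD; have := Re_le_cmod z; rewrite ler_norml => /andP[+ _].
  by lra.
have [|e e0|_ hc] := @weierstrass_dpoly _ (fun N => \poly_(n < N) a n) (dsum a) s 1 ltr01.
- move=> z z1; under eq_fun do rewrite dpoly_eval_poly.
  exact: dgrowth_cvg h (hd z z1).
- have [K hK] := exists_natr_gt (4 * B / e).
  have hK' : 4 * B / K.+1%:R <= e.
    rewrite ler_pdivrMr ?ltr0n // [e * _]mulrC -ler_pdivrMr //.
    by apply: le_trans (ltW hK) _; rewrite ler_nat.
  exists K => k l Kk Kl z z1; rewrite !dpoly_eval_poly.
  rewrite (_ : _ - _ = (dpartial a (s + z) k - dpartial a (s + z) K) - (dpartial a (s + z) l - dpartial a (s + z) K)); last by ring.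
  apply: le_trans (ler_cmodB _ _) _.
  apply: le_trans hK'; rewrite (_ : 4 * B / _ = 2 * B / K.+1%:R + 2 * B / K.+1%:R); last by ring.
  by apply: lerD; apply: dpartial_tail h (hd z z1) _.
apply: (cvg_unique_C hc).
have E N : dpoly_eval (dderiv (\poly_(n < N) a n)) s =
    dpartial (fun n => a n * (- ln (n.+1%:R : R))%:C) s N.
  rewrite -dpoly_eval_poly; congr dpoly_eval; apply/polyP => n.
  by rewrite dderiv_coef !coef_poly; case: ifP => _; rewrite ?mul0r.
under eq_fun do rewrite E.
apply: dgrowth_cvg (dgrowth_ln h) _; lra.
Qed.

End DirichletConvolution.


(** * Coefficients of the Volterra operator *)

Section LaplaceIntegral.
Variable R : realType.
Local Notation C := (Cplx R).
Local Notation mu := (@lebesgue_measure R).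
Implicit Types (l r B : R).

Lemma continuous_expR_lin (k l : R) : continuous (fun x : R => k * expR (- (x * l))).
Proof.
move=> x; apply: (@continuousM _ _ (cst k) (fun x : R => expR (- (x * l)))); first exact: cst_continuous.
apply: (@continuous_comp _ _ _ (fun x : R => - (x * l)) expR); last exact: continuous_expR.
apply: continuousN; apply: continuousM; [exact: id|exact: cst_continuous].
Qed.

Lemma integral_expRN l : 0 < l ->
  (\int[mu]_(x in `[0%R, +oo[) (expR (- (x * l)))%:E = (l^-1)%:E)%E.
Proof.
move=> l0.
have hF (x : R) : is_derive x 1 (fun x : R => - l^-1 * expR (- (x * l))) (expR (- (x * l))).
  have h1 : is_derive x 1 (fun x : R => - (x * l)) (- l).
    rewrite (_ : (fun x : R => - (x * l)) = fun x : R => (- l) * x ^+ 1).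
      by apply: (is_derive_eq (is_derive_monomial (- l) 0 x)); rewrite expr0 !mulr1.
    by apply/funext => y; rewrite expr1 mulNr mulrC.
  have h2 := @is_derive1_comp _ expR (fun x : R => - (x * l)) x _ _ (is_derive_expR (- (x * l))) h1.
  have h3 := @is_deriveZ _ _ _ _ (- l^-1) x 1 _ h2.
  apply: (is_derive_eq h3); rewrite /GRing.scale /=; field; lra.
rewrite (@ge0_continuous_FTC2y _ _ (fun x : R => - l^-1 * expR (- (x * l))) 0 0).
- by rewrite mul0r oppr0 expR0 mulr1 -EFinB sub0r opprK.
- by move=> x _; exact: expR_ge0.
- apply: continuous_subspaceT => x.
  by have := @continuous_expR_lin 1 l x; under eq_fun do rewrite mul1r.
- rewrite -[X in _ --> X](mulr0 (- l^-1)); apply: cvgMr.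
  apply: (@cvg_comp _ _ _ (fun x : R => x * l) (fun x => expR (- x)) _ (pinfty_nbhs R)); last exact: cvgr_expR.
  exact: gt0_cvgMly.
- by move=> x _; exact: ex_derive.
- apply: cvg_at_right_filter; exact: continuous_expR_lin.
- by move=> x _; rewrite derive1E; exact: derive_val.
Qed.

Lemma integrable_expRN k l : 0 < l ->
  mu.-integrable `[0%R, +oo[%classic (fun x => (k * expR (- (x * l)))%:E).
Proof.
move=> l0.
have m1 : measurable_fun (`[0%R, +oo[%classic : set R) (fun x : R => expR (- (x * l))).
  apply: measurable_funTS; apply: continuous_measurable_fun => x.
  by have := @continuous_expR_lin 1 l x; under eq_fun do rewrite mul1r.
have h : mu.-integrable `[0%R, +oo[%classic (fun x => (expR (- (x * l)))%:E).
  apply/integrableP; split; first exact/measurable_EFinP.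
  under eq_integral do rewrite gee0_abs ?lee_fin ?expR_ge0 //.
  by rewrite integral_expRN // ltry.
rewrite (_ : (fun x => _) = (fun x => k%:E * (expR (- (x * l)))%:E)%E); last first.
  by apply/funext => x; rewrite EFinM.
by apply: integrableZl => //; exact: measurable_itv.
Qed.

(** Dominated convergence. The constant term has to vanish since it is not integrable; every other
    term decays at least as fast as 2^{-x}, which gives the dominating function. *)
Lemma cvg_integral_exp_sum (r : nat -> R) (phi : R -> R) B : 0 <= B ->
  (forall n, `|r n| <= B * n.+1%:R `^ (- 2)) -> r 0%N = 0 ->
  (forall x, 0 <= x -> (fun N => \sum_(n < N) r n * expR (- (x * ln (n.+1%:R : R)))) @ \oo --> phi x) ->
  (fun N => \sum_(n < N) r n / ln (n.+1%:R : R)) @ \oo -->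
    \int[mu]_(x in `[0, +oo[) phi x.
Proof.
move=> B0 hr r0 hphi.
pose D : set (measurableTypeR R) := `[0%R, +oo[%classic.
have mD : measurable D by exact: measurable_itv.
pose f N (x : measurableTypeR R) : \bar R := (\sum_(n < N) r n * expR (- (x * ln (n.+1%:R : R))))%:E.
have ln2 : 0 < ln (2 : R) by rewrite ln_gt0 // ltr1n.
have i1 n : mu.-integrable D (fun x => (r n * expR (- (x * ln (n.+1%:R : R))))%:E).
  case: n => [|n].
    under eq_fun do rewrite r0 mul0r; exact: integrable0.
  apply: integrable_expRN; rewrite ln_gt0 // ltr1n //.
have iN N : mu.-integrable D (f N) /\
   (\int[mu]_(x in D) f N x = (\sum_(n < N) r n / ln (n.+1%:R : R))%:E)%E.
  elim: N => [|N [IH1 IH2]].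
    rewrite /f; under eq_fun do rewrite big_ord0; split; first exact: integrable0.
    by rewrite integral0 big_ord0.
  have E : f N.+1 = (f N \+ (fun x => (r N * expR (- (x * ln (N.+1%:R : R))))%:E))%E.
    by apply/funext => x; rewrite /f big_ord_recr EFinD.
  split; first by rewrite E; exact: integrableD.
  rewrite E integralD // IH2 big_ord_recr EFinD; congr (_ + _)%E.
  case: N {IH1 IH2 E} => [|N].
    under eq_integral do rewrite r0 mul0r; by rewrite integral0 r0 mul0r.
  have lN : 0 < ln (N.+2%:R : R) by rewrite ln_gt0 // ltr1n.
  under eq_integral do rewrite EFinM.
  rewrite integralZl //; first by rewrite integral_expRN // -EFinM.
  rewrite (_ : (fun x => _) = (fun x => (1 * expR (- (x * ln (N.+2%:R : R))))%:E)).
    exact: integrable_expRN.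
  by apply/funext => x; rewrite mul1r.
have mf N : measurable_fun D (f N) by have [/integrableP[]] := iN N.
have fphi x : D x -> f ^~ x @ \oo --> (phi x)%:E.
  rewrite /D /= in_itv /= andbT => x0; apply/cvg_EFin; last exact: hphi.
  by near=> n.
have ig : mu.-integrable D (fun x => (2 * B * expR (- (x * ln 2)))%:E).
  exact: integrable_expRN.
have fg : {ae mu, forall x n, D x -> (`|f n x| <= (2 * B * expR (- (x * ln 2)))%:E)%E}.
  apply: aeW => x N; rewrite /D /= in_itv /= andbT => x0.
  rewrite /f lee_fin; apply: le_trans (ler_norm_sum _ _ _) _.
  apply: (@le_trans _ _ (\sum_(n < N) B * n.+1%:R `^ (- 2) * expR (- (x * ln 2)))).
    apply: ler_sum => n _; rewrite normrM (ger0_norm (expR_ge0 _)).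
    case: n => [[|n] /= _].
      by rewrite r0 normr0 mul0r !mulr_ge0 ?expR_ge0 ?powR_ge0.
    have hl : expR (- (x * ln (n.+2%:R : R))) <= expR (- (x * ln (2 : R))).
      by rewrite ler_expR lerN2 ler_wpM2l // ler_ln ?posrE ?ltr0n // ler_nat.
    exact: ler_pM (normr_ge0 _) (expR_ge0 _) (hr n.+1) hl.
  rewrite -mulr_suml ler_wpM2r ?expR_ge0 // -mulr_sumr mulrC ler_wpM2r //.
  have := @sum_inv_sqr_tail R 0 N (leq0n N); rewrite big_mkord divr1; exact.
have mphi : measurable_fun D (fun x => (phi x)%:E).
  exact: (emeasurable_fun_cvg _ _ mf fphi).
have [_ _] := dominated_convergence mD mf mphi (aeW _ fphi) ig fg.
rewrite /Rintegral.
have -> : [sequence (\int[mu]_(x in D) f n x)%E]_n = (fun N => (\sum_(n < N) r n / ln (n.+1%:R : R))%:E).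
  by apply/funext => N; rewrite /= (iN N).2.
have [ip _ _] := dominated_convergence mD mf mphi (aeW _ fphi) ig fg.
have fin := integrable_fin_num mD ip.
rewrite -(fineK fin) => /fine_cvg; exact.
Unshelve. all: end_near.
Qed.

Lemma natpowN_real n (x : R) : natpowN n.+1 (x%:C : C) = (expR (- (x * ln (n.+1%:R : R))))%:C.
Proof.
rewrite natpowNE // /cexp.
have -> : complex.Re (- ((x%:C : C) * (ln (n.+1%:R : R))%:C)) = - (x * ln (n.+1%:R : R)).
  by rewrite /=; ring.
have -> : complex.Im (- ((x%:C : C) * (ln (n.+1%:R : R))%:C)) = 0.
  by rewrite /=; ring.
by rewrite cos0 sin0 mulr1 mulr0.
Qed.

(** Along the ray, n^{-s-x} integrates to n^{-s} / ln n; real and imaginary parts are treated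
    separately, as in [ray_integral]. *)
Lemma ray_integral_dsum (F : C -> C) (c : nat -> C) (tau B : R) (s : C) :
  dgrowth c tau B -> tau + 2 <= complex.Re s -> c 0%N = 0 ->
  (forall x : R, 0 <= x -> F (s + x%:C) = dsum c (s + x%:C)) ->
  ray_integral F s = dsum (fun n => c n / (ln (n.+1%:R : R))%:C) s.
Proof.
move=> hc hs c0 hF; have B0 := dgrowth_ge0 hc.
pose t n := c n * natpowN n.+1 s.
have tn n : cmod (t n) <= B * n.+1%:R `^ (- 2) by exact: dgrowth_term hs.
have t0 : t 0%N = 0 by rewrite /t c0 mul0r.
have hx (x : R) : 0 <= x -> tau + 2 <= complex.Re (s + x%:C).
  by move=> x0; rewrite ReD /= (le_trans hs) // lerDl.
have E (x : R) N : dpartial c (s + x%:C) N = \sum_(n < N) t n * (expR (- (x * ln (n.+1%:R : R))))%:C.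
  rewrite dpartialE; apply: eq_bigr => n _.
  by rewrite natpowND natpowN_real mulrA.
have hE (x : R) : 0 <= x ->
    (fun N => \sum_(n < N) t n * (expR (- (x * ln (n.+1%:R : R))))%:C) @ \oo --> dsum c (s + x%:C).
  move=> x0; have := dgrowth_cvg hc (hx x x0).
  by rewrite (_ : dpartial c (s + x%:C) = fun N => \sum_(n < N) t n * (expR (- (x * ln (n.+1%:R : R))))%:C) //; apply/funext => N; rewrite E.
symmetry; apply: dsum_cvg.
have Eq N : dpartial (fun n => c n / (ln (n.+1%:R : R))%:C) s N =
    \sum_(n < N) t n * ((ln (n.+1%:R : R))^-1)%:C.
  by rewrite dpartialE; apply: eq_bigr => n _; rewrite fmorphV /t mulrAC.
rewrite (_ : dpartial _ _ = fun N => \sum_(n < N) t n * ((ln (n.+1%:R : R))^-1)%:C); last first.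
  by apply/funext => N; exact: Eq.
have ReC (z : C) (x : R) : complex.Re (z * x%:C) = complex.Re z * x.
  by rewrite ReM /= mulr0 subr0.
have ImC (z : C) (x : R) : complex.Im (z * x%:C) = complex.Im z * x.
  by rewrite ImM /= mulr0 add0r.
apply: cvg_ReIm.
- have := @cvg_integral_exp_sum (fun n => complex.Re (t n)) (fun x => complex.Re (F (s + x%:C))) B B0 _ _ _.
  rewrite (_ : (fun N => complex.Re _) = fun N => \sum_(n < N) complex.Re (t n) / ln (n.+1%:R : R)); last first.
    by apply/funext => N; rewrite Re_sum; apply: eq_bigr => n _; rewrite ReC.
  apply.
  + by move=> n; exact: le_trans (Re_le_cmod _) (tn n).
  + by rewrite t0.
  + move=> x x0; rewrite hF //; have := cvg_Re (hE x x0).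
    rewrite (_ : (fun N => complex.Re _) = fun N => \sum_(n < N) complex.Re (t n) * expR (- (x * ln (n.+1%:R : R)))) //.
    by apply/funext => N; rewrite Re_sum; apply: eq_bigr => n _; rewrite ReC.
- have := @cvg_integral_exp_sum (fun n => complex.Im (t n)) (fun x => complex.Im (F (s + x%:C))) B B0 _ _ _.
  rewrite (_ : (fun N => complex.Im _) = fun N => \sum_(n < N) complex.Im (t n) / ln (n.+1%:R : R)); last first.
    by apply/funext => N; rewrite Im_sum; apply: eq_bigr => n _; rewrite ImC.
  apply.
  + by move=> n; exact: le_trans (Im_le_cmod _) (tn n).
  + by rewrite t0.
  + move=> x x0; rewrite hF //; have := cvg_Im (hE x x0).
    rewrite (_ : (fun N => complex.Im _) = fun N => \sum_(n < N) complex.Im (t n) * expR (- (x * ln (n.+1%:R : R)))) //.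
    by apply/funext => N; rewrite Im_sum; apply: eq_bigr => n _; rewrite ImC.
Qed.

Lemma dgrowthW (c : nat -> C) (tau tau' B : R) : tau <= tau' -> dgrowth c tau B -> dgrowth c tau' B.
Proof.
move=> tt h n; apply: le_trans (h n) _; rewrite ler_wpM2l ?(dgrowth_ge0 h) //.
exact: natr_powR_le.
Qed.

Lemma dgrowthD (c c' : nat -> C) (tau B B' : R) : dgrowth c tau B -> dgrowth c' tau B' ->
  dgrowth (fun n => c n + c' n) tau (B + B').
Proof.
move=> h h' n; apply: le_trans (ler_cmodD _ _) _; rewrite mulrDl; exact: lerD.
Qed.

Lemma dconv0 (P : {poly C}) (b : nat -> C) : b 0%N = 0 -> dconv P b 0 = 0.
Proof.
move=> b0; rewrite /dconv big1 // => d; rewrite dvdn1 => /eqP ->.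
by rewrite divn1 /= b0 mulr0.
Qed.

(** Far to the right the ray integral is itself a Dirichlet series, so adding it to [h] gives a
    series that vanishes on a vertical line; [dsum_coef_le] with bound 0 then kills all
    coefficients. The result is h' = P g' read on coefficients, which holds regardless of where the
    series converge. *)
Lemma volterra_coef (P : {poly C}) (g h : nat -> C) :
  is_volterra g (fun n => P`_n) h ->
  h 0%N = 0 /\ forall n, (ln (n.+1%:R : R))%:C * h n =
    dconv P (fun e => g e * (ln (e.+1%:R : R))%:C) n.
Proof.
case=> theta [_ cg ch H].
have [tg [Bg [tg0 hg]]] := converges_dgrowth cg.
have [th [Bh [th0 hh]]] := converges_dgrowth ch.
pose b n := g n * (- ln (n.+1%:R : R))%:C.
have hb : dgrowth b (tg + 1) Bg by exact: dgrowth_ln.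
have tg1 : 0 <= tg + 1 by rewrite addr_ge0.
pose c := dconv P b; have hc := @dgrowth_dconv _ P _ _ _ tg1 hb; rewrite -/c in hc.
set Bc := _ * Bg in hc.
have c0 : c 0%N = 0 by apply: dconv0; rewrite /b ln1 oppr0 mulr0.
(* Coefficients of the ray integral. At [n = 0] the divisor is ln 1 = 0 and the quotient is 0, in
   agreement with [c0]. *)
pose q n := c n / (ln (n.+1%:R : R))%:C.
have ln2 : 0 < ln (2 : R) by rewrite ln_gt0 // ltr1n.
have hq : dgrowth q (tg + 1) (Bc / ln 2).
  case=> [|n]; first by rewrite /q c0 mul0r cmod0 mulr_ge0 ?powR_ge0 // divr_ge0 ?(dgrowth_ge0 hc) // ltW.
  rewrite /q cmodM cmodV cmod_real ger0_norm ?ln_ge0 ?ler1n //.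
  rewrite mulrAC; apply: ler_pM; rewrite ?cmod_ge0 ?invr_ge0 ?ln_ge0 ?ler1n //.
  by rewrite lef_pV2 ?posrE // ?ln_gt0 ?ltr1n // ler_ln ?posrE ?ltr0n // ler_nat.
pose tau := Num.max th (tg + 1).
have ha : dgrowth (fun n => h n + q n) tau (Bh + Bc / ln 2).
  by apply: dgrowthD; [apply: dgrowthW hh|apply: dgrowthW hq]; rewrite /tau le_max lexx ?orbT.
have hth : th <= tau by rewrite /tau le_max lexx.
have htg : tg + 1 <= tau by rewrite /tau le_max lexx orbT.
pose sigma := tau + 3 + `|theta|.
have hsum (t : R) : dsum (fun n => h n + q n) (sigma +i* t) = 0.
  set s : C := sigma +i* t.
  have nth := normr_ge0 theta; have tle := ler_norm theta.
  have s1 : tau + 3 <= complex.Re s by rewrite /= /sigma; lra.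
  have s2 : theta < complex.Re s.
    by rewrite /= /sigma; have : 0 <= tau by [exact: le_trans hth]; lra.
  have sh : dpartial h s @ \oo --> dsum h s by apply: dgrowth_cvg hh _; lra.
  have sq : dpartial q s @ \oo --> dsum q s by apply: dgrowth_cvg hq _; lra.
  have -> : dsum (fun n => h n + q n) s = dsum h s + dsum q s.
    apply: dsum_cvg; have := cvgDC sh sq.
    rewrite (_ : (fun N => _ + _) = dpartial (fun n => h n + q n) s) //.
    apply/funext => N; rewrite !dpartialE -big_split /=; apply: eq_bigr => n _.
    by rewrite mulrDl.
  rewrite (H _ s2).
  rewrite (@ray_integral_dsum _ c (tg + 1) Bc s hc) ?addNr //; first lra.
  move=> x x0.
  have hsx : tg + 4 <= complex.Re (s + x%:C).
    by rewrite ReD [complex.Re x%:C]/=; move: (complex.Re s) s1 => u u1; lra.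
  rewrite dsum_dpoly (dsum_derive1 hg); last lra.
  symmetry; apply: dsum_cvg; apply: cvg_dconv; apply: dgrowth_cvg hb _; lra.
have a0 n : h n + q n = 0.
  have := @dsum_coef_le _ _ _ _ sigma 0 n ha _ _.
  have -> : tau + 2 <= sigma by rewrite /sigma; have := normr_ge0 theta; lra.
  move=> /(_ isT) hh0.
  have {}hh0 : cmod (h n + q n) * n.+1%:R `^ (- sigma) <= 0.
    by apply: hh0 => t; rewrite hsum cmod0.
  apply/eqP; rewrite -cmod_eq0 eq_le cmod_ge0 andbT.
  by rewrite -(@ler_pM2r _ (n.+1%:R `^ (- sigma))) ?mul0r // powR_gt0 // ltr0n.
have hE n : h n = - q n by apply/eqP; rewrite -addr_eq0 a0.
split; first by rewrite hE /q c0 mul0r oppr0.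
move=> n; rewrite hE /q.
have cE : c n = - dconv P (fun e => g e * (ln (e.+1%:R : R))%:C) n.
  rewrite /c /dconv -sumrN; apply: eq_bigr => d _.
  by rewrite /b rmorphN; ring.
case: n cE => [|n] cE; first by rewrite ln1 mul0r; apply/eqP; rewrite eq_sym -oppr_eq0 -cE c0.
rewrite cE mulNr opprK mulrCA mulfV ?mulr1 //.
by rewrite -(rmorph0 (@real_complex R)) (inj_eq (@complexI R)) gt_eqF // ln_gt0 // ltr1n.
Qed.

End LaplaceIntegral.


(** * Sums over primes *)

Section PrimeSums.
Variable R : realType.
Implicit Types (x e : R).

Definition smooth j n := all (fun q => q < j)%N (primes n).

(** Partial sums of the zeta series over integers whose prime factors are all below [j]: Euler
    products are compared with these finite sums, so no infinite product occurs. *)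
Definition zsum x j N : R := \sum_(n < N | smooth j n.+1) n.+1%:R `^ (- x).

Lemma expR_ge_sub_inv (b a : R) : 0 < a -> 0 < b -> (b - a) / b <= ln b - ln a <= (b - a) / a.
Proof.
move=> a0 b0; have key (u v : R) : 0 < u -> 0 < v -> ln v - ln u <= (v - u) / u.
  move=> u0 v0; rewrite -ln_div ?posrE //.
  have E : v / u = 1 + (v - u) / u by field; lra.
  have h0 : 0 < v / u by rewrite divr_gt0.
  by rewrite E; apply: le_ln1Dx; lra.
apply/andP; split; last exact: key.
have := key b a b0 a0; rewrite (_ : (b - a) / b = - ((a - b) / b)); last by ring.
by move: ((a - b) / b) => u; lra.
Qed.

(** Compares e x^{-1-e} with the increments of -x^{-e} through the tangent-line bounds of ln and
    exp; sums over unit steps then telescope, which replaces the integral test. *)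
Lemma powRN_diff_le e (a b : R) : 0 < e -> 0 < a -> 0 < b ->
  e * b `^ (- (1 + e)) * (b - a) <= a `^ (- e) - b `^ (- e) /\
  a `^ (- e) - b `^ (- e) <= e * a `^ (- (1 + e)) * (b - a).
Proof.
move=> e0 a0 b0; have /andP[h1 h2] := expR_ge_sub_inv a0 b0.
have pE (u v : R) : 0 < u -> 0 < v -> u `^ (- e) = v `^ (- e) * expR (e * (ln v - ln u)).
  by move=> u0 v0; rewrite /powR !gt_eqF // -expRD; congr expR; ring.
have pS (u : R) : 0 < u -> u `^ (- (1 + e)) = u `^ (- e) / u.
  by move=> u0; rewrite opprD addrC powRD ?(gt_eqF u0) ?implybT // powR_inv1 // ltW.
split.
- rewrite (pE a b) // (pS b) //.
  have := expR_ge1Dx (e * (ln b - ln a)).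
  have p0 : 0 < b `^ (- e) by rewrite powR_gt0.
  move: (b `^ (- e)) (expR _) p0 => B X B0 hX.
  have h3 : e * ((b - a) / b) <= e * (ln b - ln a) by rewrite ler_pM2l.
  rewrite (_ : e * (B / b) * (b - a) = B * (e * ((b - a) / b))); last by ring.
  have h4 : e * ((b - a) / b) <= X - 1 by lra.
  by have := ler_wpM2l (ltW B0) h4; rewrite mulrBr mulr1.
- rewrite (pE b a) // (pS a) //.
  have := expR_ge1Dx (e * (ln a - ln b)).
  have p0 : 0 < a `^ (- e) by rewrite powR_gt0.
  move: (a `^ (- e)) (expR _) p0 => A X A0 hX.
  have h3 : e * (ln b - ln a) <= e * ((b - a) / a) by rewrite ler_pM2l.
  rewrite (_ : e * (A / a) * (b - a) = A * (e * ((b - a) / a))); last by ring.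
  have h4 : 1 - X <= e * ((b - a) / a) by lra.
  by have := ler_wpM2l (ltW A0) h4; rewrite mulrBr mulr1.
Qed.

Lemma zeta_upper e N : 0 < e -> \sum_(n < N) (n.+1%:R : R) `^ (- (1 + e)) <= 1 + e^-1.
Proof.
move=> e0; have ei : 0 <= e^-1 by rewrite invr_ge0 ltW.
case: N => [|N]; first by rewrite big_ord0; lra.
apply: (@le_trans _ _ (1 + (1 - N.+1%:R `^ (- e)) * e^-1)); last first.
  by rewrite lerD2l ler_piMl // lerBlDr lerDl powR_ge0.
elim: N => [|N IH]; first by rewrite big_ord1 !powR1; lra.
rewrite big_ord_recr /=.
have [h _] := @powRN_diff_le e N.+1%:R N.+2%:R e0 (ltr0Sn _ _) (ltr0Sn _ _).
move: h; rewrite -natrB // subSnn mulr1 => h.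
have h' : N.+2%:R `^ (- (1 + e)) <= (N.+1%:R `^ (- e) - N.+2%:R `^ (- e)) * e^-1.
  by rewrite ler_pdivlMr // mulrC.
apply: le_trans (lerD IH h') _; lra.
Qed.

Lemma zeta_lower e N : 0 < e ->
  (1 - N.+1%:R `^ (- e)) / e <= \sum_(n < N) (n.+1%:R : R) `^ (- (1 + e)).
Proof.
move=> e0; elim: N => [|N IH]; first by rewrite big_ord0 powR1 subrr mul0r.
rewrite big_ord_recr /=.
have [_ h] := @powRN_diff_le e N.+1%:R N.+2%:R e0 (ltr0Sn _ _) (ltr0Sn _ _).
move: h; rewrite -natrB // subSnn mulr1 => h.
have h' : (N.+1%:R `^ (- e) - N.+2%:R `^ (- e)) * e^-1 <= N.+1%:R `^ (- (1 + e)).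
  by rewrite ler_pdivrMr // mulrC.
apply: le_trans (lerD IH h'); lra.
Qed.

Lemma sum_multiples (V : zmodType) (F : nat -> V) (A : pred nat) q N : (0 < q)%N ->
  \sum_(n < N | (q %| n.+1)%N && A n.+1) F n.+1 =
  \sum_(m < N %/ q | A (q * m.+1)%N) F (q * m.+1)%N.
Proof.
move=> q0; elim: N => [|N IH]; first by rewrite div0n !big_ord0.
rewrite big_mkcond big_ord_recr -big_mkcond IH /= divnS //.
have [hq|hq] := boolP (q %| N.+1)%N; last by rewrite addr0.
rewrite add1n [RHS]big_mkcond big_ord_recr -big_mkcond /=.
have -> // : N.+1 = (q * (N %/ q).+1)%N.
by rewrite -{1}(divnK hq) divnS // hq mulnC.
Qed.

Lemma smoothW j k n : (j <= k)%N -> smooth j n -> smooth k n.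
Proof. by move=> jk; apply: sub_all => q /= h; exact: leq_trans h jk. Qed.

Lemma smoothS q n : prime q -> (0 < n)%N ->
  smooth q n = smooth q.+1 n && ~~ (q %| n)%N.
Proof.
move=> pq n0; apply/idP/andP => [h|[h1 h2]].
  split; first exact: smoothW h.
  apply/negP => qn; have := allP h q; rewrite mem_primes pq n0 qn => /(_ isT).
  by rewrite ltnn.
apply/allP => r rn; have := allP h1 r rn; rewrite ltnS leq_eqVlt => /predU1P[rq|//].
by move: rn; rewrite rq mem_primes (negPf h2) !andbF.
Qed.

Lemma smooth_mul q m : prime q -> (0 < m)%N -> smooth q.+1 (q * m) = smooth q.+1 m.
Proof.
move=> pq m0; have q0 := prime_gt0 pq; apply/allP/allP => h r hr.
  by apply: h; rewrite primesM // hr orbT.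
move: hr; rewrite primesM // => /orP[|]; last exact: h.
by rewrite primes_prime // inE => /eqP ->.
Qed.

(** An integer counted on the left either avoids [q] or is [q] times an integer of the same kind up
    to N / q: the Euler factor at [q] in finite form. *)
Lemma zsum_split x q N : prime q ->
  zsum x q.+1 N = zsum x q N + q%:R `^ (- x) * zsum x q.+1 (N %/ q).
Proof.
move=> pq; have q0 := prime_gt0 pq.
rewrite /zsum (bigID (fun n : 'I_N => (q %| n.+1)%N)) /= addrC; congr (_ + _).
  by apply: eq_bigl => n; rewrite (smoothS pq).
rewrite (eq_bigl (fun n : 'I_N => (q %| n.+1)%N && smooth q.+1 n.+1)); last first.
  by move=> n; rewrite andbC.
rewrite (@sum_multiples _ (fun n => n%:R `^ (- x)) (smooth q.+1)) // mulr_sumr.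
apply: eq_big => [m|m _]; first by rewrite smooth_mul.
by rewrite natrM powRM.
Qed.

Lemma zsum_nonprime x q N : ~~ prime q -> zsum x q.+1 N = zsum x q N.
Proof.
move=> npq; apply: eq_bigl => n; apply/idP/idP => [h|]; last exact: smoothW.
apply/allP => r rn; have := allP h r rn; rewrite ltnS leq_eqVlt => /predU1P[rq|//].
by move: rn; rewrite rq mem_primes (negPf npq).
Qed.

Lemma zsum_ge0 x j N : 0 <= zsum x j N.
Proof. by apply: sumr_ge0 => n _; exact: powR_ge0. Qed.

Lemma zsum_mono x j k N M : (j <= k)%N -> (N <= M)%N -> zsum x j N <= zsum x k M.
Proof.
move=> jk NM; apply: (@le_trans _ _ (zsum x k N)).
  rewrite /zsum [leLHS]big_mkcond [leRHS]big_mkcond; apply: ler_sum => n _.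
  case: ifPn => h; first by rewrite (smoothW jk h).
  by case: ifP => // _; exact: powR_ge0.
rewrite /zsum -(subnKC NM) [leLHS]big_mkcond [leRHS]big_mkcond big_split_ord /= lerDl.
by apply: sumr_ge0 => n _; case: ifP => // _; exact: powR_ge0.
Qed.

Lemma zsum_ge1 x j N : (0 < N)%N -> 1 <= zsum x j N.
Proof.
move=> N0; rewrite /zsum (bigD1 (Ordinal N0)) //= powR1 lerDl.
by apply: sumr_ge0 => n _; exact: powR_ge0.
Qed.

Lemma zsum0 x N : zsum x 0 N <= 1.
Proof.
case: N => [|N]; first by rewrite /zsum big_ord0.
rewrite /zsum (bigD1 ord0) //= powR1 big1 ?addr0 // => n /andP[h n0].
have n1 : (1 < n.+1)%N by rewrite ltnS lt0n; apply: contra n0 => /eqP e; apply/eqP/val_inj.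
have := pdiv_prime n1; move=> pp.
by have := allP h (pdiv n.+1); rewrite mem_primes pp pdiv_dvd /= => /(_ isT).
Qed.

Lemma prime_pow_le_half x q : 1 <= x -> prime q -> 0 <= (q%:R : R) `^ (- x) <= 1 / 2.
Proof.
move=> x1 pq; rewrite powR_ge0 /=.
have q2 : 2 <= (q%:R : R) by rewrite (ler_nat R 2) prime_gt1.
apply: (@le_trans _ _ (q%:R `^ (- 1))).
  by apply: ler_powR; [lra|rewrite lerN2].
rewrite powR_inv1 ?ler0n // mul1r lef_pV2 ?posrE //; lra.
Qed.

Lemma prod_euler_upper x J : exists N, \prod_(q < J | prime q) (1 + q%:R `^ (- x)) <= zsum x J N.+1.
Proof.
elim: J => [|J [N IH]].
  by exists 0%N; rewrite big_ord0 zsum_ge1.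
have [pJ|npJ] := boolP (prime J); last first.
  by exists N; rewrite big_mkcond big_ord_recr -big_mkcond /= (negPf npJ) mulr1 zsum_nonprime.
(* The range is multiplied by [J] so that its quotient by [J] is still [N.+1]. *)
exists (J * N.+1).-1; have J0 := prime_gt0 pJ.
rewrite prednK ?muln_gt0 ?J0 // zsum_split // mulKn //.
rewrite big_mkcond big_ord_recr -big_mkcond /= pJ mulrDr mulr1; apply: lerD.
  apply: le_trans IH _; apply: zsum_mono => //; exact: leq_pmull.
rewrite mulrC ler_wpM2l ?powR_ge0 //; apply: le_trans IH _; exact: zsum_mono.
Qed.

Lemma prod_euler_lower x J N : 1 <= x ->
  zsum x J N * \prod_(q < J | prime q) (1 - q%:R `^ (- x)) <= 1.
Proof.
move=> x1; elim: J => [|J IH]; first by rewrite big_ord0 mulr1 zsum0.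
rewrite big_mkcond big_ord_recr -big_mkcond /=.
have [pJ|npJ] := boolP (prime J); last by rewrite mulr1 zsum_nonprime.
apply: le_trans IH; rewrite mulrCA [leRHS]mulrC.
have h0 : 0 <= \prod_(q < J | prime q) (1 - (q%:R : R) `^ (- x)).
  by apply: prodr_ge0 => q pq; have := prime_pow_le_half x1 pq; lra.
rewrite ler_wpM2l // mulrBr mulr1 lerBlDr [zsum x J.+1 N in leLHS]zsum_split // lerD2l.
rewrite mulrC ler_wpM2r ?powR_ge0 //; apply: zsum_mono => //; exact: leq_div.
Qed.

Lemma sum_prime_sqr_le x J : 1 <= x ->
  \sum_(q < J | prime q) ((q%:R : R) `^ (- x)) ^+ 2 <= 2.
Proof.
move=> x1; apply: (@le_trans _ _ (\sum_(n < J) (n.+1%:R : R) `^ (- (1 + 1)))); last first.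
  by apply: le_trans (zeta_upper J ltr01) _; rewrite invr1.
rewrite big_mkcond /=.
apply: (@le_trans _ _ (\sum_(q < J.+1 | prime q) ((q%:R : R) `^ (- x)) ^+ 2)).
  by rewrite [leRHS]big_mkcond big_ord_recr /= lerDl; case: ifP => // _; exact: sqr_ge0.
rewrite big_mkcond big_ord_recl /= add0r; apply: ler_sum => n _.
rewrite /bump /= add1n; case: ifPn => _; last exact: powR_ge0.
rewrite expr2 -powRD ?pnatr_eq0 ?implybT //; apply: natr_powR_le; lra.
Qed.

Lemma expR_le_1Dx (y : R) : 0 <= y <= 1 / 2 -> expR y <= (1 + y) * expR (2 * y ^+ 2).
Proof.
move=> /andP[y0 y1]; have h1 := expR_ge1Dx (- y); have h2 := expR_ge1Dx (2 * y ^+ 2).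
rewrite expRN in h1.
have e0 := expR_gt0 y.
have h3 : expR y * (1 - y) <= 1.
  by rewrite -ler_pdivlMl // mulr1.
have h4 : expR y * (1 - y) <= (1 + y) * expR (2 * y ^+ 2) * (1 - y).
  apply: le_trans h3 _.
  have : (1 + y) * (1 + 2 * y ^+ 2) * (1 - y) <= (1 + y) * expR (2 * y ^+ 2) * (1 - y).
    by rewrite ler_wpM2r ?ler_wpM2l //; lra.
  apply: le_trans.
  rewrite (_ : _ * _ * _ = 1 + y ^+ 2 * (1 - 2 * y ^+ 2)); last by ring.
  rewrite lerDl mulr_ge0 ?sqr_ge0 //; nra.
by rewrite ler_pM2r in h4; lra.
Qed.

Lemma inv_1Bx_le_expR (y : R) : 0 <= y <= 1 / 2 -> 1 <= (1 - y) * expR (y + 2 * y ^+ 2).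
Proof.
move=> /andP[y0 y1]; have h2 := expR_ge1Dx (y + 2 * y ^+ 2).
have : (1 - y) * (1 + (y + 2 * y ^+ 2)) <= (1 - y) * expR (y + 2 * y ^+ 2).
  by rewrite ler_wpM2l //; lra.
apply: le_trans; nra.
Qed.

(** Passing from exp(y) to 1 + y costs exp(2 y^2) in each factor; the squares sum to at most 2,
    hence the constant [expR 4]. *)
Lemma expR_prime_sum_le e J : 0 < e ->
  expR (\sum_(q < J | prime q) (q%:R : R) `^ (- (1 + e))) <= expR 4 * (1 + e^-1).
Proof.
move=> e0; have x1 : 1 <= 1 + e by lra.
have [N hN] := prod_euler_upper (1 + e) J.
have h1 : expR (\sum_(q < J | prime q) (q%:R : R) `^ (- (1 + e))) <=
   \prod_(q < J | prime q) (1 + (q%:R : R) `^ (- (1 + e))) *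
   expR (2 * \sum_(q < J | prime q) ((q%:R : R) `^ (- (1 + e))) ^+ 2).
  rewrite mulr_sumr !expR_sum -big_split /=; apply: ler_prod => q pq.
  by rewrite expR_ge0 /= expR_le_1Dx // prime_pow_le_half.
apply: le_trans h1 _; rewrite mulrC; apply: ler_pM.
- exact: expR_ge0.
- by apply: prodr_ge0 => q _; rewrite addr_ge0 ?powR_ge0.
- by rewrite ler_expR; have := sum_prime_sqr_le J x1; lra.
- apply: le_trans hN _; apply: le_trans (zeta_upper N.+1 e0).
  rewrite /zsum [leLHS]big_mkcond; apply: ler_sum => n _; case: ifP => // _; exact: powR_ge0.
Qed.

Lemma expR_prime_sum_ge e : 0 < e -> exists J,
  (2 * e)^-1 <= expR 4 * expR (\sum_(q < J | prime q) (q%:R : R) `^ (- (1 + e))).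
Proof.
move=> e0; have x1 : 1 <= 1 + e by lra.
(* With this [N] the partial zeta sum already reaches half of 1 / e. *)
have [N hN] : exists N : nat, (N.+1%:R : R) `^ (- e) <= 1 / 2.
  have [N hN] := exists_natr_gt ((2 : R) `^ e^-1).
  exists N; have N0 : 0 < (N.+1%:R : R) by rewrite ltr0n.
  have h : (2 : R) `^ e^-1 <= N.+1%:R by apply: le_trans (ltW hN) _; rewrite ler_nat.
  have : ((2 : R) `^ e^-1) `^ e <= N.+1%:R `^ e.
    by apply: ge0_ler_powR; rewrite ?nnegrE ?powR_ge0 // ltW.
  rewrite -powRrM mulVf ?gt_eqF // powRr1 // => h2.
  by rewrite powRN mul1r lef_pV2 ?posrE // powR_gt0.
exists N.+1.
have h1 : (2 * e)^-1 <= zsum (1 + e) N.+1 N.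
  apply: (@le_trans _ _ ((1 - N.+1%:R `^ (- e)) / e)).
    rewrite invfM ler_wpM2r ?invr_ge0 ?(ltW e0) //; lra.
  apply: le_trans (zeta_lower N e0) _.
  rewrite /zsum [leRHS]big_mkcond; apply: ler_sum => n _.
  have -> // : smooth N.+1 n.+1.
  apply/allP => q; rewrite mem_primes => /and3P[_ _ /dvdn_leq] /(_ isT) h.
  by apply: leq_ltn_trans h _; rewrite ltnS.
apply: le_trans h1 _.
have h2 := prod_euler_lower N.+1 N x1.
set P := \prod_(q < N.+1 | _) _ in h2.
have h3 : 1 <= P * expR (\sum_(q < N.+1 | prime q) (q%:R : R) `^ (- (1 + e)) +
   2 * \sum_(q < N.+1 | prime q) ((q%:R : R) `^ (- (1 + e))) ^+ 2).
  rewrite mulr_sumr -big_split expR_sum -big_split /=.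
  apply: (@le_trans _ _ (\prod_(q < N.+1 | prime q) 1)); first by rewrite big1.
  by apply: ler_prod => q pq; rewrite ler01 /= inv_1Bx_le_expR // prime_pow_le_half.
rewrite -[leLHS]mulr1; apply: le_trans (ler_wpM2l (zsum_ge0 _ _ _) h3) _.
rewrite mulrA; apply: (@le_trans _ _ (1 * expR (\sum_(q < N.+1 | prime q) (q%:R : R) `^ (- (1 + e)) + 4))).
  apply: ler_pM => //; rewrite ?expR_ge0 ?mulr_ge0 ?zsum_ge0 //.
    by apply: prodr_ge0 => q pq; have := prime_pow_le_half x1 pq; lra.
  by rewrite ler_expR lerD2l; have := sum_prime_sqr_le N.+1 x1; lra.
by rewrite mul1r expRD mulrC.
Qed.

End PrimeSums.


(** * One-variable estimates *)

Section RealEstimates.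
Variable R : realType.
Implicit Types (t u r b p : R).

Lemma expR_taylor2 t : `|t| <= 1 -> `|expR t - (1 + t + t ^+ 2 / 2)| <= 8 * `|t| ^+ 3.
Proof.
move=> t1; have := @cexp_taylor_bound R (t%:C) 3 1; rewrite ler01 lexx => /(_ isT) [].
rewrite cmod_real !mul1r [complex.Re t%:C]/= [complex.Im t%:C]/= cos0 mulr1.
have S3 (f : nat -> R) : taylor_sum f 3 1 = f 0%N + f 1%N + f 2%N / 2.
  rewrite /taylor_sum !big_ord_recr big_ord0 /= !expr1n !factS fact0 !muln1.
  by rewrite !divr1 !mulr1 add0r mul1r.
rewrite S3 (_ : complex.Re (t%:C ^+ 2) = t ^+ 2); last first.
  by rewrite !expr2 ReM /= mulr0 subr0.
move=> + _ => /le_trans; apply.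
have e3 : expR `|t| <= 6.
  have h1 : expR (- (1 / 2)) >= 1 / 2 :> R.
    by apply: le_trans (expR_ge1Dx _); lra.
  have h2 : expR (1 / 2) <= 2 :> R.
    by move: h1; rewrite expRN => h1; rewrite -[leLHS]invrK -[leRHS]invrK lef_pV2 ?posrE ?invr_gt0 ?expR_gt0 // ; lra.
  apply: (@le_trans _ _ (expR (1 / 2) * expR (1 / 2))); first by rewrite -expRD ler_expR; lra.
  have := expR_gt0 (1 / 2 : R); nra.
rewrite !factS fact0 /= (_ : (2 * `|t|) ^+ 3 * _ = (8 / 6) * `|t| ^+ 3); last first.
  by rewrite exprMn !natrM; field.
have := exprn_ge0 3 (normr_ge0 t); nra.
Qed.

(** The expansion of ln (1 + t) to third order, in exponential form. With s = t - t^2 / 2 one has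
    expR s >= 1 + t - 17 |t|^3 and expR s >= 3/8, and 48 times 3/8 exceeds 17. *)
Lemma le_expR_cubic t : `|t| <= 1 / 2 -> 1 + t <= expR (t - t ^+ 2 / 2 + 48 * `|t| ^+ 3).
Proof.
move=> t1; have t0 := normr_ge0 t.
have tt : t ^+ 2 = `|t| ^+ 2 by rewrite -normrX ger0_norm // sqr_ge0.
have [l1 l2] : - `|t| <= t /\ t <= `|t| by move: (lexx `|t|); rewrite ler_norml => /andP.
pose s := t - t ^+ 2 / 2.
have s1 : `|s| <= 5 / 4 * `|t|.
  by rewrite ler_norml /s tt; apply/andP; split; nra.
have s2 : `|s| <= 1 by lra.
have := expR_taylor2 s2; rewrite ler_norml => /andP[h _].
have h3 : `|s| ^+ 3 <= 2 * `|t| ^+ 3.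
  apply: (@le_trans _ _ ((5 / 4 * `|t|) ^+ 3)); first by rewrite lerXn2r ?nnegrE ?mulr_ge0 //; lra.
  rewrite exprMn; have := exprn_ge0 3 t0; nra.
have sE : 1 + s + s ^+ 2 / 2 >= 1 + t - `|t| ^+ 3.
  have -> : s ^+ 2 = t ^+ 2 - t ^+ 2 * t + t ^+ 4 / 4 by rewrite /s; field.
  have q1 : t ^+ 2 * t <= `|t| ^+ 3 by rewrite tt [X in _ <= X]exprSr ler_wpM2l // exprn_ge0.
  have q2 : 0 <= t ^+ 4 by rewrite (exprM t 2 2) sqr_ge0.
  have := exprn_ge0 3 t0; rewrite /s; lra.
have c0 := exprn_ge0 3 t0.
have hs : expR s >= 1 + t - 17 * `|t| ^+ 3 by lra.
have hs' : expR s >= 3 / 8.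
  apply: le_trans (expR_ge1Dx s); move: s1; rewrite ler_norml => /andP[]; lra.
rewrite -/s expRD; have h4 := expR_ge1Dx (48 * `|t| ^+ 3).
have : expR s * (1 + 48 * `|t| ^+ 3) <= expR s * expR (48 * `|t| ^+ 3).
  by rewrite ler_wpM2l // expR_ge0.
apply: le_trans; nra.
Qed.

Lemma expR_le_1D t : `|t| <= 1 / 2 -> expR (t - 2 * t ^+ 2) <= 1 + t.
Proof.
rewrite ler_norml => /andP[t1 t2]; have h := expR_ge1Dx (- (t - 2 * t ^+ 2)).
have p0 : 0 < expR (- (t - 2 * t ^+ 2)) by exact: expR_gt0.
rewrite -[X in expR X]opprK expRN -[leLHS]mul1r ler_pdivrMr //.
have : (1 + t) * (1 + - (t - 2 * t ^+ 2)) <= (1 + t) * expR (- (t - 2 * t ^+ 2)).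
  by rewrite ler_wpM2l //; lra.
apply: le_trans.
rewrite (_ : _ * _ = 1 + t ^+ 2 * (1 + 2 * t)); last by ring.
by rewrite lerDl mulr_ge0 ?sqr_ge0 //; lra.
Qed.

Lemma powR_ge_tangent p t : 1 <= p -> 0 <= t -> 1 + p * (t - 1) <= t `^ p.
Proof.
rewrite le_eqVlt => /predU1P[<-|p1] t0; first by rewrite powRr1 //; lra.
have p0 : 0 < p by lra.
have q0 : 0 < (1 - p^-1)^-1 by rewrite invr_gt0 subr_gt0 invf_lt1.
have := @conjugate_powR R t 1 p (1 - p^-1)^-1 t0 ler01 p0 q0.
rewrite invrK subrKC powR1 !mulr1 => /(_ erefl) h.
rewrite mul1r in h.
have : p * t <= p * (t `^ p / p + (1 - p^-1)) by rewrite ler_pM2l.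
rewrite mulrDr mulrBr mulfV ?gt_eqF // mulrCA mulfV ?gt_eqF //; lra.
Qed.

(** Average the tangent-line inequality at the mean [m]: its linear part cancels. *)
Lemma powR_jensen p n (w x : 'I_n -> R) : 1 <= p -> (forall i, 0 <= w i) ->
  (forall i, 0 <= x i) -> \sum_i w i = 1 ->
  (\sum_i w i * x i) `^ p <= \sum_i w i * x i `^ p.
Proof.
move=> p1 w0 x0 w1; set m := \sum_i w i * x i.
have m0 : 0 <= m by apply: sumr_ge0 => i _; rewrite mulr_ge0.
have [->|mn0] := eqVneq m 0.
  by rewrite powR0 ?gt_eqF //; [apply: sumr_ge0 => i _; rewrite mulr_ge0 ?powR_ge0|lra].
have mp : 0 < m by rewrite lt_neqAle eq_sym mn0.
have mpp : 0 < m `^ p by rewrite powR_gt0.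
apply: (@le_trans _ _ (\sum_i w i * (m `^ p * (1 + p * (x i / m - 1))))); last first.
  apply: ler_sum => i _; rewrite ler_wpM2l //.
  have xm : 0 <= x i / m by rewrite divr_ge0.
  have := ler_wpM2l (ltW mpp) (powR_ge_tangent p1 xm).
  by rewrite -powRM // mulrC [m * _]mulrC divfK.
have E i : w i * (m `^ p * (1 + p * (x i / m - 1))) =
   m `^ p * (1 - p) * w i + m `^ p * p / m * (w i * x i) by ring.
under eq_bigr do rewrite E.
rewrite big_split -!mulr_sumr w1 -/m /= mulr1 divfK //.
by rewrite le_eqVlt; apply/orP; left; apply/eqP; ring.
Qed.

(* [1 + b y + b (b + 1) / 2 y ^ 2], the quadratic truncation of [(1 - y) ^ (- b)],
   satisfies [|.| ^ 2 = |1 - y| ^ (- 2 b)] up to an error of order 3. *)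
Lemma quad_sqr_le b (u v r : R) : `|b| <= 2 -> u ^+ 2 + v ^+ 2 = r ^+ 2 -> 0 <= r <= 1 / 18 ->
  1 + 2 * b * u + b ^+ 2 * r ^+ 2 + b * (b + 1) * (2 * u ^+ 2 - r ^+ 2) +
    b * (b * (b + 1)) * u * r ^+ 2 + (b * (b + 1) / 2) ^+ 2 * r ^+ 4 <=
  expR (b * (2 * u + 2 * u ^+ 2 - r ^+ 2) + 6100 * r ^+ 3).
Proof.
move=> b2 uv /andP[r0 r1].
have ru : `|u| <= r.
  by rewrite -(@ler_pXn2r _ 2) ?nnegrE // -normrX ger0_norm ?sqr_ge0 // -uv lerDl sqr_ge0.
have bb : `|b * (b + 1)| <= 6.
  rewrite normrM; have h1 : `|b + 1| <= 3 by apply: le_trans (ler_normD _ _) _; rewrite normr1; lra.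
  by have := ler_pM (normr_ge0 _) (normr_ge0 _) b2 h1; lra.
have q0 : 0 <= 2 * u ^+ 2 + r ^+ 2 by have := sqr_ge0 u; have := sqr_ge0 r; lra.
have u2 : u ^+ 2 <= r ^+ 2 by rewrite -uv lerDl sqr_ge0.
have q1 : `|2 * u ^+ 2 - r ^+ 2| <= r ^+ 2.
  by rewrite ler_norml; have := sqr_ge0 u; move=> h; apply/andP; split; lra.
have r2 : 0 <= r ^+ 2 by exact: sqr_ge0.
have r3 : 0 <= r ^+ 3 by exact: exprn_ge0.
have r4 : r ^+ 4 <= r ^+ 3 / 18 by rewrite [leLHS]exprSr mulrC; nra.
have r32 : r ^+ 3 <= r ^+ 2 / 18 by rewrite [leLHS]exprSr mulrC; nra.
have r21 : r ^+ 2 <= r / 18 by rewrite expr2; nra.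
set E := b * (b * (b + 1)) * u * r ^+ 2 + (b * (b + 1) / 2) ^+ 2 * r ^+ 4.
have E1 : `|E| <= 13 * r ^+ 3.
  apply: le_trans (ler_normD _ _) _.
  have e1 : `|b * (b * (b + 1)) * u * r ^+ 2| <= 12 * r ^+ 3.
    move: (b * (b + 1)) bb => k kb.
    have h := ler_pM (normr_ge0 _) (normr_ge0 _) b2 kb; rewrite -normrM in h.
    have h' := ler_pM (normr_ge0 _) (normr_ge0 _) h ru; rewrite -normrM in h'.
    rewrite normrM (ger0_norm r2); apply: le_trans (ler_wpM2r r2 h') _.
    by rewrite [r ^+ 3]exprS le_eqVlt; apply/orP; left; apply/eqP; ring.
  have e2 : `|(b * (b + 1) / 2) ^+ 2 * r ^+ 4| <= 9 * r ^+ 4.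
    have r40 : 0 <= r ^+ 4 by exact: exprn_ge0.
    rewrite normrM (ger0_norm r40) ler_wpM2r // ger0_norm ?sqr_ge0 // expr_div_n.
    rewrite -[(b * (b + 1)) ^+ 2]ger0_norm ?sqr_ge0 // normrX.
    have := ler_pM (normr_ge0 _) (normr_ge0 _) bb bb; rewrite -expr2 => h; lra.
  lra.
set m := b ^+ 2 * r ^+ 2 + b * (b + 1) * (2 * u ^+ 2 - r ^+ 2) + E.
have b4 : b ^+ 2 <= 4.
  by rewrite -[b ^+ 2]ger0_norm ?sqr_ge0 // normrX; have := ler_pM (normr_ge0 _) (normr_ge0 _) b2 b2; rewrite -expr2; lra.
have m1 : `|m| <= 11 * r ^+ 2.
  apply: le_trans (ler_normD _ _) _.
  have h1 : `|b ^+ 2 * r ^+ 2 + b * (b + 1) * (2 * u ^+ 2 - r ^+ 2)| <= 10 * r ^+ 2.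
    apply: le_trans (ler_normD _ _) _.
    have h1 := ler_pM (normr_ge0 _) (normr_ge0 _) bb q1; rewrite -normrM in h1.
    have h2 := ler_wpM2r r2 b4.
    have h3 : `|b ^+ 2 * r ^+ 2| <= 4 * r ^+ 2 by rewrite ger0_norm // mulr_ge0 ?sqr_ge0.
    lra.
  lra.
set A := 2 * b * u + m.
have -> : 1 + 2 * b * u + b ^+ 2 * r ^+ 2 + b * (b + 1) * (2 * u ^+ 2 - r ^+ 2) +
    b * (b * (b + 1)) * u * r ^+ 2 + (b * (b + 1) / 2) ^+ 2 * r ^+ 4 = 1 + A.
  by rewrite /A /m /E; ring.
have bu : `|2 * b * u| <= 4 * r.
  rewrite -mulrA normrM ger0_norm // normrM; have := ler_pM (normr_ge0 _) (normr_ge0 _) b2 ru; lra.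
have A1 : `|A| <= 5 * r.
  apply: le_trans (ler_normD _ _) _; lra.
have A2 : `|A| <= 1 / 2 by lra.
(* Cubic errors: 48 times 125 from |A|^3, 44 from A^2 / 2 and 13 from [E], together below 6100. *)
apply: le_trans (le_expR_cubic A2) _; rewrite ler_expR.
have A3 : `|A| ^+ 3 <= 125 * r ^+ 3.
  have : `|A| ^+ 3 <= (5 * r) ^+ 3 by rewrite lerXn2r ?nnegrE ?mulr_ge0.
  by rewrite exprMn; lra.
have A4 : A ^+ 2 >= 4 * b ^+ 2 * u ^+ 2 - 88 * r ^+ 3.
  have -> : A ^+ 2 = 4 * b ^+ 2 * u ^+ 2 + 2 * (2 * b * u) * m + m ^+ 2 by rewrite /A; ring.
  have h1 : `|(2 * b * u) * m| <= 44 * r ^+ 3.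
    rewrite normrM; have := ler_pM (normr_ge0 _) (normr_ge0 _) bu m1.
    by rewrite (_ : 4 * r * (11 * r ^+ 2) = 44 * r ^+ 3) // [r ^+ 3]exprS; ring.
  move: h1; rewrite ler_norml => /andP[h1 _]; have := sqr_ge0 m.
  by move: (m) h1 => m' h1; lra.
have E2 : E <= 13 * r ^+ 3 by apply: le_trans (ler_norm _) E1.
have AE : A = 2 * b * u + b ^+ 2 * r ^+ 2 + b * (b + 1) * (2 * u ^+ 2 - r ^+ 2) + E by rewrite /A /m; ring.
have -> : b * (2 * u + 2 * u ^+ 2 - r ^+ 2) = 2 * b * u + b ^+ 2 * r ^+ 2 + b * (b + 1) * (2 * u ^+ 2 - r ^+ 2) - 2 * b ^+ 2 * u ^+ 2 by ring.
by move: A3 A4 AE; move: (A) => A' A3 A4 AE; lra.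
Qed.

(** Exponential form of the bound on the truncated Poisson kernel, made to be multiplied by
    [powR_quad_le] with b = -2/p: the terms in [u] then cancel. *)
Lemma poisson_le (u r W : R) : `|u| <= r -> 0 <= r <= 1 / 18 ->
  W <= 1 + 2 * u + 2 * (2 * u ^+ 2 - r ^+ 2) + 4 * r ^+ 3 ->
  W <= expR (2 * u + 2 * u ^+ 2 - 2 * r ^+ 2 + 1400 * r ^+ 3).
Proof.
move=> ru /andP[r0 r1] hW; apply: (le_trans hW).
have u2 : u ^+ 2 <= r ^+ 2.
  by rewrite -[u ^+ 2]ger0_norm ?sqr_ge0 // normrX lerXn2r ?nnegrE.
have r2 : 0 <= r ^+ 2 by exact: sqr_ge0.
have r3 : 0 <= r ^+ 3 by exact: exprn_ge0.
have r32 : r ^+ 3 <= r ^+ 2 / 18 by rewrite [leLHS]exprSr mulrC; nra.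
have r21 : r ^+ 2 <= r / 18 by rewrite expr2; nra.
set m := 2 * (2 * u ^+ 2 - r ^+ 2) + 4 * r ^+ 3.
have m1 : `|m| <= 3 * r ^+ 2.
  by rewrite ler_norml /m; have := sqr_ge0 u; move=> h; apply/andP; split; lra.
set A := 2 * u + m.
have -> : 1 + 2 * u + 2 * (2 * u ^+ 2 - r ^+ 2) + 4 * r ^+ 3 = 1 + A by rewrite /A /m; ring.
have bu : `|2 * u| <= 2 * r by rewrite normrM ger0_norm //; lra.
have A1 : `|A| <= 3 * r by apply: le_trans (ler_normD _ _) _; lra.
have A2 : `|A| <= 1 / 2 by lra.
apply: le_trans (le_expR_cubic A2) _; rewrite ler_expR.
have A3 : `|A| ^+ 3 <= 27 * r ^+ 3.
  have : `|A| ^+ 3 <= (3 * r) ^+ 3 by rewrite lerXn2r ?nnegrE ?mulr_ge0.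
  by rewrite exprMn; lra.
have A4 : A ^+ 2 >= 4 * u ^+ 2 - 12 * r ^+ 3.
  have -> : A ^+ 2 = 4 * u ^+ 2 + 2 * ((2 * u) * m) + m ^+ 2 by rewrite /A; ring.
  have h1 : `|(2 * u) * m| <= 6 * r ^+ 3.
    rewrite normrM; have := ler_pM (normr_ge0 _) (normr_ge0 _) bu m1.
    by rewrite (_ : 2 * r * (3 * r ^+ 2) = 6 * r ^+ 3) // [r ^+ 3]exprS; ring.
  move: h1; rewrite ler_norml => /andP[h1 _]; have := sqr_ge0 m; lra.
have -> : A - A ^+ 2 / 2 = 2 * u + (4 * u ^+ 2 - 2 * r ^+ 2 + 4 * r ^+ 3) - A ^+ 2 / 2 by rewrite {1}/A /m; ring.
lra.
Qed.

(** The reverse passage, from an exponential to a quadratic polynomial in [u], whose average over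
    roots of unity can be computed. *)
Lemma expR_quad_upper (u r : R) : `|u| <= r -> 0 <= r <= 1 / 18 ->
  expR (2 * u + 2 * u ^+ 2 - r ^+ 2) <= 1 + 2 * u + (4 * u ^+ 2 - r ^+ 2) + 300 * r ^+ 3.
Proof.
move=> ru /andP[r0 r1].
have u2 : u ^+ 2 <= r ^+ 2.
  by rewrite -[u ^+ 2]ger0_norm ?sqr_ge0 // normrX lerXn2r ?nnegrE.
have r2 : 0 <= r ^+ 2 by exact: sqr_ge0.
have r3 : 0 <= r ^+ 3 by exact: exprn_ge0.
have r32 : r ^+ 3 <= r ^+ 2 / 18 by rewrite [leLHS]exprSr mulrC; nra.
have r21 : r ^+ 2 <= r / 18 by rewrite expr2; nra.
set m := 2 * u ^+ 2 - r ^+ 2.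
have m1 : `|m| <= r ^+ 2.
  by rewrite ler_norml /m; have := sqr_ge0 u; move=> h; apply/andP; split; lra.
set A := 2 * u + m.
have -> : 2 * u + 2 * u ^+ 2 - r ^+ 2 = A by rewrite /A /m; ring.
have bu : `|2 * u| <= 2 * r by rewrite normrM ger0_norm //; lra.
have A1 : `|A| <= 3 * r by apply: le_trans (ler_normD _ _) _; lra.
have A2 : `|A| <= 1 by lra.
have := expR_taylor2 A2; rewrite ler_norml => /andP[_ h].
have A3 : `|A| ^+ 3 <= 27 * r ^+ 3.
  have : `|A| ^+ 3 <= (3 * r) ^+ 3 by rewrite lerXn2r ?nnegrE ?mulr_ge0.
  by rewrite exprMn; lra.
have A4 : A ^+ 2 <= 4 * u ^+ 2 + 5 * r ^+ 3.
  have -> : A ^+ 2 = 4 * u ^+ 2 + 2 * ((2 * u) * m) + m ^+ 2 by rewrite /A; ring.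
  have h1 : `|(2 * u) * m| <= 2 * r ^+ 3.
    rewrite normrM; have := ler_pM (normr_ge0 _) (normr_ge0 _) bu m1.
    by rewrite (_ : 2 * r * (r ^+ 2) = 2 * r ^+ 3) // [r ^+ 3]exprS; ring.
  have h2 : m ^+ 2 <= r ^+ 3.
    rewrite -[m ^+ 2]ger0_norm ?sqr_ge0 // normrX.
    have := ler_pM (normr_ge0 _) (normr_ge0 _) m1 m1; rewrite -expr2 => /le_trans; apply.
    by rewrite [r ^+ 3]exprS; nra.
  move: h1; rewrite ler_norml => /andP[_ h1]; lra.
have AE : A = 2 * u + (2 * u ^+ 2 - r ^+ 2) by [].
move: h A3 A4; rewrite AE; lra.
Qed.

End RealEstimates.


(** * Poisson kernels and point evaluation on the circle, by root-of-unity averages *)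

Section OneVariable.
Variable R : realType.
Local Notation C := (Cplx R).
Implicit Types (a z w y : C) (Q H : {poly C}) (p : R).

Definition proot N w := [/\ cmod w = 1, w ^+ N = 1 & forall j, (0 < j < N)%N -> w ^+ j != 1].

Definition cj (z : C) : C := conjc z.

Lemma cjM z w : cj (z * w) = cj z * cj w.
Proof. exact: (rmorphM (@conjc R)). Qed.

Lemma cjX z n : cj (z ^+ n) = cj z ^+ n.
Proof. exact: (rmorphXn (@conjc R)). Qed.

Lemma cjK z : cj (cj z) = z.
Proof. exact: conjcK. Qed.

Lemma cj0 : cj 0 = 0.
Proof. exact: (rmorph0 (@conjc R)). Qed.

Lemma cj_sum (I : Type) (s : seq I) (P : pred I) (F : I -> C) :
  cj (\sum_(i <- s | P i) F i) = \sum_(i <- s | P i) cj (F i).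
Proof. exact: (rmorph_sum (@conjc R)). Qed.

Lemma cmod_cj z : cmod (cj z) = cmod z.
Proof. by case: z => a b; rewrite !cmodE /= sqrrN. Qed.

Lemma conj_mul_self a : cj a * a = (cmod a ^+ 2)%:C.
Proof.
rewrite cmod_sqr; case: a => u v; apply/eqP; rewrite eq_complex /=.
by apply/andP; split; apply/eqP; ring.
Qed.

Lemma mul_cj z : cmod z = 1 -> z * cj z = 1.
Proof. by move=> h; rewrite mulrC conj_mul_self h expr1n. Qed.

Lemma sum_proot_conj N w m e : (0 < N)%N -> proot N w -> (m < N)%N -> (e < N)%N ->
  \sum_(k < N) (w ^+ k) ^+ m * (cj (w ^+ k)) ^+ e = if m == e then N%:R else 0.
Proof.
move=> N0 [w1 wN wj] mN eN.
have wk k : (w ^+ k) * cj (w ^+ k) = 1 by apply: mul_cj; rewrite cmodX w1 expr1n.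
have pos d : (0 < d < N)%N -> \sum_(k < N) (w ^+ k) ^+ d = 0.
  by move=> dN; rewrite sum_root_of_unity // ifN // gtnNdvd //; case/andP: dN.
have [->|me] := eqVneq m e.
  rewrite (eq_bigr (fun=> 1)); first by rewrite sumr_const card_ord.
  by move=> k _; rewrite -exprMn wk expr1n.
have [em|me'] := leqP e m.
  rewrite (eq_bigr (fun k : 'I_N => (w ^+ k) ^+ (m - e))); first by apply: pos; lia.
  by move=> k _; rewrite -{1}(subnK em) exprD -mulrA -exprMn wk expr1n mulr1.
rewrite (eq_bigr (fun k : 'I_N => cj ((w ^+ k) ^+ (e - m)))); last first.
  move=> k _; rewrite -{1}(subnK (ltnW me')) [X in _ * X]exprD mulrCA -exprMn wk expr1n mulr1.
  by rewrite !cjX.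
by rewrite -cj_sum pos ?cj0 //; lia.
Qed.

(** Discrete Fourier inversion, exact because [N] exceeds the degree. The base point [z] is
    arbitrary because it will be a coordinate of a point of the polytorus. *)
Lemma coef_avg N w H z e : (0 < N)%N -> proot N w -> cmod z = 1 ->
  (size H <= N)%N -> (e < N)%N ->
  \sum_(k < N) H.[w ^+ k * z] * cj (w ^+ k * z) ^+ e = N%:R * H`_e.
Proof.
move=> N0 hw z1 hH eN.
under eq_bigr do rewrite horner_coef mulr_suml.
rewrite exchange_big /=.
have E (i : 'I_(size H)) : \sum_(k < N) H`_i * (w ^+ k * z) ^+ i * cj (w ^+ k * z) ^+ e =
    if (i : nat) == e then N%:R * H`_e else 0.
  transitivity (H`_i * (z ^+ i * cj z ^+ e) * \sum_(k < N) (w ^+ k) ^+ i * (cj (w ^+ k)) ^+ e).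
    rewrite mulr_sumr; apply: eq_bigr => k _; rewrite cjM !exprMn; ring.
  rewrite sum_proot_conj //; last exact: leq_trans (ltn_ord i) hH.
  case: eqP => [->|_]; last by rewrite mulr0.
  by rewrite -exprMn (mul_cj z1) expr1n mulr1 mulrC.
under eq_bigr do rewrite E.
have [he|he] := ltnP e (size H).
  rewrite (bigD1 (Ordinal he)) //= eqxx big1 ?addr0 // => i ie.
  by rewrite ifN.
rewrite nth_default // mulr0 big1 // => i _; case: eqP => // ie.
Qed.

(** The Poisson kernel 1 + 2 Re (y + y^2 + ...) truncated at degree [D]. As a trigonometric
    polynomial it keeps averages over roots of unity exact. *)
Definition poissonk D y : R := 1 + \sum_(l < D) 2 * complex.Re (y ^+ l.+1).

Lemma poissonkE D y : (poissonk D y)%:C = 1 + \sum_(l < D) (y ^+ l.+1 + cj (y ^+ l.+1)) :> C.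
Proof.
rewrite /poissonk rmorphD rmorph1 rmorph_sum; congr (_ + _); apply: eq_bigr => l _.
move: (y ^+ l.+1) => x; rewrite mulrC -[RHS]/(x + cj x).
by case: x => u v; apply/eqP; rewrite eq_complex /=; apply/andP; split; apply/eqP; ring.
Qed.

(** The conjugate half of the kernel reproduces the coefficients of [H]; the analytic half averages
    to 0, since [H] times ['X^(l.+1)] has no constant term. The condition [D.*2.+1 <= N] excludes
    aliasing. *)
Lemma poisson_avg N w H a z D : (0 < N)%N -> proot N w -> cmod z = 1 ->
  (size H <= D.+1)%N -> (D.*2.+1 <= N)%N ->
  \sum_(k < N) H.[w ^+ k * z] * (poissonk D (cj a * (w ^+ k * z)))%:C = N%:R * H.[a].
Proof.
move=> N0 hw z1 hH hN.
pose zz k := w ^+ k * z.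
have E (k : 'I_N) : H.[w ^+ k * z] * (poissonk D (cj a * (w ^+ k * z)))%:C =
   H.[w ^+ k * z] * cj (w ^+ k * z) ^+ 0 +
   (\sum_(l < D) (H * (cj a ^+ l.+1 *: 'X^(l.+1))).[w ^+ k * z] * cj (w ^+ k * z) ^+ 0 +
   \sum_(l < D) a ^+ l.+1 * (H.[w ^+ k * z] * cj (w ^+ k * z) ^+ l.+1)).
  rewrite poissonkE expr0 mulrDr !mulr1; congr (_ + _).
  rewrite -big_split /= mulr_sumr; apply: eq_bigr => l _.
  rewrite mulrDr hornerM hornerZ hornerXn mulr1 exprMn; congr (_ + _).
  by rewrite (cjM (cj a ^+ l.+1)) (cjX (cj a)) cjK (cjX (w ^+ k * z)) mulrCA.
under eq_bigr do rewrite E.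
rewrite big_split /= coef_avg //; last by lia.
rewrite big_split /= exchange_big /= big1 ?add0r => [|l _]; last first.
  rewrite coef_avg //.
    by rewrite -scalerAr coefZ coefMXn /= mulr0 mulr0.
  apply: leq_trans (size_polyMleq _ _) _.
  have := size_scale_leq (cj a ^+ l.+1) ('X^(l.+1) : {poly C}); rewrite size_polyXn.
  move: hH hN (ltn_ord l); rewrite -addnn.
  move: (size (cj a ^+ l.+1 *: 'X^(l.+1))) => y; move: (size H) => x.
  by move: (nat_of_ord l) => i; lia.
rewrite exchange_big /=.
rewrite (horner_coef_wide a hH) big_ord_recl /= expr0 mulr1 mulrDr; congr (_ + _).
rewrite mulr_sumr; apply: eq_bigr => l _; rewrite -mulr_sumr coef_avg //; last first.
- by have := ltn_ord l; lia.
- by apply: leq_trans hH _; lia.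
by rewrite /bump /= add1n; ring.
Qed.

Lemma geometric_le (r : R) n : 0 <= r < 1 -> \sum_(i < n) r ^+ i <= (1 - r)^-1.
Proof.
move=> /andP[r0 r1]; have h : 0 < 1 - r by rewrite subr_gt0.
rewrite -[leRHS]mul1r ler_pdivlMr // mulrC.
have -> : (1 - r) * (\sum_(i < n) r ^+ i) = 1 - r ^+ n by rewrite -[RHS]opprB subrX1; ring.
by rewrite gerBl exprn_ge0.
Qed.

Lemma Re_sqr y : complex.Re (y ^+ 2) = 2 * complex.Re y ^+ 2 - cmod y ^+ 2.
Proof. by rewrite cmod_sqr expr2 ReM; ring. Qed.

(** The truncated kernel stays nonnegative because [r] is small; its values can then serve as
    weights in Jensen's inequality. *)
Lemma poissonk_bounds D y r : cmod y = r -> r <= 1 / 18 -> (2 <= D)%N ->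
  0 <= poissonk D y <= 1 + 2 * complex.Re y + 2 * (2 * complex.Re y ^+ 2 - r ^+ 2) + 4 * r ^+ 3.
Proof.
move=> yr r1 D2; have r0 : 0 <= r by rewrite -yr cmod_ge0.
have r01 : 0 <= r < 1 by rewrite r0 /=; lra.
have inv2 : (1 - r)^-1 <= 2.
  by rewrite -[leRHS]invrK lef_pV2 ?posrE; lra.
have hRe l : `|complex.Re (y ^+ l)| <= r ^+ l by rewrite -yr -cmodX Re_le_cmod.
apply/andP; split.
  rewrite /poissonk -lerBlDl sub0r.
  apply: (@le_trans _ _ (\sum_(l < D) - (2 * r) * r ^+ l)).
    rewrite -mulr_sumr mulNr lerN2.
    have := geometric_le D r01 => h.
    have : 2 * r * (\sum_(i < D) r ^+ i) <= 2 * r * 2 by rewrite ler_wpM2l ?mulr_ge0 //; lra.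
    by lra.
  apply: ler_sum => l _; have := hRe l.+1; rewrite ler_norml exprS => /andP[+ _]; lra.
rewrite /poissonk; case: D D2 => [|[|D]] // _.
rewrite !big_ord_recl /= /bump /= ?addn0 ?add1n expr1 Re_sqr yr.
set S := \sum_(l < D) _.
have : S <= 4 * r ^+ 3.
  apply: (@le_trans _ _ (\sum_(l < D) 2 * r ^+ 3 * r ^+ l)).
    apply: ler_sum => l _; rewrite !add1n -mulrA -exprD ler_wpM2l //.
    apply: le_trans (ler_norm _) _; exact: hRe.
  rewrite -mulr_sumr; have := geometric_le D r01 => h.
  have r3 : 0 <= r ^+ 3 by exact: exprn_ge0.
  have : 2 * r ^+ 3 * (\sum_(i < D) r ^+ i) <= 2 * r ^+ 3 * 2 by rewrite ler_wpM2l ?mulr_ge0 //; lra.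
  by lra.
lra.
Qed.

Definition quad (b : R) y : C := 1 + b%:C * y + (b * (b + 1) / 2)%:C * y ^+ 2.

Lemma cmod_quad_sqr b y r : cmod y = r -> `|b| <= 2 -> r <= 1 / 18 ->
  cmod (quad b y) ^+ 2 <=
    expR (b * (2 * complex.Re y + 2 * complex.Re y ^+ 2 - r ^+ 2) + 6100 * r ^+ 3).
Proof.
move=> yr b2 r1.
have r0 : 0 <= r by rewrite -yr cmod_ge0.
have uv : complex.Re y ^+ 2 + complex.Im y ^+ 2 = r ^+ 2 by rewrite -cmod_sqr yr.
have r01 : 0 <= r <= 1 / 18 by rewrite r0.
apply: le_trans (quad_sqr_le b2 uv r01).
have r4 : r ^+ 4 = (complex.Re y ^+ 2 + complex.Im y ^+ 2) ^+ 2 by rewrite uv -exprM.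
rewrite r4 -uv cmod_sqr /quad.
case: (y) => u v /=; rewrite le_eqVlt; apply/orP; left; apply/eqP.
by field.
Qed.

Lemma powR_cmod_sqr p z : cmod z `^ p = (cmod z ^+ 2) `^ (p / 2).
Proof.
by rewrite -powR_mulrn ?cmod_ge0 // -powRrM mulrCA mulfV ?mulr1.
Qed.

Lemma powR_quad_le p b y r : 1 <= p -> cmod y = r -> `|b| <= 2 -> r <= 1 / 18 ->
  cmod (quad b y) `^ p <=
    expR (b * p / 2 * (2 * complex.Re y + 2 * complex.Re y ^+ 2 - r ^+ 2) + 3050 * p * r ^+ 3).
Proof.
move=> p1 yr b2 r1; rewrite powR_cmod_sqr.
have p2 : 0 <= p / 2 by lra.
apply: (@le_trans _ _ (expR (b * (2 * complex.Re y + 2 * complex.Re y ^+ 2 - r ^+ 2) + 6100 * r ^+ 3) `^ (p / 2))).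
  by apply: ge0_ler_powR; rewrite ?nnegrE ?sqr_ge0 ?expR_ge0 //; exact: cmod_quad_sqr.
by rewrite -expRM ler_expR le_eqVlt; apply/orP; left; apply/eqP; field.
Qed.

Lemma quad_real b (x : R) : quad b x%:C = (1 + b * x + b * (b + 1) / 2 * x ^+ 2)%:C.
Proof. by rewrite /quad !rmorphD rmorph1 !rmorphM. Qed.

(** At the real point |a|^2 the p-th power is (1 - r^2)^2 up to order 3; this is the factor divided
    out in [one_variable_small]. *)
Lemma quad_lower p a r : 1 <= p -> cmod a = r -> r <= 1 / 18 ->
  expR (- (2 * r ^+ 2 + 2 * p * r ^+ 3)) <= cmod (quad (- (2 / p)) (cj a * a)) `^ p.
Proof.
move=> p1 ar r1; have r0 : 0 <= r by rewrite -ar cmod_ge0.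
rewrite conj_mul_self ar quad_real cmod_real.
set b := 2 / p.
have b0 : 0 < b by rewrite divr_gt0 //; lra.
have b2 : b <= 2 by rewrite ler_pdivrMr; nra.
have pb : p * b = 2 by rewrite /b mulrC divfK //; lra.
have r2 : 0 <= r ^+ 2 by exact: sqr_ge0.
have r3 : 0 <= r ^+ 3 by exact: exprn_ge0.
have r21 : r ^+ 2 <= r / 18 by rewrite expr2; nra.
have r42 : 0 <= r ^+ 4 <= r ^+ 2 / 324.
  rewrite exprn_ge0 //= (_ : r ^+ 4 = r ^+ 2 * r ^+ 2); last by rewrite -exprD.
  nra.
have r43 : r ^+ 4 <= r ^+ 3 / 18 by rewrite [leLHS]exprSr mulrC; nra.
set t := - b * r ^+ 2 + - b * (- b + 1) / 2 * (r ^+ 2) ^+ 2.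
have c1 : `|- b * (- b + 1) / 2| <= 1 by rewrite ler_norml; apply/andP; split; nra.
have t1 : `|t| <= 3 * r ^+ 2.
  apply: le_trans (ler_normD _ _) _.
  have h1 : `|- b * r ^+ 2| <= 2 * r ^+ 2 by rewrite normrM normrN !ger0_norm ?ler_wpM2r // ltW.
  have h2 : `|- b * (- b + 1) / 2 * (r ^+ 2) ^+ 2| <= r ^+ 4.
    by rewrite normrM -exprM (@ger0_norm _ (r ^+ 4)) ?ler_piMl //; case/andP: r42.
  by case/andP: r42 => *; lra.
have t2 : `|t| <= 1 / 2 by lra.
have -> : 1 + - b * r ^+ 2 + - b * (- b + 1) / 2 * (r ^+ 2) ^+ 2 = 1 + t by rewrite addrA.
have h := expR_le_1D t2.
rewrite ger0_norm; last by apply: le_trans h; exact: expR_ge0.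
apply: (@le_trans _ _ (expR (t - 2 * t ^+ 2) `^ p)); last first.
  by apply: ge0_ler_powR; rewrite ?nnegrE ?expR_ge0 //; [lra|apply: le_trans h; exact: expR_ge0].
rewrite -expRM ler_expR.
have t3 : t ^+ 2 <= 9 * r ^+ 4.
  rewrite -[t ^+ 2]ger0_norm ?sqr_ge0 // normrX.
  have := ler_pM (normr_ge0 _) (normr_ge0 _) t1 t1; rewrite -expr2 => /le_trans; apply.
  by rewrite (_ : r ^+ 4 = r ^+ 2 * r ^+ 2); [lra|rewrite -exprD].
have t4 : t >= - b * r ^+ 2 - r ^+ 4.
  rewrite /t lerD2l -exprM; case/andP: r42 => r40 _.
  move: c1; rewrite ler_norml => /andP[c1 _]; nra.
have : - b * r ^+ 2 - 19 * r ^+ 4 <= t - 2 * t ^+ 2 by lra.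
move=> h5; have p0 : 0 <= p by lra.
have := ler_wpM2l p0 h5.
have -> : p * (- b * r ^+ 2 - 19 * r ^+ 4) = - 2 * r ^+ 2 - 19 * p * r ^+ 4 by rewrite -pb; ring.
move=> h6; rewrite [leRHS]mulrC; apply: (le_trans _ h6).
have : p * r ^+ 4 <= p * (r ^+ 3 / 18) by rewrite ler_wpM2l.
have : 0 <= p * r ^+ 3 by rewrite mulr_ge0.
by lra.
Qed.

(** Up to order r^3 this is |Q(a)|^p <= (1 - r^2)^{-1} times the mean of |Q|^p. Average Q T against
    the Poisson kernel, with T close to (1 - conj(a) z)^{2/p}: |T|^p cancels the denominator |1 -
    conj(a) z|^2 of the kernel and leaves 1 - r^2, whereas |T(a)|^p is about (1 - r^2)^2. *)
Lemma one_variable_small p Q a r N w z : 1 <= p -> cmod a = r -> r <= 1 / 18 ->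
  ((size Q).+2.*2.+1 <= N)%N -> proot N w -> cmod z = 1 ->
  cmod Q.[a] `^ p <= expR (r ^+ 2 + 5000 * p * r ^+ 3) *
    (N%:R^-1 * \sum_(k < N) cmod Q.[w ^+ k * z] `^ p).
Proof.
move=> p1 ar r1 hN hw z1; have N0 : (0 < N)%N by apply: leq_trans hN.
have NR : 0 < (N%:R : R) by rewrite ltr0n.
have r0 : 0 <= r by rewrite -ar cmod_ge0.
have r01 : 0 <= r <= 1 / 18 by rewrite r0.
pose b : R := - (2 / p).
have p0 : 0 < p by lra.
have b2 : `|b| <= 2.
  by rewrite /b normrN ger0_norm ?ler_pdivrMr ?divr_ge0 //; lra.
pose T : {poly C} := 1 + (b%:C * cj a) *: 'X + ((b * (b + 1) / 2)%:C * cj a ^+ 2) *: 'X^2.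
have TE y : T.[y] = quad b (cj a * y).
  by rewrite /T /quad !hornerE /=; ring.
have sT : (size T <= 3)%N.
  apply: leq_trans (size_polyD _ _) _; rewrite geq_max; apply/andP; split.
    apply: leq_trans (size_polyD _ _) _; rewrite size_poly1 geq_max /=.
    by apply: leq_trans (size_scale_leq _ _) _; rewrite size_polyX.
  by apply: leq_trans (size_scale_leq _ _) _; rewrite size_polyXn.
pose D := (size Q).+2.
have sH : (size (Q * T)%R <= D.+1)%N.
  by apply: leq_trans (size_polyMleq _ _) _; rewrite /D; lia.
pose zz k : C := w ^+ k * z.
have zz1 k : cmod (zz k) = 1 by case: hw => w1 _ _; rewrite cmodM cmodX w1 expr1n z1 mulr1.
pose y k : C := cj a * zz k.
have yr k : cmod (y k) = r by rewrite cmodM cmod_cj ar zz1 mulr1.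
pose W k := poissonk D (y k).
have hW k : 0 <= W k <= 1 + 2 * complex.Re (y k) + 2 * (2 * complex.Re (y k) ^+ 2 - r ^+ 2) + 4 * r ^+ 3.
  exact: poissonk_bounds.
have W0 k : 0 <= W k by case/andP: (hW k).
have sumW : \sum_(k < N) N%:R^-1 * W k = 1.
  rewrite -mulr_sumr; have := @poisson_avg N w 1 a z D N0 hw z1.
  rewrite size_poly1 => /(_ isT hN); rewrite hornerC mulr1.
  under eq_bigr do rewrite hornerC mul1r.
  rewrite -rmorph_sum -(rmorph_nat (@real_complex R)) => /(@complexI R) ->.
  by rewrite mulVf ?gt_eqF.
have E := @poisson_avg N w (Q * T) a z D N0 hw z1 sH hN.
have key : cmod (Q * T).[a] <= \sum_(k < N) N%:R^-1 * W k * cmod (Q * T).[zz k].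
  have -> : (Q * T).[a] = \sum_(k < N) (N%:R^-1 * W k)%:C * (Q * T).[zz k].
    transitivity (N%:R^-1 * (N%:R * (Q * T).[a])).
      by rewrite mulrA mulVf ?mul1r // pnatr_eq0 -lt0n.
    rewrite -E mulr_sumr; apply: eq_bigr => k _.
    by rewrite rmorphM fmorphV rmorph_nat -/(zz k) -/(y k) -/(W k); ring.
  apply: le_trans (cmod_sum _ _ _) _; apply: ler_sum => k _.
  rewrite cmodM cmod_real ger0_norm //.
  by apply: mulr_ge0 => //; rewrite invr_ge0 ltW.
have key2 : cmod (Q * T).[a] `^ p <= \sum_(k < N) N%:R^-1 * W k * cmod (Q * T).[zz k] `^ p.
  apply: (le_trans (ge0_ler_powR (ltW p0) _ _ key)); rewrite ?nnegrE ?cmod_ge0 //.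
    by apply: sumr_ge0 => k _; rewrite !mulr_ge0 ?cmod_ge0 // invr_ge0 ltW.
  apply: powR_jensen => // k; last exact: cmod_ge0.
  by rewrite mulr_ge0 // invr_ge0 ltW.
have bp : b * p / 2 = -1 by rewrite /b; field; lra.
have r3 : 0 <= r ^+ 3 by exact: exprn_ge0.
have key3 : cmod (Q * T).[a] `^ p <= expR (- r ^+ 2 + (3050 * p + 1400) * r ^+ 3) *
    (N%:R^-1 * \sum_(k < N) cmod Q.[zz k] `^ p).
  apply: (le_trans key2); rewrite !mulr_sumr; apply: ler_sum => k _.
  rewrite hornerM cmodM powRM ?cmod_ge0 // TE -/(y k).
  have h1 := powR_quad_le p1 (yr k) b2 r1; rewrite bp in h1.
  have ru : `|complex.Re (y k)| <= r by rewrite -(yr k) Re_le_cmod.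
  have /andP[_ hw1] := hW k; have h2 := poisson_le ru r01 hw1.
  have h3 := ler_pM (W0 k) (powR_ge0 _ _) h2 h1; rewrite -expRD in h3.
  (* The terms 2u + 2u^2 of the kernel and of the factor cancel; -2r^2 and +r^2 leave -r^2. *)
  rewrite (_ : _ + _ = - r ^+ 2 + (3050 * p + 1400) * r ^+ 3) in h3; last by ring.
  have h4 := ler_wpM2r (mulr_ge0 (ltW (_ : 0 < N%:R^-1)) (powR_ge0 (cmod Q.[zz k]) p)) h3.
  have NV : 0 < (N%:R^-1 : R) by rewrite invr_gt0.
  apply: le_trans (h4 NV); rewrite le_eqVlt; apply/orP; left; apply/eqP.
  by rewrite -/b; ring.
have TA := quad_lower p1 ar r1; rewrite -/b in TA.
move: key3; rewrite hornerM cmodM powRM ?cmod_ge0 // TE.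
set A := N%:R^-1 * _; set X := cmod Q.[a] `^ p.
have A0 : 0 <= A by rewrite mulr_ge0 ?invr_ge0 ?ler0n // sumr_ge0 // => k _; exact: powR_ge0.
have X0 : 0 <= X by exact: powR_ge0.
move=> key3; have := le_trans (ler_wpM2l X0 TA) key3.
rewrite expRN -ler_pdivlMr ?invr_gt0 ?expR_gt0 // invrK => /le_trans; apply.
rewrite mulrAC -expRD; rewrite ler_wpM2r // ler_expR.
have : 1 * r ^+ 3 <= p * r ^+ 3 by rewrite ler_wpM2r.
by rewrite mul1r; nra.
Qed.

(** Dropping the [k] lowest coefficients and dividing by z^k amounts to averaging Q against the sum
    of a^i conj(z)^{i+k}, whose modulus is bounded independently of [k]. With [k = 0] this is the
    crude point evaluation used for small primes. *)
Lemma one_variable_shift p Q a (rho : R) k N w z : 1 <= p -> cmod a <= rho -> rho < 1 ->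
  (size Q < N)%N -> proot N w -> cmod z = 1 ->
  cmod (drop_poly k Q).[a] `^ p <= ((1 - rho)^-1) `^ p *
    (N%:R^-1 * \sum_(j < N) cmod Q.[w ^+ j * z] `^ p).
Proof.
move=> p1 ar r1 hN hw z1; have N0 : (0 < N)%N by apply: leq_trans hN.
have NR : 0 < (N%:R : R) by rewrite ltr0n.
have r0 : 0 <= rho by apply: le_trans ar; exact: cmod_ge0.
have p0 : 0 < p by lra.
pose zz j : C := w ^+ j * z.
have zz1 j : cmod (zz j) = 1 by case: hw => w1 _ _; rewrite cmodM cmodX w1 expr1n z1 mulr1.
have i0 : 0 <= (1 - rho)^-1 by rewrite invr_ge0; lra.
have E : (drop_poly k Q).[a] = \sum_(j < N) (N%:R^-1 : C) *
    (Q.[zz j] * \sum_(i < size Q - k) a ^+ i * (cj (zz j)) ^+ (i + k)).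
  rewrite -mulr_sumr; under eq_bigr do rewrite mulr_sumr.
  rewrite exchange_big /=.
  have sd : (size (drop_poly k Q) <= size Q - k)%N by rewrite size_drop_poly.
  rewrite (horner_coef_wide a sd) mulr_sumr; apply: eq_bigr => i _.
  transitivity (N%:R^-1 * (a ^+ i * \sum_(j < N) Q.[zz j] * (cj (zz j)) ^+ (i + k))).
    rewrite coef_avg ?(ltnW hN) //; last by have := ltn_ord i; lia.
    have NC : (N%:R^-1 : C) * N%:R = 1 by rewrite mulVf // pnatr_eq0 -lt0n.
    rewrite coef_drop_poly (_ : N%:R^-1 * (a ^+ i * (N%:R * Q`_(i + k))) =
      (N%:R^-1 * N%:R) * (Q`_(i + k) * a ^+ i)); first by rewrite NC mul1r.
    by move: (N%:R^-1 : C) (N%:R : C) => u v; ring.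
  by congr (_ * _); rewrite mulr_sumr; apply: eq_bigr => j _; rewrite mulrCA.
have key : cmod (drop_poly k Q).[a] <= \sum_(j < N) N%:R^-1 * (cmod Q.[zz j] * (1 - rho)^-1).
  rewrite E; apply: le_trans (cmod_sum _ _ _) _; apply: ler_sum => j _.
  rewrite !cmodM cmodV cmod_nat ler_wpM2l ?invr_ge0 ?(ltW NR) // ler_wpM2l ?cmod_ge0 //.
  apply: le_trans (cmod_sum _ _ _) _.
  have r01 : 0 <= rho < 1 by rewrite r0.
  apply: le_trans (geometric_le (size Q - k) r01); apply: ler_sum => i _.
  rewrite cmodM cmodX cmodX cmod_cj zz1 expr1n mulr1.
  by rewrite lerXn2r ?nnegrE ?cmod_ge0.
apply: (le_trans (ge0_ler_powR (ltW p0) _ _ key)); rewrite ?nnegrE ?cmod_ge0 //.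
  by apply: sumr_ge0 => j _; rewrite !mulr_ge0 ?cmod_ge0 ?invr_ge0 ?ler0n //; lra.
apply: le_trans (powR_jensen p1 _ _ _) _.
- by move=> j; rewrite invr_ge0 ltW.
- by move=> j; rewrite mulr_ge0 ?cmod_ge0.
- by rewrite sumr_const card_ord -[LHS]mulr_natr mulVf ?gt_eqF.
rewrite mulrA mulr_sumr; apply: ler_sum => j _.
rewrite powRM ?cmod_ge0 // le_eqVlt; apply/orP; left; apply/eqP; ring.
Qed.

(** The majorant of |quad|^p is, up to a constant factor, a quadratic polynomial in Re y, so its
    mean is exact once [2 < N]: Re y averages to 0 and 4 (Re y)^2 - r^2 to r^2. *)
Lemma quad_average p a r N w z : 1 <= p -> cmod a = r -> r <= 1 / 18 ->
  (2 < N)%N -> proot N w -> cmod z = 1 ->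
  N%:R^-1 * \sum_(k < N) cmod (quad (2 / p) (cj a * (w ^+ k * z))) `^ p <=
    expR (r ^+ 2 + 5000 * p * r ^+ 3).
Proof.
move=> p1 ar r1 hN hw z1; have N0 : (0 < N)%N by apply: leq_trans hN.
have NR : 0 < (N%:R : R) by rewrite ltr0n.
have r0 : 0 <= r by rewrite -ar cmod_ge0.
have r01 : 0 <= r <= 1 / 18 by rewrite r0.
have r3 : 0 <= r ^+ 3 by exact: exprn_ge0.
pose b : R := 2 / p.
have p0 : 0 < p by lra.
have b2 : `|b| <= 2.
  by rewrite /b ger0_norm ?ler_pdivrMr ?divr_ge0 //; lra.
have bp : b * p / 2 = 1 by rewrite /b; field; lra.
pose y k : C := cj a * (w ^+ k * z).
have yr k : cmod (y k) = r.
  by case: hw => w1 _ _; rewrite !cmodM cmod_cj cmodX w1 expr1n z1 ar !mulr1.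
have sy j : (0 < j < N)%N -> \sum_(k < N) y k ^+ j = 0.
  move=> jN; have := @sum_proot_conj N w j 0 N0 hw; case/andP: (jN) => j0 jN'.
  move=> /(_ jN' N0); rewrite gtn_eqF // => S0.
  transitivity ((cj a * z) ^+ j * \sum_(k < N) (w ^+ k) ^+ j * (cj (w ^+ k)) ^+ 0); last by rewrite S0 mulr0.
  by rewrite mulr_sumr; apply: eq_bigr => k _; rewrite /y !exprMn expr0 mulr1; ring.
have s1 : \sum_(k < N) complex.Re (y k) = 0.
  rewrite -Re_sum; transitivity (complex.Re (\sum_(k < N) y k ^+ 1)).
    by under [in RHS]eq_bigr do rewrite expr1.
  by rewrite sy //; lia.
have s2 : \sum_(k < N) (4 * complex.Re (y k) ^+ 2 - r ^+ 2) = N%:R * r ^+ 2.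
  have h : \sum_(k < N) complex.Re (y k ^+ 2) = 0 by rewrite -Re_sum sy //; lia.
  transitivity (\sum_(k < N) (2 * complex.Re (y k ^+ 2) + r ^+ 2)).
    by apply: eq_bigr => k _; rewrite Re_sqr yr; ring.
  by rewrite big_split /= -mulr_sumr h mulr0 add0r sumr_const card_ord mulr_natl.
have key k : cmod (quad b (y k)) `^ p <= (1 + 2 * complex.Re (y k) + (4 * complex.Re (y k) ^+ 2 - r ^+ 2) + 300 * r ^+ 3) * expR (3050 * p * r ^+ 3).
  apply: le_trans (powR_quad_le p1 (yr k) b2 r1) _; rewrite bp mul1r expRD ler_wpM2r ?expR_ge0 //.
  by apply: expR_quad_upper => //; rewrite -(yr k) Re_le_cmod.
rewrite -/b.
apply: (@le_trans _ _ (N%:R^-1 * \sum_(k < N) ((1 + 2 * complex.Re (y k) + (4 * complex.Re (y k) ^+ 2 - r ^+ 2) + 300 * r ^+ 3) * expR (3050 * p * r ^+ 3)))).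
  by rewrite ler_wpM2l ?invr_ge0 ?ler0n //; apply: ler_sum => k _; exact: key.
rewrite -mulr_suml 3!big_split /= -mulr_sumr s1 s2 !sumr_const card_ord mulr0 addr0.
have -> : N%:R^-1 * ((1 *+ N + N%:R * r ^+ 2 + (300 * r ^+ 3) *+ N) * expR (3050 * p * r ^+ 3)) =
  (1 + (r ^+ 2 + 300 * r ^+ 3)) * expR (3050 * p * r ^+ 3).
  have G (n x c e : R) : n != 0 -> n^-1 * ((n + n * x + n * c) * e) = (1 + (x + c)) * e.
    by move=> n0; field.
  by rewrite -(mulr_natl (300 * r ^+ 3) N) G // gt_eqF.
apply: (@le_trans _ _ (expR (r ^+ 2 + 300 * r ^+ 3) * expR (3050 * p * r ^+ 3))).
  by rewrite ler_wpM2r ?expR_ge0 // expR_ge1Dx.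
rewrite -expRD ler_expR.
have : 1 * r ^+ 3 <= p * r ^+ 3 by rewrite ler_wpM2r.
by rewrite mul1r; nra.
Qed.

End OneVariable.


(** * Point evaluation and the polytorus *)

Section Polytorus.
Variable R : realType.
Local Notation C := (Cplx R).
Local Notation T := (polytorus R).
Local Notation TT := {ptws nat -> circle R}.
Implicit Types (z w : T).

Definition tcoord (z : T) j : C := set_val (z j).

Lemma cmod_tcoord z j : cmod (tcoord z j) = 1.
Proof.
rewrite /tcoord; case: (z j) => x hx; rewrite set_valE /=.
by move: hx; rewrite inE /= normE => /(@complexI R).
Qed.

Lemma circle_of (x : C) : cmod x = 1 -> exists c : circle R, set_val c = x.
Proof.
move=> x1; have hx : x \in [set z : C | `|z| = 1] by rewrite inE /= normE x1.
by exists (SigSub hx).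
Qed.

Definition trot w z : T := fun j => circleM (w j) (z j).

Lemma tcoord_trot w z j : tcoord (trot w z) j = tcoord w j * tcoord z j.
Proof. by []. Qed.

(** Continuity for the product topology. Neighbourhoods live on [TT]; [T] is the same set with its
    Borel sigma-algebra. *)
Definition tcvg (F : T -> C) := forall z (e : R), 0 < e ->
  nbhs (z : TT) [set y : TT | cmod (F z - F y) < e].

Lemma tcvg_cst (c : C) : tcvg (fun=> c).
Proof.
move=> z e e0; apply: filterS (@filterT _ (nbhs (z : TT)) _) => y _ /=.
by rewrite subrr cmod0.
Qed.

Lemma tcvgD F G : tcvg F -> tcvg G -> tcvg (fun z => F z + G z).
Proof.
move=> hF hG z e e0; have e2 : 0 < e / 2 by rewrite divr_gt0.
apply: filterS (@filterI _ (nbhs (z : TT)) _ _ _ (hF z _ e2) (hG z _ e2)) => y [h1 h2] /=.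
rewrite (_ : F z + G z - (F y + G y) = (F z - F y) + (G z - G y)); last by ring.
by apply: le_lt_trans (ler_cmodD _ _) _; rewrite [e]splitr; exact: ltrD.
Qed.

Lemma tcvgM F G : tcvg F -> tcvg G -> tcvg (fun z => F z * G z).
Proof.
move=> hF hG z e e0.
pose k := cmod (F z) + cmod (G z) + 1.
have k0 : 0 < k by rewrite ltr_wpDl // addr_ge0 ?cmod_ge0.
pose d := Num.min 1 (e / k / 2).
have d0 : 0 < d by rewrite lt_min ltr01 !divr_gt0.
apply: filterS (@filterI _ (nbhs (z : TT)) _ _ _ (hF z _ d0) (hG z _ d0)) => y [].
rewrite /= !lt_min => /andP[_ h1] /andP[h2 h3].
rewrite (_ : F z * G z - F y * G y = F z * (G z - G y) + (G z - (G z - G y)) * (F z - F y)); last by ring.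
apply: le_lt_trans (ler_cmodD _ _) _; rewrite !cmodM.
have hG1 : cmod (G z - (G z - G y)) <= cmod (G z) + 1.
  by apply: le_trans (ler_cmodB _ _) _; rewrite lerD2l ltW.
have a1 : cmod (F z) * cmod (G z - G y) <= cmod (F z) * (e / k / 2).
  by rewrite ler_wpM2l ?cmod_ge0 // ltW.
have a2 : cmod (G z - (G z - G y)) * cmod (F z - F y) <= (cmod (G z) + 1) * (e / k / 2).
  by apply: ler_pM; rewrite ?cmod_ge0 // ltW.
apply: le_lt_trans (lerD a1 a2) _; rewrite -mulrDl addrA -/k.
by rewrite mulrA mulrCA mulfV ?gt_eqF // mulr1 ltr_pdivrMr // ltr_pMr // ltr1n.
Qed.

Lemma tcvgX F n : tcvg F -> tcvg (fun z => F z ^+ n).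
Proof.
move=> hF; elim: n => [|n IH].
  rewrite (_ : (fun z => _) = fun=> 1); last by apply/funext => z; rewrite expr0.
  exact: tcvg_cst.
rewrite (_ : (fun z => _) = fun z => F z * F z ^+ n); last by apply/funext => z; rewrite exprS.
exact: tcvgM.
Qed.

Lemma tcvg_sum (I : Type) (s : seq I) (P : pred I) (F : I -> T -> C) :
  (forall i, tcvg (F i)) -> tcvg (fun z => \sum_(i <- s | P i) F i z).
Proof.
move=> hF; elim: s => [|i s IH].
  rewrite (_ : (fun z => _) = fun=> 0); last by apply/funext => z; rewrite big_nil.
  exact: tcvg_cst.
have h := tcvgD (hF i) IH.
case Pi : (P i).
  by rewrite (_ : (fun z => _) = fun z => F i z + \sum_(j <- s | P j) F j z) //; apply/funext => z; rewrite big_cons Pi.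
by rewrite (_ : (fun z => _) = fun z => \sum_(j <- s | P j) F j z) //; apply/funext => z; rewrite big_cons Pi.
Qed.

Lemma tcvg_prod (I : Type) (s : seq I) (P : pred I) (F : I -> T -> C) :
  (forall i, tcvg (F i)) -> tcvg (fun z => \prod_(i <- s | P i) F i z).
Proof.
move=> hF; elim: s => [|i s IH].
  rewrite (_ : (fun z => _) = fun=> 1); last by apply/funext => z; rewrite big_nil.
  exact: tcvg_cst.
have h := tcvgM (hF i) IH.
case Pi : (P i).
  by rewrite (_ : (fun z => _) = fun z => F i z * \prod_(j <- s | P j) F j z) //; apply/funext => z; rewrite big_cons Pi.
by rewrite (_ : (fun z => _) = fun z => \prod_(j <- s | P j) F j z) //; apply/funext => z; rewrite big_cons Pi.
Qed.

Lemma nbhs_circle (x : circle R) (e : R) : 0 < e ->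
  nbhs x [set y : circle R | cmod (set_val x - set_val y : C) < e].
Proof.
move=> e0; have h := @initial_continuous (circle R) C set_val x.
by move/cvg_cmodP: h => /(_ _ e0).
Qed.

Lemma tcvg_tcoord j : tcvg (fun z => tcoord z j).
Proof.
move=> z e e0.
exact: (@proj_continuous nat (fun=> circle R) j z _ (nbhs_circle (z j) e0)).
Qed.

(** Continuity of a rotation, reduced to coordinates: the product topology is the supremum of the
    initial topologies of the projections, and the circle carries the initial topology of
    [set_val]. *)
Lemma nbhs_trot (w z : TT) (A : set TT) :
  nbhs ((fun j => circleM (w j) (z j)) : TT) A ->
  nbhs z ((fun y : TT => (fun j => circleM (w j) (y j)) : TT) @^-1` A).
Proof.
pose r (y : TT) : TT := fun j => circleM (w j) (y j).
have FF : Filter (r @ z) by exact: fmap_filter (nbhs_filter z).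
have H := @cvg_sup (nat -> circle R) nat (fun i => Topological.class (initial_topology (fun f : (nat -> circle R) => f i))) (r @ z) (r z) FF.
apply: (H.2 _ A) => {A} i A.
have hi := @continuous_comp_initial (nat -> circle R) TT (circle R) (fun f : nat -> circle R => f i) r.
apply: (hi _ z A) => {A} y A.
have hs := @continuous_comp_initial (circle R) TT C set_val (fun y : TT => r y i).
apply: (hs _ y A) => {A} x.
have hh := @cvg_cmodP R TT (nbhs x) (fun u : TT => (set_val (r u i) : C)) (set_val (r x i)) (nbhs_filter x).
apply: hh.2 => e e0.
exact: (tcvgM (tcvg_cst (tcoord w i)) (tcvg_tcoord i) x e0).
Qed.

Lemma topen_measurable (A : set T) : open (A : set TT) -> measurable A.
Proof. by move=> oA; exact: sub_sigma_algebra. Qed.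

Lemma measurable_trot w : measurable_fun [set: T] (trot w).
Proof.
apply: (@measurability _ _ T T setT (trot w) (@open TT)) => //.
move=> _ [A oA <-]; rewrite setTI; apply: topen_measurable.
rewrite openE => z /= Az; apply: nbhs_trot; exact: open_nbhs_nbhs.
Qed.

Lemma measurable_cmod (F : T -> C) : tcvg F -> measurable_fun [set: T] (fun z => cmod (F z)).
Proof.
move=> hF; apply: (measurability _ (RGenOpens.measurableE R)).
move=> _ [_ [a [b ->] <-]]; rewrite setTI; apply: topen_measurable.
rewrite openE => z /=; rewrite in_itv /= => /andP[az zb].
have e0 : 0 < Num.min (cmod (F z) - a) (b - cmod (F z)) by rewrite lt_min !subr_gt0 az zb.
apply: filterS (hF z _ e0) => y /=; rewrite in_itv /= lt_min => /andP[h1 h2].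
have := ler_cmod_dist (F z) (F y); rewrite ler_norml => /andP[h3 h4].
by apply/andP; split; lra.
Qed.

Lemma measurable_cmod_powR (p : R) (F : T -> C) : tcvg F ->
  measurable_fun [set: T] (fun z => (cmod (F z) `^ p)%:E).
Proof.
move=> hF; apply/measurable_EFinP.
exact: (measurableT_comp (measurable_powR p) (measurable_cmod hF)).
Qed.

Definition coord_rot i (c : circle R) : T := fun j => if j == i then c else circle1 R.

Lemma tcoord_coord_rot i c z j :
  tcoord (trot (coord_rot i c) z) j = if j == i then set_val c * tcoord z j else tcoord z j.
Proof.
rewrite tcoord_trot {1}/tcoord /coord_rot; case: eqP => // _.
by rewrite /circle1 set_valE mul1r.
Qed.

Section Haar.
Variable m : probability T R.
Hypothesis hm : is_haar m.
Local Open Scope ereal_scope.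

Lemma haar_trot w (F : T -> \bar R) : measurable_fun [set: T] F -> (forall z, 0 <= F z) ->
  \int[m]_z F (trot w z) = \int[m]_z F z.
Proof.
move=> mF F0; have mr := measurable_trot w.
have := @ge0_integral_pushforward _ _ _ _ R (trot w) mr m setT F measurableT mF (fun z _ => F0 z).
rewrite preimage_setT => <-; apply: eq_measure_integral => A mA _.
by rewrite /pushforward; exact: hm.
Qed.

(* Haar invariance replaces the integral over one coordinate by an average over
   the translates by roots of unity. *)
Lemma haar_average i N (w : C) (F : T -> R) : (0 < N)%N -> cmod w = 1%R ->
  measurable_fun [set: T] F -> (forall z, (0 <= F z)%R) ->
  exists c : nat -> circle R, (forall k, set_val (c k) = (w ^+ k)%R) /\
  \int[m]_z (F z)%:E =
  \int[m]_z ((N%:R^-1 * \sum_(k < N) F (trot (coord_rot i (c k)) z))%R)%:E.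
Proof.
move=> N0 w1 mF F0.
have hc k : exists c : circle R, set_val c = (w ^+ k)%R.
  by apply: circle_of; rewrite cmodX w1 expr1n.
have [c cE] := choice hc; exists c; split=> //.
have mk k : measurable_fun [set: T] (fun z => (F (trot (coord_rot i (c k)) z))%:E).
  apply/measurable_EFinP; exact: measurableT_comp mF (measurable_trot _).
have NV : (0 <= N%:R^-1 :> R)%R by rewrite invr_ge0.
under [RHS]eq_integral do rewrite EFinM.
rewrite ge0_integralZl_EFin //; last 2 first.
- by move=> z _; rewrite lee_fin sumr_ge0.
- rewrite (_ : (fun z => _) = fun z => \sum_(k < N) (F (trot (coord_rot i (c k)) z))%:E); last first.
    by apply/funext => z; rewrite sumEFin.
  exact: emeasurable_sum.
under [in RHS]eq_integral do rewrite -sumEFin.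
rewrite ge0_integral_sum //; last by move=> k z _; rewrite lee_fin.
rewrite (eq_bigr (fun=> \int[m]_z (F z)%:E)); last first.
  move=> k _; apply: (@haar_trot (coord_rot i (c k)) (fun z => (F z)%:E)) => //; exact/measurable_EFinP.
have I0 : 0 <= \int[m]_z (F z)%:E by apply: integral_ge0 => z _; rewrite lee_fin.
have S (x : \bar R) n : 0 <= x -> \sum_(k < n) x = n%:R%:E * x.
  move=> x0; elim: n => [|n IH]; first by rewrite big_ord0 mul0e.
  by rewrite big_ord_recr /= IH -natr1 EFinD ge0_muleDl ?mul1e // lee_fin.
by rewrite S // muleA -EFinM mulVf ?mul1e // pnatr_eq0 -lt0n.
Qed.

End Haar.

End Polytorus.


(** * Evaluation at completely multiplicative functions *)

Section CompletelyMultiplicative.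
Variable R : realType.
Local Notation C := (Cplx R).
Implicit Types (x y : nat -> C) (P Q : {poly C}) (s : C).

(* The completely multiplicative function with value [x q] at each prime q. *)
Definition chi x n : C := \prod_(q <- primes n) x q ^+ logn q n.

(** Common form of both evaluations: x q = q^{-s} gives [dpoly_eval], coordinates of the torus give
    [bohr_lift], and mixtures lead from one to the other prime by prime. *)
Definition ev P x : C := \sum_(n < size P) P`_n * chi x n.+1.

Lemma chiE x n B : (0 < n)%N -> (n < B)%N -> chi x n = \prod_(q < B | prime q) x q ^+ logn q n.
Proof.
move=> n0 nB.
rewrite -(big_mkord prime (fun q => x q ^+ logn q n)) (bigID (fun q => q \in primes n)) /=.
rewrite [X in _ * X]big1 ?mulr1; last first.
  by move=> q /andP[_ h]; rewrite lognE; move: h; rewrite mem_primes; case: ifP => // ->.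
rewrite -big_filter /chi; apply: perm_big; apply: uniq_perm; rewrite ?primes_uniq ?filter_uniq ?iota_uniq //.
move=> q; rewrite mem_filter mem_index_iota /=.
apply/idP/idP => [h|/andP[/andP[_ ->]] //].
rewrite h; move: (h); rewrite mem_primes => /and3P[-> _ /dvdn_leq] /(_ n0) qn.
by rewrite /= (leq_ltn_trans qn nB).
Qed.

Lemma chi1 x : chi x 1 = 1.
Proof. by rewrite /chi big_nil. Qed.

Lemma chiM x m n : (0 < m)%N -> (0 < n)%N -> chi x (m * n) = chi x m * chi x n.
Proof.
move=> m0 n0; have mn : (0 < m * n)%N by rewrite muln_gt0 m0.
pose B := (m * n).+1.
rewrite (@chiE _ _ B) // (@chiE _ m B) ?(@chiE _ n B) ?ltnS ?leq_pmulr ?leq_pmull //.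
rewrite -big_split; apply: eq_bigr => q pq /=.
by rewrite lognM // exprD.
Qed.

Lemma chi_mul x y n : chi (fun q => x q * y q) n = chi x n * chi y n.
Proof. by rewrite /chi -big_split; apply: eq_bigr => q _; rewrite exprMn. Qed.

Lemma chi_eq x y n : (forall q, prime q -> x q = y q) -> chi x n = chi y n.
Proof.
move=> h; rewrite /chi !big_seq; apply: eq_bigr => q; rewrite mem_primes => /andP[pq _].
by rewrite h.
Qed.

Lemma chi_prime x q : prime q -> chi x q = x q.
Proof. by move=> pq; rewrite /chi primes_prime // big_seq1 logn_prime // eqxx expr1. Qed.

Lemma chi_unique (f : nat -> C) n : f 1%N = 1 ->
  (forall a b, (0 < a)%N -> (0 < b)%N -> f (a * b)%N = f a * f b) ->
  (0 < n)%N -> chi f n = f n.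
Proof.
move=> f1 fM; elim/ltn_ind: n => n IH n0.
have [->|n1] := eqVneq n 1%N; first by rewrite chi1.
have {}n1 : (1 < n)%N by rewrite ltn_neqAle eq_sym n1.
have pp := pdiv_prime n1; have p0 := prime_gt0 pp.
have E : (pdiv n * (n %/ pdiv n) = n)%N by rewrite mulnC divnK // pdiv_dvd.
have q0 : (0 < n %/ pdiv n)%N by rewrite divn_gt0 // pdiv_leq.
rewrite -{1 2}E chiM // fM // chi_prime // IH //.
by apply: ltn_Pdiv => //; exact: prime_gt1.
Qed.

Lemma chi_natpowN s n : chi (fun q => natpowN q s) n.+1 = natpowN n.+1 s.
Proof.
apply: (chi_unique (f := fun q => natpowN q s)) => //; first exact: natpowN1.
by move=> [|a] [|b] // _ _; exact: natpowNM.
Qed.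

Lemma dpoly_eval_ev P s : dpoly_eval P s = ev P (fun q => natpowN q s).
Proof. by apply: eq_bigr => n _; rewrite chi_natpowN. Qed.

Lemma bohr_lift_ev P (z : polytorus R) :
  bohr_lift P z = ev P (fun q => tcoord z (prime_rank q)).
Proof. by []. Qed.

Lemma ev_eq P x y : (forall q, prime q -> x q = y q) -> ev P x = ev P y.
Proof. by move=> h; apply: eq_bigr => n _; rewrite (chi_eq _ h). Qed.

Lemma evE P N x : (size P <= N)%N -> ev P x = \sum_(n < N) P`_n * chi x n.+1.
Proof.
move=> h; rewrite /ev -(subnKC h) big_split_ord /= [X in _ + X]big1 ?addr0 //.
by move=> i _; rewrite nth_default ?mul0r // leq_addr.
Qed.

Lemma ev_shift P (sigma : R) x :
  ev (dpoly_shift P sigma) x = ev P (fun q => natpowN q sigma%:C * x q).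
Proof.
rewrite (evE _ (size_poly _ _)); apply: eq_bigr => n _.
by rewrite coef_poly ltn_ord chi_mul chi_natpowN mulrA.
Qed.

Lemma ev_dmul P Q x : ev (dmul P Q) x = ev P x * ev Q x.
Proof.
rewrite (evE _ (size_poly _ _)) /ev mulr_suml.
under eq_bigr do rewrite dmul_coef /dconv mulr_suml big_mkcond /=.
rewrite exchange_big /=; apply: eq_bigr => d _; rewrite -big_mkcond /=.
have E : \sum_(n < size P * size Q | (d.+1 %| n.+1)%N) P`_d * Q`_(n.+1 %/ d.+1).-1 * chi x n.+1 =
  \sum_(m < (size P * size Q) %/ d.+1) P`_d * Q`_m * chi x (d.+1 * m.+1).
  have := @sum_multiples _ (fun n => P`_d * Q`_(n %/ d.+1).-1 * chi x n) predT d.+1 (size P * size Q) isT.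
  under eq_bigl do rewrite andbT.
  by move=> ->; apply: eq_bigr => m _; rewrite mulKn.
rewrite E -mulrA mulr_sumr.
have h : (size Q <= (size P * size Q) %/ d.+1)%N.
  by rewrite leq_divRL // mulnC leq_mul2r ltn_ord orbT.
rewrite -[RHS](_ : \sum_(m < (size P * size Q) %/ d.+1) P`_d * (chi x d.+1 * (Q`_m * chi x m.+1)) = _).
  by apply: eq_bigr => m _; rewrite chiM //; ring.
rewrite -!mulr_sumr; congr (_ * (_ * _)); rewrite -evE //.
Qed.

(* [2 ^ (- k s)] times the sum of [sharp k P] at s is the part of P carried by the
   multiples of [2 ^ k]. *)
Definition sharp k P : {poly C} := \poly_(n < size P) P`_(2 ^ k * n.+1).-1.

Lemma sharp_coef k P n : (sharp k P)`_n = P`_(2 ^ k * n.+1).-1.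
Proof.
rewrite coef_poly; case: ltnP => // h; rewrite nth_default //.
have : (0 < 2 ^ k)%N by rewrite expn_gt0.
by move: h; move: (2 ^ k)%N (size P) => K N; nia.
Qed.

Definition upd x J (y : C) : nat -> C := fun q => if q == J then y else x q.

(** [P] as a polynomial in the value at the prime [J] alone, the other values being frozen; the
    value 1 at [J] deletes the factor of [J] from [chi]. *)
Definition onev (J : nat) P x : {poly C} := \sum_(n < size P) (P`_n * chi (upd x J 1) n.+1) *: 'X^(logn J n.+1).

Lemma chi_upd x (J : nat) (y : C) n : prime J -> (0 < n)%N ->
  chi (upd x J y) n = chi (upd x J 1) n * y ^+ logn J n.
Proof.
move=> pJ n0.
have -> : chi (upd x J y) n = chi (fun q => upd x J 1 q * upd (fun=> 1) J y q) n.
  by apply: chi_eq => q _; rewrite /upd; case: eqP => _; rewrite ?mul1r ?mulr1.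
rewrite chi_mul; congr (_ * _).
pose B := (n + J).+1.
have nB : (n < B)%N by rewrite ltnS leq_addr.
have JB : (J < B)%N by rewrite ltnS leq_addl.
rewrite (@chiE _ _ B) // (bigD1 (Ordinal JB)) //= big1 ?mulr1 /upd ?eqxx // => q /andP[_ qJ].
by rewrite ifN ?expr1n //; apply: contra qJ => /eqP h; apply/eqP/val_inj.
Qed.

Lemma ev_onev J P x (y : C) : prime J -> ev P (upd x J y) = (onev J P x).[y].
Proof.
move=> pJ; rewrite /onev horner_sum; apply: eq_bigr => n _.
by rewrite hornerZ hornerXn chi_upd // mulrA.
Qed.

Lemma size_onev J P x : (size (onev J P x) <= (size P).+1)%N.
Proof.
apply: (leq_trans (size_sum _ _ _)); apply/bigmax_leqP => n _.
apply: leq_trans (size_scale_leq _ _) _; rewrite size_polyXn ltnS.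
have [pJ|npJ] := boolP (prime J); last by rewrite lognE (negPf npJ).
have : (logn J n.+1 < n.+1)%N by apply: ltn_logl.
by have := ltn_ord n; lia.
Qed.

(** [sharp] acts on the variable of the prime 2 only, so [one_variable_shift] controls it at a cost
    independent of [k]. *)
Lemma ev_sharp k P x (y : C) : ev (sharp k P) (upd x 2 y) = (drop_poly k (onev 2 P x)).[y].
Proof.
have K0 : (0 < 2 ^ k)%N by rewrite expn_gt0.
rewrite /onev linear_sum horner_sum.
pose F n := P`_n.-1 * chi (upd x 2 y) (n %/ 2 ^ k).
transitivity (\sum_(n < size P | (2 ^ k %| n.+1)%N && predT n.+1) F n.+1).
  rewrite (sum_multiples F predT (size P) K0) /F.
  have sz : (size (sharp k P) <= size P %/ 2 ^ k)%N.
    apply/leq_sizeP => i hi; rewrite sharp_coef nth_default //.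
    have h : (size P < (size P %/ 2 ^ k).+1 * 2 ^ k)%N by rewrite -ltn_divLR.
    rewrite -ltnS prednK ?muln_gt0 ?K0 //; apply: leq_trans h _.
    by rewrite mulnC leq_mul2l ltnS hi orbT.
  by rewrite (evE _ sz); apply: eq_bigr => m _; rewrite sharp_coef mulKn.
rewrite big_mkcond /=; apply: eq_bigr => n _; rewrite andbT /F /=.
rewrite linearZ hornerZ /=.
have E : (drop_poly k 'X^(logn 2 n.+1) : {poly C}).[y] = if (2 ^ k %| n.+1)%N then y ^+ (logn 2 n.+1 - k) else 0.
  rewrite pfactor_dvdn //; case: leqP => h.
    rewrite (_ : drop_poly k 'X^(logn 2 n.+1) = 'X^(logn 2 n.+1 - k)) ?hornerXn //.
    apply/polyP => i; rewrite coef_drop_poly !coefXn.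
    by move: (logn 2 n.+1) h => l h; congr (_%:R); congr nat_of_bool; apply/eqP/eqP; lia.
  rewrite drop_poly_eq0 ?horner0 // size_polyXn; exact: h.
rewrite E; case: ifPn => h; last by rewrite mulr0.
have n0 : (0 < n.+1 %/ 2 ^ k)%N by rewrite divn_gt0 // dvdn_leq.
rewrite chi_upd // -mulrA; congr (_ * _).
have El : logn 2 (n.+1 %/ 2 ^ k) = (logn 2 n.+1 - k)%N by rewrite logn_div // pfactorK.
rewrite El; congr (_ * _).
rewrite -[in RHS](divnK h) chiM // [chi _ (2 ^ k)%N](_ : _ = 1) ?mulr1 //.
elim: (k) => [|j IH]; first by rewrite expn0 chi1.
by rewrite expnS chiM ?expn_gt0 // IH mulr1 chi_prime.
Qed.

End CompletelyMultiplicative.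


Section PrimeRank.

Lemma prime_rank_lt q q' : prime q -> (q < q')%N -> (prime_rank q < prime_rank q')%N.
Proof.
move=> pq h; rewrite /prime_rank -(subnKC (ltnW h)) iotaD count_cat -addn1 leq_add2l add0n.
have d0 : (0 < q' - q)%N by rewrite subn_gt0.
by case: (q' - q)%N d0 => // d _; rewrite /= pq.
Qed.

Lemma prime_rank_inj q q' : prime q -> prime q' -> prime_rank q = prime_rank q' -> q = q'.
Proof.
move=> pq pq' h; case: (ltngtP q q') => // l.
  by have := prime_rank_lt pq l; rewrite h ltnn.
by have := prime_rank_lt pq' l; rewrite h ltnn.
Qed.

End PrimeRank.

(** * Point evaluation on the polytorus, one prime at a time *)

Section PointEvaluation.
Variable R : realType.
Local Notation C := (Cplx R).
Local Notation T := (polytorus R).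
Implicit Types (z : T) (P : {poly C}) (a x : nat -> C) (s : C).

(** Interpolates between the Bohr lift ([J = 2]) and the evaluation at [a] ([J] beyond the size of
    the polynomial); each step fixes one more prime. *)
Definition mixc a J z : nat -> C :=
  fun q => if (q < J)%N then a q else tcoord z (prime_rank q).

Lemma tcvg_ev P (x : T -> nat -> C) : (forall q, tcvg (fun z => x z q)) -> tcvg (fun z => ev P (x z)).
Proof.
move=> hx; apply: tcvg_sum => n; apply: tcvgM; first exact: tcvg_cst.
by apply: tcvg_prod => q; apply: tcvgX.
Qed.

Lemma tcvg_mixc a J q : tcvg (fun z => mixc a J z q).
Proof.
rewrite /mixc; case: (q < J)%N; first exact: tcvg_cst.
exact: tcvg_tcoord.
Qed.

Lemma ev_mixcS P a J z : prime J -> ev P (mixc a J.+1 z) = ev P (upd (mixc a J z) J (a J)).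
Proof.
move=> pJ; apply: ev_eq => q _; rewrite /upd /mixc ltnS leq_eqVlt.
by case: eqP => [->|].
Qed.

Lemma ev_mixc_rot P a J z (c : circle R) : prime J ->
  ev P (mixc a J (trot (coord_rot (prime_rank J) c) z)) =
  ev P (upd (mixc a J z) J (set_val c * tcoord z (prime_rank J))).
Proof.
move=> pJ; apply: ev_eq => q pq; rewrite /upd /mixc tcoord_coord_rot.
case: (eqVneq q J) => [->|qJ]; first by rewrite ltnn eqxx.
case: ltnP => // _; rewrite ifN //; apply: contra qJ => /eqP h; apply/eqP.
exact: prime_rank_inj h.
Qed.

Lemma exists_proot N : (0 < N)%N -> exists w : C, proot N w.
Proof. exact: root_of_unity. Qed.

Section Haar.
Variable m : probability T R.
Hypothesis hm : is_haar m.

Definition tint (F : T -> R) : \bar R := (\int[m]_z (F z)%:E)%E.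

Lemma tint_ge0 F : (forall z, 0 <= F z) -> (0 <= tint F)%E.
Proof. by move=> h; apply: integral_ge0 => z _; rewrite lee_fin. Qed.

(** A pointwise bound by averages over rotations of one coordinate becomes, after integration, a
    bound by the integral of [F] itself. *)
Lemma torus_step (F G : T -> R) i N (w : C) (c0 : R) : (0 < N)%N -> cmod w = 1 -> 0 <= c0 ->
  measurable_fun [set: T] F -> measurable_fun [set: T] G ->
  (forall z, 0 <= F z) -> (forall z, 0 <= G z) ->
  (forall c : nat -> circle R, (forall k, set_val (c k) = w ^+ k) -> forall z,
     G z <= c0 * (N%:R^-1 * \sum_(k < N) F (trot (coord_rot i (c k)) z))) ->
  (tint G <= c0%:E * tint F)%E.
Proof.
move=> N0 w1 c00 mF mG F0 G0 h; rewrite /tint.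
have [c [cE ->]] := haar_average hm i N0 w1 mF F0.
have mA : measurable_fun [set: T] (fun z => N%:R^-1 * \sum_(k < N) F (trot (coord_rot i (c k)) z)).
  apply: measurable_funM; first exact: measurable_cst.
  by apply: measurable_sum => k; exact: measurableT_comp mF (measurable_trot _).
have A0 z : 0 <= N%:R^-1 * \sum_(k < N) F (trot (coord_rot i (c k)) z).
  by rewrite mulr_ge0 ?invr_ge0 ?ler0n // sumr_ge0.
rewrite -ge0_integralZl_EFin //; last 2 first.
- by move=> z _; rewrite lee_fin.
- exact/measurable_EFinP.
apply: ge0_le_integral => //.
- by move=> z _; rewrite lee_fin.
- exact/measurable_EFinP.
- by apply/measurable_EFinP; apply: measurable_funM => //; exact: measurable_cst.
- by move=> z _; rewrite -EFinM lee_fin; exact: h.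
Qed.

Variable p : R.
Hypothesis p1 : 1 <= p.

Definition evint P (x : T -> nat -> C) : \bar R := tint (fun z => cmod (ev P (x z)) `^ p).

Let p0 : 0 <= p. Proof. exact: le_trans ler01 p1. Qed.

Lemma measurable_ev P (x : T -> nat -> C) : (forall q, tcvg (fun z => x z q)) ->
  measurable_fun [set: T] (fun z => cmod (ev P (x z)) `^ p).
Proof. by move=> hx; apply/measurable_EFinP; apply: measurable_cmod_powR; exact: tcvg_ev. Qed.

Lemma evint_ge0 P (x : T -> nat -> C) : (0 <= evint P x)%E.
Proof. by apply: tint_ge0 => z; exact: powR_ge0. Qed.

Lemma evint_step P Q a J N (w : C) (c0 : R) : prime J -> (0 < N)%N -> proot N w -> 0 <= c0 ->
  (forall z, cmod (ev Q (mixc a J.+1 z)) `^ p <= c0 *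
     (N%:R^-1 * \sum_(k < N) cmod (onev J P (mixc a J z)).[w ^+ k * tcoord z (prime_rank J)] `^ p)) ->
  (evint Q (mixc a J.+1) <= c0%:E * evint P (mixc a J))%E.
Proof.
move=> pJ N0 hw c00 h; have [w1 _ _] := hw.
apply: (@torus_step (fun z => cmod (ev P (mixc a J z)) `^ p)
  (fun z => cmod (ev Q (mixc a J.+1 z)) `^ p) (prime_rank J) N w c0).
- exact: N0.
- exact: w1.
- exact: c00.
- by apply: measurable_ev => q; exact: tcvg_mixc.
- by apply: measurable_ev => q; exact: tcvg_mixc.
- by move=> z; exact: powR_ge0.
- by move=> z; exact: powR_ge0.
move=> c cE z; under eq_bigr do rewrite ev_mixc_rot // ev_onev // cE.
exact: h.
Qed.

Lemma evint_small P a J (r : R) : prime J -> cmod (a J) = r -> r <= 1 / 18 ->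
  (evint P (mixc a J.+1) <= (expR (r ^+ 2 + 5000 * p * r ^+ 3))%:E * evint P (mixc a J))%E.
Proof.
move=> pJ ar r1; have N0 : (0 < (size P).+3.*2.+1)%N by [].
have [w hw] := exists_proot N0.
apply: (evint_step pJ N0 hw (expR_ge0 _)) => z; rewrite ev_mixcS // ev_onev //.
apply: one_variable_small => //; last exact: cmod_tcoord.
by rewrite ltnS leq_double !ltnS; exact: size_onev.
Qed.

Lemma evint_sharp P a k (rho : R) : cmod (a 2) <= rho -> rho < 1 ->
  (evint (sharp k P) (mixc a 3) <= ((1 - rho)^-1 `^ p)%:E * evint P (mixc a 2))%E.
Proof.
move=> ar r1; have N0 : (0 < (size P).+2)%N by [].
have [w hw] := exists_proot N0.
apply: (@evint_step P (sharp k P) a 2 _ w _ isT N0 hw (powR_ge0 _ _)) => z.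
rewrite ev_mixcS // ev_sharp.
apply: one_variable_shift => //; last exact: cmod_tcoord.
by rewrite ltnS; exact: size_onev.
Qed.

Lemma evint_crude P a J (rho : R) : prime J -> cmod (a J) <= rho -> rho < 1 ->
  (evint P (mixc a J.+1) <= ((1 - rho)^-1 `^ p)%:E * evint P (mixc a J))%E.
Proof.
move=> pJ ar r1; have N0 : (0 < (size P).+2)%N by [].
have [w hw] := exists_proot N0.
apply: (evint_step pJ N0 hw (powR_ge0 _ _)) => z; rewrite ev_mixcS // ev_onev //.
have := @one_variable_shift R p (onev J P (mixc a J z)) (a J) rho 0 _ w (tcoord z (prime_rank J)) p1 ar r1 _ hw (cmod_tcoord _ _).
by rewrite drop_poly0l; apply; rewrite ltnS; exact: size_onev.
Qed.

Lemma evint_nonprime P a J : ~~ prime J -> evint P (mixc a J.+1) = evint P (mixc a J).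
Proof.
move=> npJ; congr tint; apply/funext => z; congr (cmod _ `^ p).
apply: ev_eq => q pq; rewrite /mixc ltnS leq_eqVlt.
by case: eqP => // qJ; move: npJ; rewrite -qJ pq.
Qed.

Lemma evint_bohr P a : evint P (mixc a 2) = tint (fun z => cmod (bohr_lift P z) `^ p).
Proof.
congr tint; apply/funext => z; congr (cmod _ `^ p); rewrite bohr_lift_ev.
by apply: ev_eq => q pq; rewrite /mixc ltnNge prime_gt1.
Qed.

Lemma evint_full P a J : (size P < J)%N -> evint P (mixc a J) = (cmod (ev P a) `^ p)%:E.
Proof.
move=> PJ.
have E z : cmod (ev P (mixc a J z)) `^ p = cmod (ev P a) `^ p.
  congr (cmod _ `^ p); apply: eq_bigr => n _; congr (_ * _).
  rewrite /chi !big_seq; apply: eq_bigr => q; rewrite mem_primes => /and3P[_ _ /dvdn_leq] /(_ isT) qn.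
  by rewrite /mixc (leq_ltn_trans qn) // (leq_ltn_trans (ltn_ord n)).
rewrite /evint /tint; under eq_integral do rewrite E.
by rewrite integral_cst //= probability_setT mule1.
Qed.

Let half : R := 2^-1.

Lemma natr_half_le (q : nat) (sigma : R) : half <= sigma -> (q.+1%:R : R) `^ (- sigma) <= q.+1%:R `^ (- half).
Proof. by move=> h; apply: natr_powR_le; rewrite lerN2. Qed.

(** At Re s = 1/2 the cubic errors of the one-variable estimates are q^{-3/2}, still summable, so
    the constants stay uniform up to that line. *)
Lemma sum_prime_cube_le J : \sum_(q < J | prime q) ((q%:R : R) `^ (- half)) ^+ 3 <= 3.
Proof.
apply: (@le_trans _ _ (\sum_(n < J) (n.+1%:R : R) `^ (- (1 + half)))); last first.
  apply: le_trans (zeta_upper J _) _; rewrite /half ?invrK ?invr_gt0 //; lra.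
rewrite big_mkcond /=.
apply: (@le_trans _ _ (\sum_(q < J.+1 | prime q) ((q%:R : R) `^ (- half)) ^+ 3)).
  by rewrite [leRHS]big_mkcond big_ord_recr /= lerDl; case: ifP => // _; rewrite exprn_ge0 ?powR_ge0.
rewrite big_mkcond big_ord_recl /= add0r; apply: ler_sum => n _.
rewrite /bump /= add1n; case: ifPn => _; last exact: powR_ge0.
rewrite -powR_mulrn ?powR_ge0 // -powRrM; apply: natr_powR_le.
rewrite /half; lra.
Qed.

Lemma powR_half_small q : (324 <= q)%N -> (q%:R : R) `^ (- half) <= 1 / 18.
Proof.
move=> q0; have : (324%:R : R) `^ half <= q%:R `^ half.
  by apply: ge0_ler_powR; rewrite ?nnegrE ?ler0n ?ler_nat // invr_ge0.
have -> : (324%:R : R) `^ half = 18.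
  rewrite (_ : 324%:R = 18 `^ 2%:R); last by rewrite powR_mulrn // -natrX.
  by rewrite -powRrM mulfV ?powRr1 // pnatr_eq0.
move=> h; rewrite powRN mul1r lef_pV2 ?posrE //.
by apply: lt_le_trans h.
Qed.

Let rho0 : R := 2 `^ (- half).

Lemma rho0_lt1 : rho0 < 1.
Proof.
rewrite /rho0 /powR pnatr_eq0 /= -[ltRHS]expR0 ltr_expR mulNr oppr_lt0 mulr_gt0 ?invr_gt0 //.
by rewrite ln_gt0 // ltr1n.
Qed.

(** The prime 2 is treated first, together with the division by z^k; the other primes below 324 cost
    a fixed factor each; every further prime costs exp(r^2 + O(r^3)). [K] collects everything but
    the sum of the r^2 and does not depend on [s], [P] or [k]. *)
Lemma cole_gamelin : exists K : R, forall s P k (X : R), 1 / 2 <= complex.Re s ->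
  (forall J, \sum_(q < J | prime q) (q%:R : R) `^ (- (2 * complex.Re s)) <= X) ->
  ((cmod (dpoly_eval (sharp k P) s) `^ p)%:E <=
   (expR (K + X))%:E * tint (fun z => cmod (bohr_lift P z) `^ p)%R)%E.
Proof.
pose K1 : R := (1 - rho0)^-1 `^ p.
have K1pos : 0 < K1 by rewrite powR_gt0 // invr_gt0 subr_gt0 rho0_lt1.
have K1ge : 1 <= K1.
  have h1p : 1 `^ p = 1 :> R by rewrite powR1.
  rewrite -h1p; apply: ge0_ler_powR; rewrite ?nnegrE ?invr_ge0 ?subr_ge0 ?(ltW rho0_lt1) //.
  by rewrite invf_ge1 ?subr_gt0 ?rho0_lt1 // gerBl powR_ge0.
pose kap := ln K1.
have kap0 : 0 <= kap by exact: ln_ge0.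
have kapE : K1 = expR kap by rewrite lnK.
have [c5 [c50 c5E]] : exists c : R, 0 <= c /\ c = 5000 * p.
  by exists (5000 * p); exact: conj (mulr_ge0 (ler0n R 5000) p0) erefl.
have [c3 [c30 c3E]] : exists c : R, 0 <= c /\ c = kap * 324%:R.
  by exists (kap * 324%:R); exact: conj (mulr_ge0 kap0 (ler0n R 324)) erefl.
exists (c3 + kap + 3 * c5) => s P k X; rewrite div1r -/half => hs hX; set J := (size P).+1; have PJ : (size P < J)%N by [].
set sigma := complex.Re s in hs *.
pose a q := natpowN q s.
have ra q : (0 < q)%N -> cmod (a q) = (q%:R : R) `^ (- sigma).
  by case: q => // q _; rewrite /a cmod_natpowN.
have ra2 q : (0 < q)%N -> cmod (a q) <= (q%:R : R) `^ (- half).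
  by case: q => // q _; rewrite ra //; exact: natr_half_le.
(* Bound for the logarithm of the cost of the prime [q]: a fixed amount below 324, added to the
   exponent of [evint_small]. *)
have [kp kpE] : exists kp : nat -> R, forall q,
    kp q = kap * (q < 324)%:R + (q%:R `^ (- (2 * sigma)) + c5 * (q%:R `^ (- half)) ^+ 3).
  by exists (fun q => kap * (q < 324)%:R + (q%:R `^ (- (2 * sigma)) + c5 * (q%:R `^ (- half)) ^+ 3)).
have kp0 q : 0 <= kp q.
  rewrite kpE addr_ge0 //; first by rewrite mulr_ge0.
  by rewrite addr_ge0 ?powR_ge0 // mulr_ge0 // exprn_ge0 // powR_ge0.
have rho2 q : prime q -> cmod (a q) <= rho0.
  move=> pq; apply: le_trans (ra2 q (prime_gt0 pq)) _.
  rewrite /rho0 !powRN lef_pV2 ?posrE ?powR_gt0 ?ltr0n ?prime_gt0 //.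
  by apply: ge0_ler_powR; rewrite ?nnegrE ?invr_ge0 ?ler0n // (ler_nat R 2) prime_gt1.
have step Q q : prime q -> (evint Q (mixc a q.+1) <= (expR (kp q))%:E * evint Q (mixc a q))%E.
  move=> pq; have q0 := prime_gt0 pq.
  have [q324|q324] := ltnP q 324.
    apply: le_trans (evint_crude Q pq (rho2 q pq) rho0_lt1) _.
    rewrite lee_wpmul2r ?evint_ge0 // lee_fin -/K1 kapE ler_expR kpE q324 mulr1.
    by rewrite lerDl addr_ge0 ?powR_ge0 // mulr_ge0 // exprn_ge0 // powR_ge0.
  have rs : cmod (a q) <= 1 / 18 by apply: le_trans (ra2 q q0) _; exact: powR_half_small.
  apply: le_trans (evint_small Q pq erefl rs) _.
  rewrite lee_wpmul2r ?evint_ge0 // lee_fin ler_expR kpE ltnNge q324 mulr0 add0r.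
  apply: lerD.
    rewrite ra // expr2 -powRD; last by rewrite pnatr_eq0 -lt0n q0 implybT.
    by rewrite -opprD -mulr2n mulr_natl.
  by rewrite -c5E ler_wpM2l // lerXn2r ?nnegrE ?cmod_ge0 ?powR_ge0 // ra2.
(* The product starts at 3, the prime 2 being left to [evint_sharp]. *)
have chain Q i : (evint Q (mixc a (3 + i)) <=
    (expR (\sum_(q < 3 + i | prime q && (3 <= q)%N) kp q))%:E * evint Q (mixc a 3))%E.
  elim: i => [|i IH].
    rewrite addn0 big1 ?expR0 ?mul1e // => q /andP[_ h].
    by have := ltn_ord q; rewrite ltnNge h.
  rewrite addnS big_mkcond big_ord_recr -big_mkcond /= leq_addr andbT.
  case: ifPn => pq; last by rewrite addr0 evint_nonprime.
  apply: le_trans (step Q _ pq) _.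
  rewrite expRD [expR _ * expR _]mulrC EFinM -muleA.
  by apply: lee_wpmul2l; rewrite ?lee_fin ?expR_ge0.
have h1 : (evint (sharp k P) (mixc a 3) <= (expR kap)%:E * tint (fun z => cmod (bohr_lift P z) `^ p)%R)%E.
  rewrite -(evint_bohr P a) -kapE; apply: evint_sharp; last exact: rho0_lt1.
  exact: rho2.
rewrite dpoly_eval_ev -/a -(@evint_full _ a (3 + J)); last first.
  apply: leq_ltn_trans (size_poly _ _) _; exact: leq_trans PJ (leq_addl _ _).
apply: le_trans (chain _ J) _.
apply: (@le_trans _ _ ((expR (\sum_(q < 3 + J | prime q && (3 <= q)%N) kp q))%:E *
   ((expR kap)%:E * tint (fun z => cmod (bohr_lift P z) `^ p)%R))%E).
  by rewrite lee_wpmul2l // lee_fin expR_ge0.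
rewrite muleA -EFinM -expRD; apply: lee_wpmul2r; last rewrite lee_fin ler_expR.
  by apply: tint_ge0 => z; exact: powR_ge0.
have cnt : \sum_(q < 3 + J | prime q && (3 <= q)%N) kap * (q < 324)%:R <= c3.
  rewrite c3E -mulr_sumr ler_wpM2l // -natr_sum ler_nat.
  apply: (@leq_trans (\sum_(0 <= q < 3 + J | (q < 324)%N) 1)%N).
    rewrite big_mkord big_mkcond [leqRHS]big_mkcond; apply: leq_sum => q _ /=.
    by case: (_ && _); case: (_ < _)%N.
  rewrite -big_filter sum1_size -(size_iota 0 324); apply: uniq_leq_size; rewrite ?filter_uniq ?iota_uniq //.
  by move=> q; rewrite mem_filter mem_iota add0n => /andP[-> _].
have sumE (F : nat -> R) : (forall q, 0 <= F q) ->
    \sum_(q < 3 + J | prime q && (3 <= q)%N) F q <= \sum_(q < 3 + J | prime q) F q.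
  move=> F0; rewrite big_mkcond [leRHS]big_mkcond; apply: ler_sum => q _ /=.
  by case: (prime q) => //=; case: ifP.
have s1 := le_trans (sumE (fun q => (q%:R : R) `^ (- (2 * sigma))) (fun q => powR_ge0 _ _)) (hX _).
have s2 := le_trans (sumE (fun q => ((q%:R : R) `^ (- half)) ^+ 3) (fun q => exprn_ge0 _ (powR_ge0 _ _))) (sum_prime_cube_le _).
have s3 := ler_wpM2l c50 s2.
under eq_bigr do rewrite kpE.
rewrite big_split big_split /= -mulr_sumr.
move: cnt s1 s3; rewrite -!mulr_sumr.
move: (\sum_(i < _ | _) _) (\sum_(i < _ | _) _) (\sum_(i < _ | _) _) => x y z; lra.
Qed.

End Haar.

End PointEvaluation.


(** * The test functions *)

Section TestFunctions.
Variable R : realType.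
Local Notation C := (Cplx R).
Local Notation T := (polytorus R).
Implicit Types (P Q : {poly C}) (s : C) (x a : nat -> C) (z : T).

Lemma evD P Q x : ev (P + Q) x = ev P x + ev Q x.
Proof.
pose N := maxn (size P) (size Q).
rewrite (@evE _ (P + Q) N) ?size_polyD // (@evE _ P N) ?leq_maxl // (@evE _ Q N) ?leq_maxr //.
by rewrite -big_split; apply: eq_bigr => n _; rewrite coefD mulrDl.
Qed.

Lemma evZ (c : C) P x : ev (c *: P) x = c * ev P x.
Proof.
rewrite (@evE _ (c *: P) (size P)) ?size_scale_leq // /ev mulr_sumr.
by apply: eq_bigr => n _; rewrite coefZ mulrA.
Qed.

Lemma ev_Xn m x : (0 < m)%N -> ev ('X^(m.-1)) x = chi x m.
Proof.
case: m => // m _ /=; rewrite (@evE _ _ m.+1) ?size_polyXn // big_ord_recr /= coefXn eqxx mul1r.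
rewrite big1 ?add0r // => i _; rewrite coefXn; case: eqP => [h|_]; last by rewrite mul0r.
by have := ltn_ord i; rewrite h ltnn.
Qed.

Lemma ev1 x : ev 1 x = 1.
Proof. by rewrite -(expr0 'X) (@ev_Xn 1) // chi1. Qed.

Lemma chi_expn x q k : prime q -> chi x (q ^ k) = x q ^+ k.
Proof.
move=> pq; have q0 := prime_gt0 pq.
elim: k => [|k IH]; first by rewrite expn0 chi1.
by rewrite expnS chiM ?expn_gt0 ?q0 // IH chi_prime // exprS.
Qed.

Lemma dconvE P N b n : (size P <= N)%N ->
  dconv P b n = \sum_(d < N | (d.+1 %| n.+1)%N) P`_d * b (n.+1 %/ d.+1).-1.
Proof.
move=> h; rewrite /dconv [LHS]big_mkcond [RHS]big_mkcond /= -(subnKC h) big_split_ord /=.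
rewrite [X in _ + X]big1 ?addr0 // => i _.
by rewrite nth_default ?mul0r ?leq_addr // if_same.
Qed.

Lemma dmul_Xn_coef m Q d : (0 < m)%N ->
  (dmul 'X^(m.-1) Q)`_d = if (m %| d.+1)%N then Q`_(d.+1 %/ m).-1 else 0.
Proof.
case: m => // m _; rewrite dmul_coef (@dconvE _ m.+1) ?size_polyXn // big_mkcond big_ord_recr /=.
rewrite coefXn eqxx mul1r big1 ?add0r // => i _.
rewrite coefXn; case: (eqVneq (i : nat) m) => [h|_]; last by rewrite mul0r if_same.
by have := ltn_ord i; rewrite h ltnn.
Qed.

Lemma dconv_dmul_Xn m Q b n : (0 < m)%N ->
  dconv (dmul 'X^(m.-1) Q) b (m * n.+1).-1 = dconv Q b n.
Proof.
move=> m0; set F := dmul _ _; pose M := (size Q + size F)%N.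
rewrite (@dconvE _ (m * M)); last by rewrite /M; nia.
rewrite prednK ?muln_gt0 ?m0 //.
transitivity (\sum_(d < m * M | (m %| d.+1)%N && (d.+1 %| m * n.+1)%N)
    Q`_(d.+1 %/ m).-1 * b (m * n.+1 %/ d.+1).-1).
  rewrite big_mkcond [RHS]big_mkcond; apply: eq_bigr => d _ /=.
  by rewrite dmul_Xn_coef //; case: (m %| d.+1)%N; case: ifP => //; rewrite ?mul0r.
have := @sum_multiples _ (fun j => Q`_(j %/ m).-1 * b (m * n.+1 %/ j).-1) (fun j => (j %| m * n.+1)%N) m (m * M) m0.
move=> ->; rewrite mulKn // (@dconvE Q M) ?leq_addr //.
apply: eq_big => [e|e _]; first by rewrite dvdn_pmul2l.
by rewrite mulKn // divnMl.
Qed.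

(* The quadratic truncation of the Euler factor [(1 - c q ^ (- s)) ^ (- b)]. *)
Definition tfac (b : R) (c : C) q : {poly C} :=
  1 + (b%:C * c) *: 'X^(q.-1) + ((b * (b + 1) / 2)%:C * c ^+ 2) *: 'X^((q ^ 2).-1).

Lemma ev_tfac b c q x : prime q -> ev (tfac b c q) x = quad b (c * x q).
Proof.
move=> pq; have q0 := prime_gt0 pq.
by rewrite /tfac !evD !evZ !ev_Xn ?expn_gt0 ?q0 // ev1 chi_prime // chi_expn // /quad exprMn !mulrA.
Qed.

(* 324 = 18 ^ 2: for smaller primes, [q ^ (- 1 / 2)] exceeds the radius 1 / 18 of the
   one-variable estimates. *)
Definition tprime q := prime q && (324 <= q)%N.

Fixpoint tprod (b : R) a X : {poly C} :=
  if X is q.+1 then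
    if tprime q then dmul (tfac b (cj (a q)) q) (tprod b a q) else tprod b a q
  else 1.

Lemma ev_tprod b a X x : ev (tprod b a X) x = \prod_(q < X | tprime q) quad b (cj (a q) * x q).
Proof.
elim: X => [|X IH] /=; first by rewrite ev1 big_ord0.
rewrite big_mkcond big_ord_recr -big_mkcond /=; case: ifPn => h; last by rewrite mulr1 IH.
by rewrite ev_dmul IH ev_tfac 1?mulrC //; case/andP: h.
Qed.

Lemma tcvg_quad b c i : tcvg (fun z => quad b (c * tcoord z i)).
Proof.
have h := tcvgM (tcvg_cst c) (@tcvg_tcoord R i).
apply: tcvgD; last by apply: tcvgM; [exact: tcvg_cst | exact: tcvgX].
by apply: tcvgD; [exact: tcvg_cst | apply: tcvgM => //; exact: tcvg_cst].
Qed.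

Section Haar.
Variable m : probability T R.
Hypothesis hm : is_haar m.

(** Here the integrand to be bounded is the one that is averaged: one factor of the test function is
    integrated out. *)
Lemma torus_step_avg (F G : T -> R) i N (w : C) (c0 : R) : (0 < N)%N -> cmod w = 1 -> 0 <= c0 ->
  measurable_fun [set: T] F -> measurable_fun [set: T] G ->
  (forall z, 0 <= F z) -> (forall z, 0 <= G z) ->
  (forall c : nat -> circle R, (forall k, set_val (c k) = w ^+ k) -> forall z,
     N%:R^-1 * \sum_(k < N) G (trot (coord_rot i (c k)) z) <= c0 * F z) ->
  (tint m G <= c0%:E * tint m F)%E.
Proof.
move=> N0 w1 c00 mF mG F0 G0 h; rewrite /tint.
have [c [cE ->]] := haar_average hm i N0 w1 mG G0.
have mA : measurable_fun [set: T] (fun z => N%:R^-1 * \sum_(k < N) G (trot (coord_rot i (c k)) z)).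
  apply: measurable_funM; first exact: measurable_cst.
  by apply: measurable_sum => k; exact: measurableT_comp mG (measurable_trot _).
have A0 z : 0 <= N%:R^-1 * \sum_(k < N) G (trot (coord_rot i (c k)) z).
  by rewrite mulr_ge0 ?invr_ge0 ?ler0n // sumr_ge0.
rewrite -ge0_integralZl_EFin //; last 2 first.
- by move=> z _; rewrite lee_fin.
- exact/measurable_EFinP.
apply: ge0_le_integral => //.
- by move=> z _; rewrite lee_fin.
- exact/measurable_EFinP.
- by apply/measurable_EFinP; apply: measurable_funM => //; exact: measurable_cst.
- by move=> z _; rewrite -EFinM lee_fin; exact: h.
Qed.

Variable p : R.
Hypothesis p1 : 1 <= p.

Let p0 : 0 <= p. Proof. exact: le_trans ler01 p1. Qed.

(** Factors are integrated out from the largest prime down; three rotations are enough for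
    [quad_average]. *)
Lemma tint_tprod_le a X : (forall q, (0 < q)%N -> cmod (a q) <= (q%:R : R) `^ (- 2^-1)) ->
  (tint m (fun z => cmod (\prod_(q < X | tprime q) quad (2 / p) (cj (a q) * tcoord z (prime_rank q))) `^ p)%R
   <= (expR (\sum_(q < X | tprime q) (cmod (a q) ^+ 2 + 5000 * p * cmod (a q) ^+ 3)))%:E)%E.
Proof.
move=> ha.
pose F X z : C := \prod_(q < X | tprime q) quad (2 / p) (cj (a q) * tcoord z (prime_rank q)).
have tF Y : tcvg (F Y) by apply: tcvg_prod => q; exact: tcvg_quad.
have mF Y : measurable_fun [set: T] (fun z => cmod (F Y z) `^ p).
  by apply/measurable_EFinP; exact: measurable_cmod_powR.
rewrite -/(F X); elim: X => [|X IH].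
  rewrite big_ord0 expR0 /tint.
  under eq_integral do rewrite /F big_ord0 cmod1 powR1.
  by rewrite integral_cst //= probability_setT mule1.
case tX : (tprime X); last first.
  rewrite big_mkcond big_ord_recr -big_mkcond /= tX addr0.
  apply: le_trans IH; rewrite le_eqVlt; apply/orP; left; apply/eqP; congr tint.
  by apply/funext => z; rewrite /F big_mkcond big_ord_recr -big_mkcond /= tX mulr1.
have /andP[pX X324] := tX.
have r1 : cmod (a X) <= 1 / 18.
  by apply: le_trans (ha X (prime_gt0 pX)) _; exact: powR_half_small.
rewrite big_mkcond big_ord_recr -big_mkcond /= tX addrC expRD EFinM.
have hN : (2 < 3)%N by []. have N0 : (0 < 3)%N by [].
have [w hw] := @exists_proot R _ N0; have [w1 _ _] := hw.
apply: (@le_trans _ _ ((expR (cmod (a X) ^+ 2 + 5000 * p * cmod (a X) ^+ 3))%:E *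
    tint m (fun z => cmod (F X z) `^ p)%R)%E); last first.
  by apply: lee_wpmul2l; [rewrite lee_fin; exact: expR_ge0 | exact: IH].
apply: (@torus_step_avg (fun z => cmod (F X z) `^ p) (fun z => cmod (F X.+1 z) `^ p) (prime_rank X) 3 w).
- exact: N0.
- exact: w1.
- exact: expR_ge0.
- exact: mF.
- exact: mF.
- by move=> z; exact: powR_ge0.
- by move=> z; exact: powR_ge0.
move=> c cE z.
have E0 k : F X.+1 (trot (coord_rot (prime_rank X) (c k)) z) =
    F X z * quad (2 / p) (cj (a X) * (w ^+ k * tcoord z (prime_rank X))).
  rewrite /F [in LHS]big_mkcond big_ord_recr -big_mkcond /= tX.
  rewrite tcoord_coord_rot eqxx cE; congr (_ * _).
  apply: eq_bigr => q /andP[pq _]; rewrite tcoord_coord_rot ifN //.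
  apply/eqP => /(prime_rank_inj pq pX) qX.
  by have := ltn_ord q; rewrite qX ltnn.
have E k : cmod (F X.+1 (trot (coord_rot (prime_rank X) (c k)) z)) `^ p =
    cmod (F X z) `^ p * cmod (quad (2 / p) (cj (a X) * (w ^+ k * tcoord z (prime_rank X)))) `^ p.
  by rewrite E0 cmodM; apply: powRM; exact: cmod_ge0.
under eq_bigr do rewrite E.
rewrite -mulr_sumr mulrCA mulrC; apply: ler_wpM2r; first exact: powR_ge0.
exact: (@quad_average R p (a X) _ 3 w _ p1 erefl r1 hN hw (cmod_tcoord _ _)).
Qed.

(** The first factor is 2^{-kw}, whose coefficient sits at index 2^k - 1 owing to the shift. *)
Definition tfun s k X : {poly C} :=
  dmul 'X^((2 ^ k).-1) (tprod (2 / p) (fun q => natpowN q s) X).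

Definition tsum (sigma : R) X := \sum_(q < X | tprime q) (q%:R : R) `^ (- (2 * sigma)).

Lemma cube_sum_le X : \sum_(q < X | tprime q) ((q%:R : R) `^ (- 2^-1)) ^+ 3 <= 3.
Proof.
apply: le_trans (@sum_prime_cube_le R X); rewrite big_mkcond [leRHS]big_mkcond; apply: ler_sum => q _ /=.
by rewrite /tprime; case: (prime q) => //=; case: ifP => // _; rewrite exprn_ge0 ?powR_ge0.
Qed.

Lemma cmod_natpowN_pos q s : (0 < q)%N -> cmod (natpowN q s) = (q%:R : R) `^ (- complex.Re s).
Proof. by case: q => // q _; exact: cmod_natpowN. Qed.

Lemma cj_real (x : R) : cj (x%:C) = x%:C :> C.
Proof. by rewrite /cj /= oppr0. Qed.

Lemma natpowN_powR q (x : R) : natpowN q x%:C = ((q%:R : R) `^ (- x))%:C.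
Proof. by rewrite /natpowN /= mul0r cos0 sin0 mulr1 mulr0 oppr0. Qed.

(** A real shift multiplies each conj(q^{-s}) by q^{-eps}, so it is absorbed by moving the parameter
    to s + eps, where the moduli are smaller. The factor 2^{-kw} has constant modulus on the torus
    and supplies the decay in [eps]. *)
Lemma tint_tfun_le s k X (eps : R) : 1 / 2 <= complex.Re s -> 0 <= eps ->
  (tint m (fun z => cmod (bohr_lift (dpoly_shift (tfun s k X) eps) z) `^ p)%R <=
   (2 `^ (- (eps * k%:R * p)) * expR (tsum (complex.Re s) X + 3 * (5000 * p)))%:E)%E.
Proof.
rewrite div1r => hs e0; pose a q := natpowN q (s + eps%:C).
have ra q : (0 < q)%N -> cmod (a q) <= (q%:R : R) `^ (- complex.Re s).
  case: q => // q _; rewrite cmod_natpowN; apply: natr_powR_le.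
  by rewrite ReD /= lerN2 lerDl.
have ha q : (0 < q)%N -> cmod (a q) <= (q%:R : R) `^ (- 2^-1).
  case: q => // q _; apply: le_trans (ra _ _) _ => //.
  by apply: natr_powR_le; rewrite lerN2.
have E z : cmod (bohr_lift (dpoly_shift (tfun s k X) eps) z) `^ p =
    2 `^ (- (eps * k%:R * p)) *
    cmod (\prod_(q < X | tprime q) quad (2 / p) (cj (a q) * tcoord z (prime_rank q))) `^ p.
  rewrite bohr_lift_ev ev_shift /tfun ev_dmul ev_Xn ?expn_gt0 // chi_expn // ev_tprod.
  rewrite cmodM powRM; [|exact: cmod_ge0|exact: cmod_ge0].
  congr (_ * cmod _ `^ _).
    rewrite cmodX cmodM cmod_tcoord mulr1 (@cmod_natpowN _ 1) /=.
    rewrite -powR_mulrn ?powR_ge0 // -!powRrM; congr (_ `^ _); ring.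
  apply: eq_bigr => q /andP[pq _]; congr (quad _ _).
  have := prime_gt0 pq; move: (nat_of_ord q) => -[//|j] _.
  by rewrite /a natpowND cjM mulrA [in RHS]natpowN_powR cj_real -natpowN_powR.
rewrite /tint; under eq_integral do rewrite E EFinM.
rewrite ge0_integralZl_EFin; last 4 first.
- by [].
- by move=> z _; rewrite lee_fin powR_ge0.
- by apply: measurable_cmod_powR; apply: tcvg_prod => q; exact: tcvg_quad.
- exact: powR_ge0.
rewrite EFinM; apply: lee_wpmul2l; first by rewrite lee_fin powR_ge0.
apply: le_trans (tint_tprod_le X ha) _; rewrite lee_fin ler_expR.
rewrite big_split /= -mulr_sumr; apply: lerD.
  apply: ler_sum => q /andP[pq _]; have q0 := prime_gt0 pq.
  rewrite (_ : - (2 * complex.Re s) = - complex.Re s * 2%:R); last by ring.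
  rewrite powRrM powR_mulrn ?powR_ge0 //.
  by rewrite lerXn2r ?nnegrE ?cmod_ge0 ?powR_ge0 // ra.
have c50 := mulr_ge0 (ler0n R 5000) p0.
rewrite [leRHS]mulrC; apply: ler_wpM2l => //; apply: le_trans (cube_sum_le X).
apply: ler_sum => q /andP[pq _]; have q0 := prime_gt0 pq.
by rewrite lerXn2r ?nnegrE ?cmod_ge0 ?powR_ge0 // ha.
Qed.

(** At [s] every argument of [quad] is the positive number r^2 with r = q^{-Re s}, so each factor
    contributes about exp(2 r^2), twice the exponent found in the norm. The loss 24 is 8 times the
    bound 3 of [cube_sum_le]. *)
Lemma tprod_value s X : 1 / 2 <= complex.Re s ->
  expR (2 * tsum (complex.Re s) X - 24) <=
  cmod (dpoly_eval (tprod (2 / p) (fun q => natpowN q s) X) s) `^ p.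
Proof.
rewrite div1r => hs; have pp : 0 < p by exact: lt_le_trans ltr01 p1.
rewrite dpoly_eval_ev ev_tprod.
pose r q := (q%:R : R) `^ (- complex.Re s).
have r0 q : 0 <= r q by exact: powR_ge0.
have hr q : (0 < q)%N -> r q <= (q%:R : R) `^ (- 2^-1).
  by case: q => // q _; apply: natr_powR_le; rewrite lerN2.
apply: (@le_trans _ _ (\prod_(q < X | tprime q) expR (2 * r q ^+ 2 - 8 * (q%:R `^ (- 2^-1)) ^+ 3))).
  rewrite -expR_sum ler_expR sumrB -!mulr_sumr; apply: lerB.
    rewrite le_eqVlt; apply/orP; left; apply/eqP; congr (_ * _); apply: eq_bigr => q _.
    rewrite (_ : - (2 * complex.Re s) = - complex.Re s * 2%:R); last by ring.
    by rewrite powRrM powR_mulrn ?powR_ge0.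
  by have := cube_sum_le X; move: (\sum_(q < X | _) _) => S; lra.
have -> : cmod (\prod_(q < X | tprime q) quad (2 / p) (cj (natpowN q s) * natpowN q s)) `^ p =
    \prod_(q < X | tprime q) cmod (quad (2 / p) (cj (natpowN q s) * natpowN q s)) `^ p.
  elim/big_rec2: _ => [|q y x _ <-]; first by rewrite cmod1 powR1.
  by rewrite cmodM powRM ?cmod_ge0.
apply: ler_prod => q /andP[pq q324]; apply/andP; split; first exact: expR_ge0.
have q0 := prime_gt0 pq.
rewrite conj_mul_self cmod_natpowN_pos // -/(r q) quad_real.
have rq : r q <= 1 / 18 by apply: le_trans (hr q q0) (powR_half_small _ q324).
have hq := hr q q0; set y := q%:R `^ (- 2^-1) in hq *.
set b := 2 / p; have b0 : 0 < b by rewrite divr_gt0.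
have b2 : b <= 2 by rewrite ler_pdivrMr // ler_peMr.
have bp : b * p = 2 by rewrite mulfVK // gt_eqF.
have x0 : 0 <= r q ^+ 2 by rewrite exprn_ge0.
have x1 : r q ^+ 2 <= 1 / 324.
  by have := r0 q; move: (r q) rq => t; nra.
have t1 : `|b * r q ^+ 2| <= 1 / 2.
  rewrite ger0_norm; last exact: mulr_ge0 (ltW b0) x0.
  by apply: le_trans (ler_pM (ltW b0) x0 b2 x1) _; lra.
have h := expR_le_1D t1.
have cE : 1 + b * r q ^+ 2 <= cmod ((1 + b * r q ^+ 2 + b * (b + 1) / 2 * r q ^+ 2 ^+ 2)%:C).
  rewrite cmod_real; apply: le_trans (ler_norm _); rewrite lerDl.
  apply: mulr_ge0; last exact: exprn_ge0.
  by apply: divr_ge0 => //; apply: mulr_ge0; rewrite ?addr_ge0 ?(ltW b0).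
have h2 := le_trans h cE.
apply: (@le_trans _ _ (expR (b * r q ^+ 2 - 2 * (b * r q ^+ 2) ^+ 2) `^ p)); last first.
  by apply: ge0_ler_powR; rewrite ?nnegrE ?expR_ge0 ?cmod_ge0.
rewrite -expRM ler_expR.
have E : (b * r q ^+ 2 - 2 * (b * r q ^+ 2) ^+ 2) * p = 2 * r q ^+ 2 - 4 * b * r q ^+ 4.
  rewrite (_ : _ * p = (b * p) * r q ^+ 2 - 2 * (b * p) * b * r q ^+ 4); last by ring.
  by rewrite bp; ring.
rewrite E; apply: lerB => //.
have a1 : r q ^+ 4 <= y ^+ 3.
  apply: (@le_trans _ _ (r q ^+ 3)); last by rewrite lerXn2r ?nnegrE ?powR_ge0.
  rewrite exprS -[leRHS]mul1r; apply: ler_wpM2r; first exact: exprn_ge0.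
  by apply: le_trans rq _; lra.
have a0 : 0 <= r q ^+ 4 by exact: exprn_ge0.
by move: (r q ^+ 4) (y ^+ 3) a0 a1 => u v; nra.
Qed.

End Haar.

End TestFunctions.


(** * The norm of A^p_alpha *)

Section MonotoneIntegral.
Context d (T : measurableType d) (R : realType).
Variable mu : {measure set T -> \bar R}.
Local Open Scope ereal_scope.

(* The integral of an arbitrary nonnegative function is a supremum over the simple
   functions below it, hence monotone. *)
Lemma ge0_integral_mono (D1 D2 : set T) (f1 f2 : T -> \bar R) :
  D1 `<=` D2 -> (forall x, D2 x -> 0 <= f2 x) -> (forall x, D1 x -> 0 <= f1 x) ->
  (forall x, D1 x -> f1 x <= f2 x) ->
  \int[mu]_(x in D1) f1 x <= \int[mu]_(x in D2) f2 x.
Proof.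
move=> D12 f20 f10 f12; rewrite !ge0_integralE //.
apply: le_ereal_sup => _ [h /= hf <-]; exists h => // x /=.
apply: le_trans (hf x) _; rewrite !patchE; case: ifPn => xD.
  by rewrite mem_set; [apply: f12; exact: set_mem | apply: D12; exact: set_mem].
by case: ifPn => // x2; apply: f20; exact: set_mem.
Qed.

Lemma ge0_integral_exhaust (E : nat -> set T) (f : T -> \bar R) B :
  nondecreasing_seq E -> (forall i, measurable (E i)) ->
  (forall i, measurable_fun (E i) f) -> (forall i x, E i x -> 0 <= f x) ->
  (forall i, \int[mu]_(x in E i) f x <= B) -> \int[mu]_(x in \bigcup_i E i) f x <= B.
Proof.
move=> ndE mE mf f0 hB.
have h := @ge0_nondecreasing_set_cvg_integral _ _ _ _ _ mu ndE mE mf f0.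
rewrite -(cvg_lim _ h) //; apply: lime_le; first by apply: cvgP h.
by near=> n.
Unshelve. all: by end_near. Qed.

End MonotoneIntegral.

(** * Elementary bounds for Gamma integrals *)

Section PowerExponential.
Variable R : realType.
Local Notation mu := (@lebesgue_measure R).
Implicit Types (a l u x : R).

(** Allows exp(-u) to be replaced by a multiple of (1 + u^a)^{-2}, because t^{a-1} (1 + (l
    t)^a)^{-2} has an elementary antiderivative. *)
Lemma powR_expR_bound a : 0 < a ->
  exists2 C : R, 0 < C & forall u, 0 <= u -> (1 + u `^ a) ^+ 2 * expR (- u) <= C.
Proof.
move=> a0; have [N hN] := exists_natr_gt a.
(* Raising u / M <= exp(u / M) to the power [M] gives u^M <= M^M exp(u); the factor 2 in [M]
   provides for the square. *)
pose M := (N.+1 * 2)%N; pose K : R := M%:R ^+ M.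
have K0 : 0 <= K by rewrite exprn_ge0.
exists (8 + 2 * K); first by lra.
move=> u u0.
have M0 : 0 < (M%:R : R) by rewrite ltr0n.
have h1 : u ^+ M <= K * expR u.
  have e : u / M%:R <= expR (u / M%:R).
    by apply: le_trans (expR_ge1Dx _); rewrite lerDr.
  have := @lerXn2r _ M (u / M%:R) (expR (u / M%:R)).
  rewrite !nnegrE expR_ge0 divr_ge0 ?(ltW M0) // => /(_ isT isT e).
  rewrite -expRM_natl [_ * (u / _)]mulrCA mulfV ?gt_eqF // mulr1.
  by rewrite expr_div_n ler_pdivrMr ?exprn_gt0 // [expR u * _]mulrC.
have h2 : u `^ a <= 1 + u ^+ N.+1.
  have [u1|u1] := leP u 1.
    apply: (@le_trans _ _ 1); last by rewrite lerDl exprn_ge0.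
    have E : 1 `^ a = 1 :> R by rewrite powR1.
    by rewrite -[leRHS]E; apply: ge0_ler_powR; rewrite ?nnegrE ?(ltW a0).
  rewrite -powR_mulrn // ler_wpDl //; apply: ler_powR; first exact: ltW.
  by rewrite ltW // (lt_le_trans hN) // ler_nat.
have h3 : 0 <= u `^ a by exact: powR_ge0.
have e0 : 0 < expR u by exact: expR_gt0.
have e1 : 1 <= expR u by rewrite -[leLHS]expR0 ler_expR.
rewrite expRN ler_pdivrMr //.
have v0 : 0 <= u ^+ N.+1 by rewrite exprn_ge0.
have E : u ^+ M = (u ^+ N.+1) ^+ 2 by rewrite exprM.
rewrite E in h1.
move: (u `^ a) (u ^+ N.+1) h1 h2 h3 v0 => y v h1 h2 h3 v0.
apply: (@le_trans _ _ (8 + 2 * v ^+ 2)).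
  apply: (@le_trans _ _ ((2 + v) ^+ 2)).
    by rewrite lerXn2r ?nnegrE; lra.
  by have := sqr_ge0 (v - 2); rewrite !sqrrD sqrrN mulrN; lra.
by nra.
Qed.

Lemma is_derive_powR_pos a x : 0 < x -> is_derive x 1 (fun t : R => t `^ a) (a * x `^ (a - 1)).
Proof.
move=> x0; have h : x \in `]0, +oo[%R by rewrite in_itv /= x0.
apply: DeriveDef; first exact: derivable_powR.
by rewrite -derive1E powR_derive1.
Qed.

Lemma continuous_powR_pos a x : 0 < x -> {for x, continuous (fun t : R => t `^ a)}.
Proof.
move=> x0; have h : x \in `]0, +oo[%R by rewrite in_itv /= x0.
by apply: differentiable_continuous; apply/derivable1_diffP; exact: derivable_powR.
Qed.

Lemma measurable_powR_expR a l (D : set R) : measurable D ->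
  measurable_fun D (fun t : R => t `^ a * expR (- (l * t))).
Proof.
move=> mD; apply: measurable_funTS; apply: measurable_funM; first exact: measurable_powR.
by apply: measurableT_comp => //; apply: measurableT_comp => //; exact: mulrl_measurable.
Qed.

(** Compact intervals, because t^{a-1} may be singular at 0; the fundamental theorem of calculus is
    applied away from it. *)
Definition exhaust (n : nat) : set R := `[n.+1%:R^-1, n.+1%:R]%classic.

Lemma exhaust_nd : nondecreasing_seq exhaust.
Proof.
move=> m n mn; apply/subsetPset => x; rewrite /exhaust /= !in_itv /= => /andP[h1 h2].
have h : (m.+1%:R : R) <= n.+1%:R by rewrite ler_nat.
apply/andP; split; last exact: le_trans h.
by apply: le_trans h1; rewrite lef_pV2 ?posrE.
Qed.

Lemma bigcup_exhaust : \bigcup_n exhaust n = `]0, +oo[%classic.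
Proof.
apply/seteqP; split => x /=.
  move=> [n _]; rewrite /exhaust /= !in_itv /= andbT => /andP[h _].
  by apply: lt_le_trans h; rewrite invr_gt0.
rewrite in_itv /= andbT => x0.
have [n hn] := exists_natr_gt (Num.max x x^-1); exists n => //.
rewrite /exhaust /= in_itv /=; move: hn; rewrite gt_max => /andP[h1 h2].
have h : (n%:R : R) <= n.+1%:R by rewrite ler_nat.
rewrite (ltW (lt_le_trans h1 h)) andbT -[x]invrK lef_pV2 ?posrE ?invr_gt0 //.
exact: ltW (lt_le_trans h2 h).
Qed.

Lemma integral_power_kernel a l n : 0 < a -> 0 < l ->
  (\int[mu]_(t in exhaust n) (t `^ (a - 1) / (1 + (l * t) `^ a) ^+ 2)%:E <= (l `^ (- a) / a)%:E)%E.
Proof.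
move=> a0 l0.
pose c := l `^ a; have c0 : 0 < c by exact: powR_gt0.
have cE : l `^ (- a) = c^-1 by rewrite powRN.
pose F (t : R) : R := - (c * a)^-1 * (1 + c * t `^ a)^-1.
have pos (t : R) : 0 < 1 + c * t `^ a.
  by rewrite ltr_pwDl // mulr_ge0 ?powR_ge0 // ltW.
pose f (t : R) := t `^ (a - 1) * ((1 + c * t `^ a) ^+ 2)^-1.
have dF (t : R) : 0 < t -> is_derive t 1 F (f t).
  move=> t0.
  have h1 := is_derive_powR_pos a t0.
  have h2 := @is_deriveZ _ _ _ _ c t 1 _ h1.
  have h3 := is_deriveD (is_derive_cst (1 : R) t 1) h2.
  have h4 := @is_deriveV _ (fun t : R => 1 + c * t `^ a) t _ 1 (lt0r_neq0 (pos t)) h3.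
  have h5 := @is_deriveZ _ _ _ _ (- (c * a)^-1) t 1 _ h4.
  apply: (is_derive_eq h5).
  rewrite /f /GRing.scale /= add0r; have := pos t; move: (t `^ (a - 1)) (1 + c * t `^ a) => u v v0.
  by field; rewrite !gt_eqF.
have cf (t : R) : 0 < t -> {for t, continuous f}.
  move=> t0; apply: continuousM; first exact: continuous_powR_pos.
  apply: continuousV; first by rewrite expf_neq0 // gt_eqF.
  have h : {for t, continuous (fun t : R => 1 + c * t `^ a)}.
    apply: continuousD; first exact: cst_continuous.
    by apply: continuousM; [exact: cst_continuous | exact: continuous_powR_pos].
  exact: continuousM.
have cF (t : R) : 0 < t -> {for t, continuous F}.
  move=> t0; apply: differentiable_continuous; apply/derivable1_diffP.
  exact: (@ex_derive _ _ _ _ _ _ _ (dF t t0)).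
have -> : (\int[mu]_(t in exhaust n) (t `^ (a - 1) / (1 + (l * t) `^ a) ^+ 2)%:E =
    \int[mu]_(t in exhaust n) (f t)%:E)%E.
  apply: eq_integral => t; rewrite inE /exhaust /= in_itv /= => /andP[h _].
  have t0 : 0 <= t by apply: le_trans h; rewrite invr_ge0.
  by rewrite /f powRM // ltW.

have n0 : 0 < (n.+1%:R^-1 : R) by rewrite invr_gt0.
(* For [n = 0] the interval is the single point 1. *)
have [n1|n1] := eqVneq n 0%N.
  rewrite /exhaust n1 invr1 set_itv1 integral_set1 lee_fin.
  by rewrite divr_ge0 ?powR_ge0 // ltW.
have nn : (n.+1%:R^-1 : R) < n.+1%:R.
  by rewrite (@lt_trans _ _ 1) ?invf_lt1 ?ltr1n ?ltnS ?lt0n.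
rewrite (@continuous_FTC2 _ f F) //.
- rewrite -EFinB lee_fin /F cE.
  have p1 := pos n.+1%:R; have p2 := pos n.+1%:R^-1.
  have i1 : 0 <= (1 + c * n.+1%:R `^ a)^-1 by rewrite invr_ge0 ltW.
  have i2 : (1 + c * n.+1%:R^-1 `^ a)^-1 <= 1.
    by rewrite invf_le1 // lerDl mulr_ge0 ?powR_ge0 // ltW.
  have k0 : 0 < (c * a)^-1 by rewrite invr_gt0 mulr_gt0.
  rewrite (_ : c^-1 / a = (c * a)^-1); last by rewrite invfM.
  by move: (c * a)^-1 (1 + _)^-1 (1 + _)^-1 k0 i1 i2 => k x y; nra.
- apply: continuous_in_subspaceT => t; rewrite inE /= in_itv /= => /andP[h _].
  by apply: cf; exact: lt_le_trans h.
- split.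
  + by move=> t; rewrite in_itv /= => /andP[h _]; apply: (@ex_derive _ _ _ _ _ _ _ (dF t _)); exact: lt_trans h.
  + by apply: cvg_at_right_filter; apply: cF.
  + by apply: cvg_at_left_filter; apply: cF; exact: lt_trans nn.
- move=> t; rewrite in_itv /= => /andP[h _]; rewrite derive1E.
  exact: (@derive_val _ _ _ _ _ _ _ (dF t (lt_trans n0 h))).
Qed.

Lemma integral_powR_expR a : 0 < a -> exists2 C : R, 0 < C & forall l, 0 < l ->
  (\int[mu]_(t in `]0%R, +oo[) (t `^ (a - 1) * expR (- (l * t)))%:E <= (C * l `^ (- a))%:E)%E.
Proof.
move=> a0; have [C C0 hC] := powR_expR_bound a0.
exists (C / a) => [|l l0]; first by rewrite divr_gt0.
rewrite -bigcup_exhaust; apply: ge0_integral_exhaust.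
- exact: exhaust_nd.
- by move=> i; exact: measurable_itv.
- by move=> i; apply/measurable_EFinP; apply: measurable_powR_expR; exact: measurable_itv.
- by move=> i x _; rewrite lee_fin mulr_ge0 ?powR_ge0 ?expR_ge0.
move=> i; apply: (@le_trans _ _ (\int[mu]_(t in exhaust i) (C%:E * (t `^ (a - 1) / (1 + (l * t) `^ a) ^+ 2)%:E))%E).
  apply: ge0_integral_mono => // t; rewrite /exhaust /= in_itv /= => /andP[h _].
  - by rewrite mule_ge0 // lee_fin ?(ltW C0) // divr_ge0 ?powR_ge0 // exprn_ge0 // addr_ge0 ?powR_ge0.
  - by rewrite lee_fin mulr_ge0 ?powR_ge0 ?expR_ge0.
  have t0 : 0 <= t by apply: le_trans h; rewrite invr_ge0.
  have lt0 : 0 <= l * t by rewrite mulr_ge0 // ltW.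
  rewrite -EFinM lee_fin mulrCA ler_wpM2l ?powR_ge0 //.
  rewrite ler_pdivlMr; last by rewrite exprn_gt0 // ltr_pwDl // powR_ge0.
  by rewrite mulrC; exact: hC.
rewrite ge0_integralZl_EFin ?(ltW C0) //.
- rewrite mulrAC -mulrA EFinM lee_pmul2l ?lte_fin //; exact: integral_power_kernel.
- exact: measurable_itv.
- by move=> t _; rewrite lee_fin divr_ge0 ?powR_ge0 // exprn_ge0 // addr_ge0 ?powR_ge0.
rewrite (_ : (fun t => _) = fun t : R => (t `^ (a - 1) * (1 + (l * t) `^ a) `^ (- 2))%:E).
  apply/measurable_EFinP; apply: measurable_funTS; apply: measurable_funM; first exact: measurable_powR.
  apply: (measurableT_comp (measurable_powR (- 2))).
  apply: measurable_funD; first exact: measurable_cst.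
  by apply: (measurableT_comp (measurable_powR a)); exact: mulrl_measurable.
apply/funext => t; congr (_ * _)%:E.
by rewrite powRN powR_mulrn // addr_ge0 // powR_ge0.
Qed.

End PowerExponential.


(** * Norms of test functions and point evaluation in A^p_alpha *)

Section BergmanNorm.
Variable R : realType.
Local Notation C := (Cplx R).
Local Notation T := (polytorus R).
Local Notation mu := (@lebesgue_measure R).
Implicit Types (P Q : {poly C}) (s w : C).

(** Only [delta/8, delta/4] is used. There t^{a-1} is comparable to delta^{a-1}, the minimum in [d0]
    covering both signs of a - 1, and exp(-2t) >= exp(-1) because delta <= 2. *)
Lemma integral_lower (a : R) : exists2 d : R, 0 < d &
  forall (delta c : R) (f : R -> \bar R), 0 < delta <= 2 -> 0 <= c ->
    (forall t, 0 < t -> (0 <= f t)%E) ->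
    (forall t, delta / 8 <= t <= delta / 4 -> ((c * (t `^ (a - 1) * expR (- (2 * t))))%:E <= f t)%E) ->
    ((c * d * delta `^ a)%:E <= \int[mu]_(t in `]0%R, +oo[) f t)%E.
Proof.
pose d0 : R := Num.min (8^-1 `^ (a - 1)) (4^-1 `^ (a - 1)).
have d00 : 0 < d0 by rewrite lt_min !powR_gt0.
exists (d0 * expR (- 1) / 8); first by rewrite divr_gt0 // mulr_gt0 ?expR_gt0.
move=> delta c f /andP[D0 D2] c0 f0 hf.
pose k := c * (d0 * delta `^ (a - 1) * expR (- 1)).
have k0 : 0 <= k by rewrite !mulr_ge0 ?powR_ge0 ?expR_ge0 // ltW.
have h1 : (\int[mu]_(t in `[(delta / 8)%R, (delta / 4)%R]) k%:E <= \int[mu]_(t in `]0%R, +oo[) f t)%E.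
  apply: ge0_integral_mono.
  - move=> t /=; rewrite !in_itv /= andbT => /andP[h _]; apply: lt_le_trans h; lra.
  - by move=> t /=; rewrite in_itv /= andbT; exact: f0.
  - by move=> t _; rewrite lee_fin.
  move=> t /=; rewrite in_itv /= => ht; apply: le_trans (hf t ht); rewrite lee_fin /k.
  have /andP[t1 t2] := ht; have t0 : 0 < t by lra.
  apply: ler_wpM2l => //; apply: ler_pM.
  - by rewrite mulr_ge0 ?powR_ge0 // ltW.
  - exact: expR_ge0.
  - have E : t = (t / delta) * delta by rewrite divfK // gt_eqF.
    have q0 : 0 < t / delta by rewrite divr_gt0.
    have q1 : 8^-1 <= t / delta by rewrite ler_pdivlMr //; lra.
    have q2 : t / delta <= 4^-1 by rewrite ler_pdivrMr //; lra.
    rewrite [in leRHS]E powRM ?(ltW q0) ?(ltW D0) //; apply: ler_wpM2r; first exact: powR_ge0.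
    rewrite /d0 ge_min; have [h|h] := leP 0 (a - 1).
      by rewrite ge0_ler_powR ?nnegrE ?invr_ge0 ?(ltW q0).
    apply/orP; right; rewrite -[a - 1]opprK [leLHS]powRN [leRHS]powRN lef_pV2 ?posrE ?powR_gt0 ?invr_gt0 //.
    apply: ge0_ler_powR; rewrite ?nnegrE ?invr_ge0 ?(ltW q0) //.
    by rewrite oppr_ge0 ltW.
  - by rewrite ler_expR; lra.
apply: le_trans h1; rewrite integral_cst //=.
rewrite lebesgue_measure_itv /= lte_fin ifT; last by lra.
rewrite -EFinD -EFinM lee_fin /k.
have E : delta `^ a = delta `^ (a - 1) * delta.
  rewrite -{3}[delta]powRr1 ?(ltW D0) // -powRD ?subrK //.
  by apply/implyP => _; rewrite gt_eqF.
rewrite E le_eqVlt; apply/orP; left; apply/eqP; field.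
by [].
Qed.

(** An infinite integral would have the real value 0, so finiteness is needed along with a positive
    lower bound. *)
Lemma integral_gamma_gt0 (a : R) : 0 < a -> 0 < Gamma a.
Proof.
move=> a0; rewrite /Gamma /Rintegral.
have [C0 C00 hC] := integral_powR_expR a0; have [d d0 hd] := integral_lower a.
have h1 := hC 1 ltr01.
have h2 : ((1 * d * 1 `^ a)%:E <= \int[mu]_(t in `]0%R, +oo[) (t `^ (a - 1) * expR (- t))%:E)%E.
  apply: hd => //; first by rewrite ltr01 ler1n.
    by move=> t _; rewrite lee_fin mulr_ge0 ?powR_ge0 ?expR_ge0.
  move=> t /andP[t0 _]; have {}t0 : 0 <= t by apply: le_trans t0.
  rewrite mul1r lee_fin ler_wpM2l ?powR_ge0 // ler_expR lerN2; lra.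
have E : (\int[mu]_(t in `]0%R, +oo[) (t `^ (a - 1) * expR (- (1 * t)))%:E =
          \int[mu]_(t in `]0%R, +oo[) (t `^ (a - 1) * expR (- t))%:E)%E.
  by apply: eq_integral => t _; rewrite mul1r.
rewrite E in h1; move: (\int[mu]_(t in _) _)%E h1 h2 => [r| |] //=.
by move=> _; rewrite lee_fin powR1 mulr1 mul1r; exact: lt_le_trans.
Qed.

Section Haar.
Variable m : probability T R.
Hypothesis hm : is_haar m.
Variables p alpha : R.
Hypotheses (p1 : 1 <= p) (al : -1 < alpha).

Let p0 : 0 < p. Proof. exact: lt_le_trans ltr01 p1. Qed.
Let a := alpha + 1.
Let a0 : 0 < a. Proof. by rewrite /a -ltrBlDr sub0r. Qed.
Let ca : R := 2 `^ a / Gamma a.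
Let ca0 : 0 < ca.
Proof. by rewrite divr_gt0 ?powR_gt0 ?integral_gamma_gt0. Qed.

Lemma mu_densityE t : mu_density alpha t = ca * (t `^ (a - 1) * expR (- (2 * t))).
Proof. by rewrite /mu_density /ca /a addrK mulrA. Qed.

Lemma mu_density_ge0 t : 0 <= mu_density alpha t.
Proof.
rewrite mu_densityE; apply: mulr_ge0; first exact: ltW.
by apply: mulr_ge0; [exact: powR_ge0|exact: expR_ge0].
Qed.

Lemma Hnorm_powE P : (Hnorm m p P `^ p = tint m (fun z => cmod (bohr_lift P z) `^ p)%R)%E.
Proof.
have h : p != 0 by rewrite gt_eqF.
rewrite /Hnorm (poweR_Lnorm _ _ h); apply: eq_integral => z _.
by rewrite gee0_abs ?poweR_EFin // lee_fin; exact: cmod_ge0.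
Qed.

Definition Aint P : \bar R :=
  (\int[mu]_(t in `]0%R, +oo[) (tint m (fun z => cmod (bohr_lift (dpoly_shift P t) z) `^ p)%R
     * (mu_density alpha t)%:E))%E.

Lemma AnormE P : Anorm m p alpha P = (Aint P `^ p^-1)%E.
Proof. by congr poweR; apply: eq_integral => t _; rewrite Hnorm_powE. Qed.

Lemma Aint_ge0 P : (0 <= Aint P)%E.
Proof.
apply: integral_ge0 => t _; apply: mule_ge0; last by rewrite lee_fin mu_density_ge0.
by apply: tint_ge0 => z; exact: powR_ge0.
Qed.

(** The decay exp(-l t) joins the factor exp(-2t) of the density; for the test functions [l] is of
    order [k], which produces k^{-a}. *)
Lemma Aint_upper : exists2 B : R, 0 < B & forall P (D l : R), 0 <= D -> 0 <= l ->
  (forall t, 0 < t -> (tint m (fun z => cmod (bohr_lift (dpoly_shift P t) z) `^ p)%R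
     <= (D * expR (- (l * t)))%:E)%E) ->
  (Aint P <= (D * B * (l + 2) `^ (- a))%:E)%E.
Proof.
have [C0 C00 hC] := integral_powR_expR a0.
exists (ca * C0) => [|P D l D0 l0 h]; first by rewrite mulr_gt0.
apply: (@le_trans _ _ (\int[mu]_(t in `]0%R, +oo[) ((D * ca)%:E * (t `^ (a - 1) * expR (- ((l + 2) * t)))%:E))%E).
  apply: ge0_integral_mono => // t /=; rewrite in_itv /= andbT => t0.
  - rewrite -EFinM lee_fin; apply: mulr_ge0; first exact: mulr_ge0 D0 (ltW ca0).
    by apply: mulr_ge0; [exact: powR_ge0|exact: expR_ge0].
  - apply: mule_ge0; last by rewrite lee_fin mu_density_ge0.
    by apply: tint_ge0 => z; exact: powR_ge0.
  apply: (@le_trans _ _ ((D * expR (- (l * t)))%:E * (mu_density alpha t)%:E)%E).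
    by apply: lee_wpmul2r; [rewrite lee_fin mu_density_ge0 | exact: h].
  have E : expR (- ((l + 2) * t)) = expR (- (l * t)) * expR (- (2 * t)).
    by rewrite -expRD mulrDl opprD.
  rewrite -!EFinM lee_fin mu_densityE E le_eqVlt; apply/orP; left; apply/eqP; ring.
rewrite ge0_integralZl_EFin.
- rewrite (_ : D * (ca * C0) * _ = D * ca * (C0 * (l + 2) `^ (- a))); last by ring.
  rewrite [leRHS]EFinM; apply: lee_wpmul2l; first by rewrite lee_fin; exact: mulr_ge0 D0 (ltW ca0).
  by apply: hC; rewrite ltr_wpDl.
- exact: measurable_itv.
- by move=> t _; rewrite lee_fin mulr_ge0 ?powR_ge0 ?expR_ge0.
- by apply/measurable_EFinP; apply: measurable_powR_expR; exact: measurable_itv.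
- exact: mulr_ge0 D0 (ltW ca0).
Qed.

Lemma bohr_lift_shift_le P t z : 0 <= t ->
  cmod (bohr_lift (dpoly_shift P t) z) <= \sum_(n < size P) cmod P`_n.
Proof.
move=> t0; rewrite bohr_lift_ev ev_shift.
apply: le_trans (cmod_sum _ _ _) _; apply: ler_sum => n _.
rewrite cmodM chi_mul chi_natpowN cmodM cmod_natpowN /=.
have -> : cmod (chi (fun q => tcoord z (prime_rank q)) n.+1) = 1.
  rewrite /chi; elim/big_rec: _ => [|q x _ h]; first exact: cmod1.
  by rewrite cmodM cmodX cmod_tcoord expr1n mul1r.
rewrite mulr1 -[leRHS]mulr1; apply: ler_wpM2l; first exact: cmod_ge0.
have h1 : (1 : R) `^ t = 1 by rewrite powR1.
rewrite powRN invf_le1 ?powR_gt0 ?ltr0n // -[leLHS]h1.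
by apply: ge0_ler_powR; rewrite ?nnegrE ?ler1n.
Qed.

Lemma Anorm_lty P : (Anorm m p alpha P < +oo)%E.
Proof.
rewrite AnormE; apply: poweR_lty; have [B _ hB] := Aint_upper.
apply: le_lt_trans (hB P ((\sum_(n < size P) cmod P`_n) `^ p) 0 _ _ _) (ltry _) => // [|t t0].
  exact: powR_ge0.
rewrite mul0r oppr0 expR0 mulr1.
set S := _ `^ p; have S0 : 0 <= S by exact: powR_ge0.
apply: (@le_trans _ _ (\int[m]_z S%:E)%E).
  apply: ge0_integral_mono => // z _; rewrite lee_fin ?powR_ge0 //.
  apply: ge0_ler_powR; rewrite ?nnegrE ?cmod_ge0 ?(ltW p0) ?sumr_ge0 //; first by move=> *; exact: cmod_ge0.
  by apply: bohr_lift_shift_le; exact: ltW.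
by rewrite integral_cst //= probability_setT mule1.
Qed.

Lemma Anorm_ge0 P : (0 <= Anorm m p alpha P)%E.
Proof. by rewrite AnormE poweR_ge0. Qed.

Lemma Anorm_tfun_le : exists2 B : R, 0 < B & forall s k X, 1 / 2 <= complex.Re s -> (0 < k)%N ->
  (Anorm m p alpha (tfun p s k X) <=
   (B * (k%:R `^ (- a) * expR (tsum (complex.Re s) X)) `^ p^-1)%:E)%E.
Proof.
have [B B0 hB] := Aint_upper.
have ln20 : 0 < ln (2 : R) by rewrite ln_gt0 // ltr1n.
pose c5 := expR (3 * (5000 * p)).
have c50 : 0 < c5 by exact: expR_gt0.
pose D := c5 * B * ln 2 `^ (- a).
have D0 : 0 < D by rewrite !mulr_gt0 ?powR_gt0.
exists (D `^ p^-1); first exact: powR_gt0.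
move=> s k X hs k0; have kR : 0 < (k%:R : R) by rewrite ltr0n.
rewrite AnormE -powRM; [|exact: ltW|by rewrite mulr_ge0 ?powR_ge0 ?expR_ge0].
rewrite -poweR_EFin; apply: gt0_ler_poweR; rewrite ?invr_ge0 ?(ltW p0) //.
- by rewrite in_itv /= leey Aint_ge0.
- by rewrite in_itv /= leey lee_fin !mulr_ge0 ?powR_ge0 ?expR_ge0 // ltW.
set S := tsum _ _.
(* 2^{-kpt} = exp(-l t) with this [l]; as p >= 1, (l + 2)^{-a} is at most (k ln 2)^{-a}. *)
have l0 : 0 <= k%:R * p * ln (2 : R) by rewrite !mulr_ge0 // ltW.
apply: le_trans (hB _ (expR S * c5) (k%:R * p * ln 2) _ l0 _) _.
- by rewrite mulr_ge0 ?expR_ge0 // ltW.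
- move=> t t0; apply: le_trans (tint_tfun_le hm p1 k X hs (ltW t0)) _.
  rewrite lee_fin -/S expRD -/c5 mulrC ler_wpM2l ?mulr_ge0 ?expR_ge0 ?(ltW c50) //.
  rewrite /powR pnatr_eq0 /= ler_expR le_eqVlt; apply/orP; left; apply/eqP; ring.
rewrite lee_fin /D.
have h : (k%:R * p * ln 2 + 2) `^ (- a) <= ln 2 `^ (- a) * k%:R `^ (- a) :> R.
  rewrite -powRM ?(ltW ln20) ?(ltW kR) // !powRN lef_pV2 ?posrE ?powR_gt0 //; last 2 first.
  - by rewrite ltr_wpDl.
  - by rewrite mulr_gt0.
  apply: ge0_ler_powR; rewrite ?nnegrE ?(ltW a0) ?addr_ge0 ?l0 //.
    by apply: mulr_ge0; exact: ltW.
  apply: (@le_trans _ _ (k%:R * p * ln 2)); last by rewrite lerDl.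
  by rewrite mulrC ler_wpM2r ?(ltW ln20) // ler_peMr.
rewrite (_ : c5 * B * ln 2 `^ (- a) * (k%:R `^ (- a) * expR S) = expR S * c5 * B * (ln 2 `^ (- a) * k%:R `^ (- a))); last by ring.
by apply: ler_wpM2l => //; rewrite !mulr_ge0 ?expR_ge0 // ltW.
Qed.

(** The shift multiplies the coefficient at a multiple of 2^k by an extra (2^k)^{-t}; [sharp] strips
    2^k from the frequency but leaves that factor in the coefficient. *)
Lemma sharp_shift_eval k P (t : R) w :
  dpoly_eval (sharp k (dpoly_shift P t)) (w - t%:C) =
  (2 `^ (- (t * k%:R)))%:C * dpoly_eval (sharp k P) w.
Proof.
have h1 : (size (sharp k (dpoly_shift P t)) <= size P)%N.
  by apply: leq_trans (size_poly _ _) (size_poly _ _).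
rewrite (dpoly_evalE _ h1) (dpoly_evalE _ (size_poly _ _)) mulr_sumr; apply: eq_bigr => n _.
rewrite !sharp_coef /dpoly_shift coef_poly.
case: ltnP => h; last by rewrite nth_default // !mul0r mulr0.
have [q qE] : exists q, (2 ^ k * n.+1 = q.+1)%N.
  by case: (2 ^ k * n.+1)%N (muln_gt0 (2 ^ k) n.+1) => [|q _]; [rewrite expn_gt0 | exists q].
rewrite qE /= -qE.
have -> : natpowN (2 ^ k * n.+1) t%:C = (2 `^ (- (t * k%:R)))%:C * natpowN n.+1 t%:C.
  rewrite !natpowN_powR natrM natrX powRM ?exprn_ge0 // rmorphM; congr (_%:C * _).
  by rewrite -powR_mulrn // -powRrM; congr (_ `^ _); ring.
have -> : natpowN n.+1 w = natpowN n.+1 t%:C * natpowN n.+1 (w - t%:C).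
  by rewrite -natpowND addrC subrK.
ring.
Qed.

(* The estimate of [cole_gamelin] for the shifts of P by t, integrated over
   [delta / 8 <= t <= delta / 4]. *)
Lemma sharp_point_eval : exists2 B : R, 0 < B & forall (delta : R) k P w,
  0 < delta <= 2 -> k%:R * delta <= 4 -> 1 / 2 + delta <= complex.Re w ->
  ((cmod (dpoly_eval (sharp k P) w))%:E <=
   (B * delta `^ (- ((a + 1) / p)))%:E * Anorm m p alpha P)%E.
Proof.
have [K hK] := cole_gamelin hm p1; have [d d0 hd] := integral_lower a.
pose L : R := 2 `^ p * (expR (K + 4) * 3).
have L0 : 0 < L by rewrite !mulr_gt0 ?powR_gt0 ?expR_gt0.
pose D := L / (d * ca); have D0 : 0 < D by rewrite divr_gt0 // mulr_gt0.
exists (D `^ p^-1); first exact: powR_gt0.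
move=> delta k P w hD kD hw; have /andP[De0 De2] := hD.
set U := cmod (dpoly_eval _ _); have U0 : 0 <= U by exact: cmod_ge0.
pose c := U `^ p * (delta / L) * ca.
have c0 : 0 <= c.
  apply: mulr_ge0 (ltW ca0); apply: mulr_ge0; first exact: powR_ge0.
  by rewrite divr_ge0 // ltW.
have key : ((c * d * delta `^ a)%:E <= Aint P)%E.
  apply: hd => // t.
    move=> _; apply: mule_ge0; last by rewrite lee_fin mu_density_ge0.
    by apply: tint_ge0 => z; exact: powR_ge0.
  move=> /andP[t1 t2]; have t0 : 0 < t by lra.
  rewrite mu_densityE /c -mulrA EFinM.
  apply: lee_wpmul2r.
    rewrite lee_fin; apply: mulr_ge0; first exact: ltW.
    by apply: mulr_ge0; [exact: powR_ge0|exact: expR_ge0].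
  (* Logarithm of the bound of [expR_prime_sum_le] at e = delta; as t <= delta / 4, the exponent 2
     Re (w - t) is still at least 1 + delta. *)
  pose X := 4 + ln (1 + delta^-1).
  have i0 : 0 < delta^-1 by rewrite invr_gt0.
  have hX J : \sum_(q < J | prime q) (q%:R : R) `^ (- (2 * complex.Re (w - t%:C))) <= X.
    apply: (@le_trans _ _ (\sum_(q < J | prime q) (q%:R : R) `^ (- (1 + delta)))).
      apply: ler_sum => q pq; have := prime_gt0 pq; case: (nat_of_ord q) => // j _.
      by apply: natr_powR_le; rewrite ReB /= lerN2; lra.
    rewrite -ler_expR /X expRD lnK ?posrE ?addr_gt0 //; exact: expR_prime_sum_le.
  have hwt : 1 / 2 <= complex.Re (w - t%:C) by rewrite ReB /=; lra.
  have := hK (w - t%:C) (dpoly_shift P t) k X hwt hX.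
  rewrite sharp_shift_eval cmodM cmod_real ger0_norm ?powR_ge0 // -/U powRM ?powR_ge0 //.
  set Y := tint _ _; set r := 2 `^ _.
  have r0 : 0 < r `^ p by rewrite !powR_gt0.
  have e0 : 0 < expR (K + X) by exact: expR_gt0.
  (* Here t k <= k delta / 4 <= 1, so 2^{-tk} is at least 1/2. *)
  have rL : 2 `^ (- p) <= r `^ p.
    rewrite /r -powRrM ler_powR ?ler1n // mulNr lerN2.
    by rewrite ger_pMl //; have : 0 <= (k%:R : R) by []; nra.
  have eL : expR (K + X) <= expR (K + 4) * 3 / delta.
    rewrite /X addrA [expR (_ + ln _)]expRD lnK ?posrE ?addr_gt0 // -mulrA ler_wpM2l ?expR_ge0 //.
    have h : 1 <= 2 / delta by rewrite ler_pdivlMr // mul1r.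
    lra.
  have Y0 : (0 <= Y)%E by apply: tint_ge0 => z; exact: powR_ge0.
  move=> hY; rewrite -(@lee_pmul2l _ (expR (K + X))%:E) ?lte_fin //.
  apply: le_trans hY; rewrite -EFinM lee_fin.
  rewrite mulrC -mulrA [leRHS]mulrC; apply: ler_wpM2l; first exact: powR_ge0.
  apply: (@le_trans _ _ (2 `^ (- p))) => //.
  apply: (@le_trans _ _ (delta / L * (expR (K + 4) * 3 / delta))).
    by apply: ler_wpM2l => //; rewrite divr_ge0 // ltW.
  have E3 : expR (K + 4) * 3 = L * 2 `^ (- p).
    by rewrite /L powRN mulrAC mulfV ?mul1r // gt_eqF // powR_gt0.
  rewrite E3 le_eqVlt; apply/orP; left; apply/eqP; field.
  by rewrite !gt_eqF.
have z0 : 0 < D * delta `^ (- (a + 1)) by rewrite mulr_gt0 ?powR_gt0.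
have key2 : ((U `^ p)%:E <= (D * delta `^ (- (a + 1)))%:E * Aint P)%E.
  apply: (@le_trans _ _ ((D * delta `^ (- (a + 1)))%:E * (c * d * delta `^ a)%:E)%E); last first.
    by apply: lee_wpmul2l => //; rewrite lee_fin ltW.
  rewrite -EFinM lee_fin /c /D.
  have E4 : delta `^ (- (a + 1)) * (delta * delta `^ a) = 1.
    rewrite -{2}[delta]powRr1 ?(ltW De0) // -powRD; last by apply/implyP => _; rewrite gt_eqF.
    by rewrite addrC powRN mulVf // gt_eqF // powR_gt0.
  rewrite le_eqVlt; apply/orP; left; apply/eqP.
  transitivity (U `^ p * (delta `^ (- (a + 1)) * (delta * delta `^ a))); first by rewrite E4 mulr1.
  move: (delta `^ (- (a + 1))) (delta `^ a) => u v; field.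
  by rewrite !gt_eqF.
have h := gt0_ler_poweR (r := p^-1).
rewrite AnormE.
have -> : (U%:E = (U `^ p)%:E `^ p^-1)%E.
  by rewrite poweR_EFin -powRrM mulfV ?gt_eqF // powRr1.
have -> : ((D `^ p^-1 * delta `^ (- ((a + 1) / p)))%:E * Aint P `^ p^-1 =
   ((D * delta `^ (- (a + 1)))%:E * Aint P) `^ p^-1)%E.
  rewrite poweRM; [|by rewrite lee_fin ltW|exact: Aint_ge0].
  rewrite poweR_EFin powRM; [|exact: ltW|exact: powR_ge0].
  by rewrite -powRrM mulNr.
apply: h => //.
- by rewrite invr_ge0 ltW.
- by rewrite in_itv /= leey lee_fin powR_ge0.
- by rewrite in_itv /= leey mule_ge0 ?Aint_ge0 // lee_fin ltW.
Qed.

End Haar.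

End BergmanNorm.


(** * The Bloch estimate *)

Section Approximation.
Variable R : realType.
Local Notation C := (Cplx R).
Local Notation T := (polytorus R).
Implicit Types (P Q F : {poly C}) (s w : C) (f g h : nat -> C).

Lemma sharp0 P : sharp 0 P = P.
Proof. by apply/polyP => n; rewrite sharp_coef expn0 mul1n. Qed.

Lemma dpartialB f g s : dpartial (fun n => f n - g n) s = fun N => dpartial f s N - dpartial g s N.
Proof.
apply/funext => N; rewrite !dpartialE -sumrB; apply: eq_bigr => n _.
by rewrite mulrBl.
Qed.

Lemma dpoly_eval_const (c : C) s : dpoly_eval (c *: 1) s = c.
Proof. by rewrite dpoly_eval_ev evZ ev1 mulr1. Qed.

Variable m : probability T R.
Hypothesis hm : is_haar m.
Variables p alpha : R.
Hypotheses (p1 : 1 <= p) (al : -1 < alpha).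

Let p0 : 0 < p. Proof. exact: lt_le_trans ltr01 p1. Qed.

Local Notation AN := (Anorm m p alpha).

Lemma Anorm0 : AN 0 = 0%E.
Proof.
rewrite AnormE //; have [B _ hB] := Aint_upper m p al.
suff -> : Aint m p alpha 0 = 0%E by rewrite poweR_EFin powR0 // invr_eq0 gt_eqF.
apply/eqP; rewrite eq_le Aint_ge0 // andbT.
apply: le_trans (hB 0 0 0 (lexx 0) (lexx 0) _) _; last by rewrite !mul0r.
move=> t t0; rewrite mul0r.
rewrite (_ : tint m _ = 0%E) //; apply: integral0_eq => z _.
have := bohr_lift_shift_le 0 z (ltW t0); rewrite size_poly0 big_ord0 => h.
rewrite (_ : cmod _ = 0) ?powR0 ?gt_eqF //.
by apply/eqP; rewrite eq_le h cmod_ge0.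
Qed.

Lemma Ap_dpoly F : Ap_has_norm m p alpha (fun n => F`_n) (fine (AN F)).
Proof.
split; first by move=> s _; apply: cvgP; exact: cvg_dpoly.
exists (fun=> F); split.
- by move=> e e0; exists 0%N => k l _ _; rewrite subrr Anorm0 lte_fin.
- by move=> s _; rewrite dsum_dpoly; exact: cvg_cst.
rewrite fineK; first exact: cvg_cst.
by rewrite ge0_fin_numE ?Anorm_lty // Anorm_ge0.
Qed.

(** Point evaluation with [k = 0], where [sharp] is the identity. *)
Lemma Anorm_cauchy_eval (P : nat -> {poly C}) (delta e : R) : 0 < delta <= 2 -> 0 < e ->
  Anorm_cauchy m p alpha P ->
  exists K : nat, forall k l, (K <= k)%N -> (K <= l)%N -> forall w, 1 / 2 + delta <= complex.Re w ->
    cmod (dpoly_eval (P k) w - dpoly_eval (P l) w) <= e.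
Proof.
move=> hD e0 hP; have [B B0 hB] := sharp_point_eval hm p1 al.
have /andP[D0 _] := hD.
set D := B * delta `^ (- ((alpha + 1 + 1) / p)); have D0' : 0 < D by rewrite mulr_gt0 ?powR_gt0.
have [K hK] := hP (e / D) (divr_gt0 e0 D0'); exists K => k l hk hl w hw.
have kd : 0%:R * delta <= 4 by rewrite mul0r.
have := hB delta 0%N (P k - P l) w hD kd hw; rewrite sharp0 dpoly_evalB -lee_fin => h.
apply: le_trans h _; apply: (@le_trans _ _ (D%:E * (e / D)%:E)%E).
  by apply: lee_wpmul2l; [rewrite lee_fin ltW | exact: ltW (hK k l hk hl)].
by rewrite -EFinM lee_fin mulrCA mulfV ?mulr1 // gt_eqF.
Qed.

(** Membership in the space gives only pointwise convergence of values. Point evaluation makes it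
    uniform on a half-plane, and [dsum_coef_le] on the line Re s = [sg] turns this into convergence
    of each coefficient; dropping an initial segment bounds the norms. *)
Lemma Ap_approximation h (M e : R) : 0 < e -> Ap_has_norm m p alpha h M ->
  exists P : nat -> {poly C},
    [/\ forall j, (AN (P j) <= (M + e)%:E)%E,
        Anorm_cauchy m p alpha P,
        forall s, 1 / 2 < complex.Re s -> (fun j => dpoly_eval (P j) s) @ \oo --> dsum h s &
        forall n, (fun j => (P j)`_n) @ \oo --> h n].
Proof.
move=> e0 [hc [P0 [cP vP nP]]].
have [K0 hK0] : exists K0 : nat, forall j, (K0 <= j)%N -> (AN (P0 j) <= (M + e)%:E)%E.
  have /fine_cvgP[hf hl] := nP.
  have hlt : M < M + e by rewrite ltrDl.
  have := cvgr_lt _ hl _ hlt => h1.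
  have [K0 _ hK0] := filterI hf (h1 _); exists K0 => j hj.
  have [a1 a2] := hK0 j hj; rewrite /= in a2.
  by rewrite -(fineK a1) lee_fin ltW.
exists (fun j => P0 (j + K0)%N); split.
- by move=> j; apply: hK0; exact: leq_addl.
- move=> d d0; have [K hK] := cP d d0; exists K => k l hk hl.
  by apply: hK; exact: leq_trans (leq_addr _ _).
- by move=> s hs; rewrite (cvg_shiftn K0 (fun j => dpoly_eval (P0 j) s)); exact: vP.
move=> n; rewrite (cvg_shiftn K0 (fun j => (P0 j)`_n)).
have [tau [Bh [tau0 gh]]] := converges_dgrowth hc.
pose sg : R := tau + 3.
have sg2 : tau + 2 <= sg by rewrite /sg; lra.
apply/cvg_cmodP => d d0.
pose N : R := n.+1%:R `^ (- sg).
have N0 : 0 < N by rewrite powR_gt0.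
have e1 : 0 < d / 2 * N by rewrite !mulr_gt0.
have h12 : 0 < (1 : R) <= 2 by rewrite ltr01 ler1n.
have [K hK] := Anorm_cauchy_eval h12 e1 cP.
exists K => // j /= hj.
have [Bp gp] := dgrowth_dpoly (P0 j) tau.
have gn : dgrowth (fun n => - h n) tau Bh by move=> i; rewrite cmodN; exact: gh.
have gd := dgrowthD gp gn.
have hb t : cmod (dsum (fun n => (P0 j)`_n - h n) (sg +i* t)) <= d / 2 * N.
  have hs : 1 / 2 < complex.Re (sg +i* t) by rewrite /= /sg; lra.
  have hs1 : 1 / 2 + 1 <= complex.Re (sg +i* t) by rewrite /= /sg; lra.
  have -> : dsum (fun n => (P0 j)`_n - h n) (sg +i* t) = dpoly_eval (P0 j) (sg +i* t) - dsum h (sg +i* t).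
    apply: dsum_cvg; rewrite dpartialB; apply: cvgBC; first exact: cvg_dpoly.
    exact: (dgrowth_cvg gh).
  apply: (@cvg_cmod_le _ (fun i => dpoly_eval (P0 j) (sg +i* t) - dpoly_eval (P0 i) (sg +i* t))).
    by apply: cvgBC; [exact: cvg_cst | exact: vP].
  by exists K => // i /= hi; exact: hK.
have := dsum_coef_le n gd sg2 hb; rewrite -/N ler_pM2r // => h1.
rewrite -cmodN opprB; apply: le_lt_trans h1 _; lra.
Qed.

Variable g : nat -> C.
Hypothesis hV : volterra_bounded m p alpha g.

Lemma dconv1 b n : dconv (1 : {poly C}) b n = b n.
Proof.
rewrite (@dconvE _ _ 1) ?size_poly1 // big_mkcond big_ord_recl big_ord0 /= addr0.
by rewrite dvd1n coef1 mul1r divn1.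
Qed.

(** T_g applied to the constant 1 is g minus its constant coefficient, so [g] inherits approximating
    polynomials from the range of the operator. *)
Lemma symbol_approximation : converges_on (1 / 2) g /\ exists Q : nat -> {poly C},
  [/\ forall n, (fun j => (Q j)`_n) @ \oo --> g n,
      forall s, 1 / 2 < complex.Re s -> (fun j => dpoly_eval (Q j) s) @ \oo --> dsum g s,
      forall delta e : R, 0 < delta <= 2 -> 0 < e ->
        exists K : nat, forall k l, (K <= k)%N -> (K <= l)%N -> forall w, 1 / 2 + delta <= complex.Re w ->
          cmod (dpoly_eval (Q k) w - dpoly_eval (Q l) w) <= e &
      forall delta : R, 0 < delta <= 2 -> exists B : R, forall j w, 1 / 2 + delta <= complex.Re w ->
        cmod (dpoly_eval (Q j) w) <= B].
Proof.
have [CV hCV] := hV.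
have [h [M [vh nh _]]] := hCV _ _ (Ap_dpoly 1).
have [h0 hn] := volterra_coef vh.
have hg n : g n = h n - (- g 0%N *: 1 : {poly C})`_n.
  rewrite coefZ coef1; case: n => [|n]; first by rewrite h0 mulr1 sub0r opprK.
  rewrite mulr0 subr0; have := hn n.+1; rewrite dconv1 mulrC => /mulIf -> //.
  apply/eqP => /(congr1 (@complex.Re R)) /= /eqP.
  by rewrite gt_eqF // ln_gt0 // ltr1n.
have hgE : g = fun n => h n - (- g 0%N *: 1 : {poly C})`_n by apply/funext.
have [P [bP cP vP kP]] := Ap_approximation ltr01 nh.
have gs s : 1 / 2 < complex.Re s -> dpartial g s @ \oo --> dsum h s + g 0%N.
  move=> hs; rewrite -[X in _ --> _ + X]opprK.
  move: (hgE); move: (- g 0%N) => c ->; rewrite dpartialB.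
  apply: cvgBC; first by have [hc _] := nh; exact: hc.
  by have := @cvg_dpoly R (c *: 1) s; rewrite dpoly_eval_const.
split; first by move=> s hs; apply: cvgP (gs s hs).
exists (fun j => P j + g 0%N *: 1); split.
- move=> n; have -> : g n = h n + (g 0%N *: 1 : {poly C})`_n.
    by rewrite [LHS]hg scaleNr coefN opprK.
  under eq_fun do rewrite coefD.
  by apply: cvgDC; [exact: kP | exact: cvg_cst].
- move=> s hs; rewrite (dsum_cvg (gs s hs)).
  under eq_fun do rewrite dpoly_evalD dpoly_eval_const.
  by apply: cvgDC; [exact: vP | exact: cvg_cst].
- move=> delta e hD e0; have [K hK] := Anorm_cauchy_eval hD e0 cP.
  exists K => k l hk hl w hw; rewrite !dpoly_evalD opprD addrACA subrr addr0; exact: hK.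
move=> delta hD; have [B B0 hB] := sharp_point_eval hm p1 al.
set D := B * delta `^ (- ((alpha + 1 + 1) / p)).
have D0 : 0 <= D by rewrite mulr_ge0 ?powR_ge0 // ltW.
exists (D * (M + 1) + cmod (g 0%N)) => j w hw.
rewrite dpoly_evalD dpoly_eval_const; apply: le_trans (ler_cmodD _ _) _; rewrite lerD2r.
have kd : 0%:R * delta <= 4 by rewrite mul0r.
have := hB delta 0%N (P j) w hD kd hw; rewrite sharp0 -lee_fin => hh.
by apply: le_trans hh _; rewrite (EFinM D); apply: lee_wpmul2l.
Qed.

End Approximation.


(** * The differential identity and the bound on the derivative *)

Section BlochBound.
Variable R : realType.
Local Notation C := (Cplx R).
Local Notation T := (polytorus R).
Implicit Types (P Q F : {poly C}) (s w : C) (f g h : nat -> C).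

(** Cauchy's estimate on the largest disc about [w] inside the half-plane. *)
Lemma dderiv_half_plane_le P (theta M : R) w : theta < complex.Re w ->
  (forall z, theta <= complex.Re z -> cmod (dpoly_eval P z) <= M) ->
  cmod (dpoly_eval (dderiv P) w) <= M / (complex.Re w - theta).
Proof.
move=> hw hM; apply: dderiv_le => [|z hz]; first by rewrite subr_gt0.
apply: hM; rewrite ReD; have := le_trans (Re_le_cmod z) hz.
by rewrite ler_norml => /andP[h _]; lra.
Qed.

(* If [f = 2 ^ (- k s) F] and [h = 2 ^ (- k s) V], then [h' = f g'] reads
   [V' - (k ln 2) V = F g']. *)
Lemma limit_identity (k : nat) F (g h : nat -> C) (P Q : nat -> {poly C}) (theta MU MQ : R) s :
  theta < complex.Re s -> 0 <= theta ->
  (forall n, (ln (n.+1%:R : R))%:C * h n =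
     dconv (dmul 'X^((2 ^ k).-1) F) (fun e => g e * (ln (e.+1%:R : R))%:C) n) ->
  (forall n, (fun j => (P j)`_n) @ \oo --> h n) ->
  (forall n, (fun j => (Q j)`_n) @ \oo --> g n) ->
  (forall j w, theta <= complex.Re w -> cmod (dpoly_eval (sharp k (P j)) w) <= MU) ->
  (forall j w, theta <= complex.Re w -> cmod (dpoly_eval (Q j) w) <= MQ) ->
  (fun j => dpoly_eval (dderiv (sharp k (P j))) s
     - (k%:R * ln (2 : R))%:C * dpoly_eval (sharp k (P j)) s
     - dpoly_eval F s * dpoly_eval (dderiv (Q j)) s) @ \oo --> (0 : C).
Proof.
move=> hs th0 hV hP hQ hMU hMQ.
pose c : C := (k%:R * ln (2 : R))%:C.
pose Z j := dderiv (sharp k (P j)) - c *: sharp k (P j) - dmul F (dderiv (Q j)).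
have ZE j w : dpoly_eval (Z j) w = dpoly_eval (dderiv (sharp k (P j))) w
     - c * dpoly_eval (sharp k (P j)) w - dpoly_eval F w * dpoly_eval (dderiv (Q j)) w.
  by rewrite /Z !dpoly_evalB dpoly_evalZ dmul_eval.
under eq_fun do rewrite -ZE.
pose d := (complex.Re s - theta) / 2.
have d0 : 0 < d by rewrite divr_gt0 // subr_gt0.
pose SF : R := \sum_(n < size F) cmod F`_n * n.+1%:R `^ (- 0).
have SF0 : 0 <= SF by apply: sumr_ge0 => n _; rewrite mulr_ge0 ?cmod_ge0 ?powR_ge0.
have MU0 : 0 <= MU.
  by apply: le_trans (hMU 0%N theta%:C _) => //; exact: cmod_ge0.
have MQ0 : 0 <= MQ.
  by apply: le_trans (hMQ 0%N theta%:C _) => //; exact: cmod_ge0.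
apply: (@vitali_dpoly _ Z (theta + d) (MU / d + cmod c * MU + SF * (MQ / d))).
- move=> j w hw; rewrite ZE.
  have hw1 : theta < complex.Re w by lra.
  have dw : d <= complex.Re w - theta by lra.
  have div_le (M : R) : 0 <= M -> M / (complex.Re w - theta) <= M / d.
    by move=> M0; rewrite ler_wpM2l // lef_pV2 ?posrE // subr_gt0.
  apply: le_trans (ler_cmodB _ _) _; apply: lerD.
    apply: le_trans (ler_cmodB _ _) _; apply: lerD.
      exact: le_trans (dderiv_half_plane_le hw1 (hMU j)) (div_le _ MU0).
    by rewrite cmodM ler_wpM2l ?cmod_ge0 // hMU // ltW.
  rewrite cmodM; apply: ler_pM; rewrite ?cmod_ge0 //.
    by apply: dpoly_eval_le; lra.
  exact: le_trans (dderiv_half_plane_le hw1 (hMQ j)) (div_le _ MQ0).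
- move=> n; pose q := (2 ^ k * n.+1).-1.
  have qE : q.+1 = (2 ^ k * n.+1)%N by rewrite prednK // muln_gt0 expn_gt0.
  (* This splitting of the logarithm is the origin of the term - (k ln 2) V: differentiating [sharp]
     sees only ln (n + 1). *)
  have lnE : ln (q.+1%:R : R) = k%:R * ln 2 + ln (n.+1%:R : R).
    by rewrite qE natrM natrX lnM ?posrE ?exprn_gt0 ?ltr0n // lnXn // mulr_natl.
  have ZC j : (Z j)`_n = (- ln (q.+1%:R : R))%:C * (P j)`_q +
      \sum_(e < size F | (e.+1 %| n.+1)%N) F`_e * ((Q j)`_(n.+1 %/ e.+1).-1 *
         (ln ((n.+1 %/ e.+1).-1.+1%:R : R))%:C).
    rewrite !coefB coefZ dderiv_coef sharp_coef dmul_coef -/q lnE /dconv -sumrN.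
    rewrite /c; congr (_ + _).
      by rewrite opprD !rmorphD !rmorphN /=; ring.
    by apply: eq_bigr => e _; rewrite dderiv_coef rmorphN mulrN mulrN opprK.
  have hq := hV q; rewrite /q dconv_dmul_Xn ?expn_gt0 // -/q in hq.
  have E0 : (- ln (q.+1%:R : R))%:C * h q +
      \sum_(e < size F | (e.+1 %| n.+1)%N) F`_e * (g (n.+1 %/ e.+1).-1 *
         (ln ((n.+1 %/ e.+1).-1.+1%:R : R))%:C) = 0.
    by rewrite rmorphN mulNr hq addNr.
  suff L : (fun j => (Z j)`_n) @ \oo --> ((- ln (q.+1%:R : R))%:C * h q +
      \sum_(e < size F | (e.+1 %| n.+1)%N) F`_e * (g (n.+1 %/ e.+1).-1 *
         (ln ((n.+1 %/ e.+1).-1.+1%:R : R))%:C) : C) by move: L; rewrite E0.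
  under eq_fun do rewrite ZC.
  apply: cvgDC; first by apply: cvgMC; [exact: cvg_cst | exact: hP].
  rewrite big_mkcond; under eq_fun do rewrite big_mkcond.
  apply: cvg_sumC => e; case: ifP => _; last exact: cvg_cst.
  apply: cvgMC; first exact: cvg_cst.
  by apply: cvgMC; [exact: hQ | exact: cvg_cst].
by rewrite /d; lra.
Qed.

(** Leaving out the primes below 324 lowers the sum by at most 324. With [expR 4] from the Euler
    product and 4 <= exp(4) for the factor in 1/delta = 4 / (4 delta), the exponent is 324 + 4 + 4 =
    332. *)
Lemma tsum_lower (delta : R) : 0 < delta -> exists X,
  delta^-1 <= expR 332 * expR (tsum (1 / 2 + delta) X).
Proof.
move=> d0; have d20 : 0 < 2 * delta by lra.
have [X hX] := expR_prime_sum_ge d20; exists X.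
have h4 : 4 <= expR (4 : R).
  by apply: le_trans (expR_ge1Dx _); lra.
have S : \sum_(q < X | prime q) (q%:R : R) `^ (- (1 + 2 * delta)) <= 324 + tsum (1 / 2 + delta) X.
  rewrite (bigID (fun q : 'I_X => (324 <= q)%N)) /= addrC; apply: lerD; last first.
    by rewrite /tsum le_eqVlt; apply/orP; left; apply/eqP; apply: eq_bigr => q _; congr (_ `^ _); lra.
  apply: (@le_trans _ _ (\sum_(q < X | (q < 324)%N) 1%:R)).
    rewrite big_mkcond [leRHS]big_mkcond; apply: ler_sum => q _ /=.
    rewrite -ltnNge; case: (prime q) (@prime_gt0 q) => /= [/(_ isT) q0|_]; last by case: ifP.
    case: ifP => // _; case: (nat_of_ord q) q0 => // j _.
    have h1 : (1 : R) `^ (1 + 2 * delta) = 1 by rewrite powR1.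
    rewrite powRN invf_le1 ?powR_gt0 ?ltr0n // -[leLHS]h1.
    by apply: ge0_ler_powR; rewrite ?nnegrE ?ler1n //; lra.
  rewrite -natr_sum ler_nat.
  rewrite -(big_mkord (fun q => q < 324)%N (fun=> 1%N)) -big_filter sum1_size -(size_iota 0 324).
  apply: uniq_leq_size; rewrite ?filter_uniq ?iota_uniq //.
  by move=> q; rewrite mem_filter !mem_iota add0n => /andP[-> _].
have e1 := le_trans hX (ler_wpM2l (expR_ge0 4) (eqbRL (ler_expR _ _) S)).
have -> : delta^-1 = 4 * (2 * (2 * delta))^-1 by field; rewrite gt_eqF.
have i0 : 0 <= (2 * (2 * delta))^-1 by rewrite invr_ge0 mulr_ge0 // ltW.
apply: le_trans (ler_pM (ler0n R 4) i0 h4 e1) _.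
rewrite -!expRD ler_expR addrA; lra.
Qed.

Section Symbol.
Variable m : probability T R.
Hypothesis hm : is_haar m.
Variables p alpha : R.
Hypotheses (p1 : 1 <= p) (al : -1 < alpha).
Variable g : nat -> C.
Hypothesis hV : volterra_bounded m p alpha g.

Let p0 : 0 < p. Proof. exact: lt_le_trans ltr01 p1. Qed.

Lemma exists_reciprocal (delta : R) : 0 < delta <= 2 ->
  exists k : nat, [/\ (0 < k)%N, delta^-1 <= k%:R & k%:R * delta <= 3].
Proof.
move=> /andP[d0 d2]; have i0 : 0 <= delta^-1 by rewrite invr_ge0 ltW.
exists (Num.truncn delta^-1).+1; split => //.
  by apply: ltW; exact: truncnS_gt.
rewrite -natr1 mulrDl mul1r.
have : (Num.truncn delta^-1)%:R * delta <= 1.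
  by rewrite -ler_pdivlMr // div1r; have /andP[] := truncn_itv i0.
lra.
Qed.

Lemma symbol_derivative_le (Q : nat -> {poly C}) (D : C -> C) :
  (forall n, (fun j => (Q j)`_n) @ \oo --> g n) ->
  (forall delta : R, 0 < delta <= 2 -> exists B : R, forall j w, 1 / 2 + delta <= complex.Re w ->
        cmod (dpoly_eval (Q j) w) <= B) ->
  (forall s, 1 / 2 < complex.Re s -> (fun j => dpoly_eval (dderiv (Q j)) s) @ \oo --> D s) ->
  exists B : R, forall (delta t : R), 0 < delta <= 2 -> delta * cmod (D ((1 / 2 + delta) +i* t)) <= B.
Proof.
move=> hQ hQb hQD.
have [CV hCV] := hV.
have [Bp Bp0 hBp] := sharp_point_eval hm p1 al.
have [Bt Bt0 hBt] := Anorm_tfun_le hm p1 al.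
pose a := alpha + 1.
(* 2^{a+1} comes from using delta/2 in place of delta, exp(24) from [tprod_value] and exp(332) from
   [tsum_lower]. *)
pose K : R := (2 `^ (a + 1) * (expR 24 * expR 332)) `^ p^-1.
exists (5 * Bp * (`|CV| + 1) * Bt * K) => delta t hD.
have /andP[d0 d2] := hD.
set s : C := _ +i* t.
have Res : complex.Re s = 1 / 2 + delta by [].
have [k [k0 k1 k2]] := exists_reciprocal hD.
have [X hX] := tsum_lower d0.
have hs : 1 / 2 <= complex.Re s by rewrite Res; lra.
have hs' : 1 / 2 < complex.Re s by rewrite Res; lra.
pose F := tprod (2 / p) (fun q => natpowN q s) X.
pose S := tsum (complex.Re s) X.
pose N0 : R := Bt * (k%:R `^ (- a) * expR S) `^ p^-1.
have kR : 0 < (k%:R : R) by rewrite ltr0n.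
have N00 : 0 < N0 by rewrite mulr_gt0 ?powR_gt0 // mulr_gt0 ?powR_gt0 ?expR_gt0.
have [h [M [vh nh hM]]] := hCV _ _ (Ap_dpoly m p1 al (tfun p s k X)).
have hN : fine (Anorm m p alpha (tfun p s k X)) <= N0.
  rewrite -lee_fin fineK; first exact: hBt.
  by rewrite ge0_fin_numE ?Anorm_lty // Anorm_ge0.
have hN0 : 0 <= fine (Anorm m p alpha (tfun p s k X)) by rewrite fine_ge0 // Anorm_ge0.
(* The approximation error may be as large as [N0], the bound on the norm of the test function: it
   only adds 1 to the constant of the operator. *)
have hM1 : M + N0 <= (`|CV| + 1) * N0.
  rewrite mulrDl mul1r lerD2r; apply: le_trans hM _.
  apply: (@le_trans _ _ (`|CV| * fine (Anorm m p alpha (tfun p s k X)))).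
    by apply: ler_wpM2r => //; exact: ler_norm.
  exact: ler_wpM2l.
have [P [bP cP vP kP]] := Ap_approximation hm p1 al N00 nh.
(* V is bounded on Re w >= 1/2 + delta/2, which leaves a disc of radius delta/2 about [s] for
   Cauchy's estimate. *)
have hD2 : 0 < delta / 2 <= 2 by apply/andP; split; lra.
pose MU : R := Bp * (delta / 2) `^ (- ((a + 1) / p)) * ((`|CV| + 1) * N0).
have Bd0 : 0 <= Bp * (delta / 2) `^ (- ((a + 1) / p)) by rewrite mulr_ge0 ?powR_ge0 // ltW.
have hMU j w : 1 / 2 + delta / 2 <= complex.Re w -> cmod (dpoly_eval (sharp k (P j)) w) <= MU.
  move=> hw; have kd : k%:R * (delta / 2) <= 4 by rewrite mulrA; lra.
  rewrite -lee_fin; apply: le_trans (hBp _ k (P j) w hD2 kd hw) _.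
  rewrite /MU (EFinM (Bp * _)); apply: lee_wpmul2l; first by rewrite lee_fin.
  by apply: le_trans (bP j) _; rewrite lee_fin.
have [MQ hMQ] := hQb _ hD2.
have [_ vc] := volterra_coef vh.
have th0 : 0 <= 1 / 2 + delta / 2 by lra.
have ths : 1 / 2 + delta / 2 < complex.Re s by rewrite Res; lra.
have lim := limit_identity (F := F) ths th0 vc kP hQ hMU hMQ.
have MU0 : 0 <= MU.
  by apply: le_trans (hMU 0%N (1 / 2 + delta / 2)%:C _) => //; exact: cmod_ge0.
have ln2 : 0 <= ln (2 : R) <= 1.
  rewrite ln_ge0 ?ler1n //=.
  have h1 : -1 < (1 : R) by lra.
  by have := le_ln1Dx h1; rewrite (_ : 1 + 1 = 2 :> R) //; lra.
(* 5 = 2 + 3: the derivative of V costs 2/delta, and k ln 2 <= 3/delta. *)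
have bound : cmod (dpoly_eval F s * D s) <= 5 / delta * MU.
  have lim2 := cvgDC lim (cvgMC (cvg_cst (dpoly_eval F s)) (hQD s hs')).
  rewrite -[dpoly_eval F s * D s]add0r; apply: (cvg_cmod_le (lim2 _)); near=> j.
  rewrite /= subrK; apply: le_trans (ler_cmodB _ _) _.
  have := dderiv_half_plane_le ths (hMU j).
  rewrite (_ : complex.Re s - (1 / 2 + delta / 2) = delta / 2); last by rewrite Res; lra.
  move=> b1; have b2 : cmod ((k%:R * ln (2 : R))%:C * dpoly_eval (sharp k (P j)) s) <= 3 / delta * MU.
    rewrite cmodM; apply: ler_pM; rewrite ?cmod_ge0 //; last by apply: hMU; exact: ltW.
    have /andP[l1 l2] := ln2.
    rewrite cmod_real ger0_norm ?mulr_ge0 ?(ltW kR) // ler_pdivlMr //.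
    by apply: le_trans k2; rewrite ler_wpM2r ?(ltW d0) // ler_piMr // ltW.
  apply: le_trans (lerD b1 b2) _; rewrite le_eqVlt; apply/orP; left; apply/eqP; field.
  by rewrite gt_eqF.
pose L : R := expR (2 * S - 24) `^ p^-1.
have L0 : 0 < L by rewrite powR_gt0 // expR_gt0.
have FL : L <= cmod (dpoly_eval F s).
  have h1 := tprod_value p1 X hs; rewrite -/F -/S in h1.
  have -> : cmod (dpoly_eval F s) = (cmod (dpoly_eval F s) `^ p) `^ p^-1.
    by rewrite -powRrM mulfV ?gt_eqF // powRr1 // cmod_ge0.
  by apply: ge0_ler_powR; rewrite ?nnegrE ?invr_ge0 ?expR_ge0 ?powR_ge0 // ltW.
(* Here the powers of delta balance: delta^{-(a+1)} from point evaluation times delta^a from k^{-a}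
   is 1/delta, which [tsum_lower] trades for exp(S); the resulting exp(2S) is the size of
   |F(s)|^p. *)
have KL : (delta / 2) `^ (- ((a + 1) / p)) * (k%:R `^ (- a) * expR S) `^ p^-1 <= K * L.
  have -> : - ((a + 1) / p) = - (a + 1) * p^-1 by rewrite mulNr.
  rewrite powRrM -!powRM; last 4 first.
  - by rewrite !mulr_ge0 ?powR_ge0 ?expR_ge0.
  - exact: expR_ge0.
  - exact: powR_ge0.
  - by rewrite mulr_ge0 ?powR_ge0 ?expR_ge0.
  apply: ge0_ler_powR; rewrite ?nnegrE ?invr_ge0 ?(ltW p0) ?mulr_ge0 ?powR_ge0 ?expR_ge0 //.
  have a1 : k%:R `^ (- a) <= delta `^ a.
    have a0 : 0 <= a by rewrite /a -lerBlDr sub0r ltW.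
    have -> : delta `^ a = (delta^-1 `^ a)^-1.
      by rewrite -(powR_inv1 (ltW d0)) -powRrM mulN1r powRN invrK.
    rewrite powRN lef_pV2 ?posrE ?powR_gt0 ?invr_gt0 //.
    by apply: ge0_ler_powR; rewrite ?nnegrE ?invr_ge0 ?(ltW d0).
  have a2 : (delta / 2) `^ (- (a + 1)) = 2 `^ (a + 1) * delta `^ (- (a + 1)).
    rewrite powRM ?invr_ge0 ?(ltW d0) // mulrC; congr (_ * _).
    have h2 : 0 <= (2 : R) by [].
    by rewrite -(powR_inv1 h2) -powRrM mulN1r opprK.
  have a3 : delta `^ (- (a + 1)) * delta `^ a = delta^-1.
    rewrite -powRD; last by apply/implyP => _; rewrite gt_eqF.
    by rewrite opprD addrAC addNr add0r powR_inv1 // ltW.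
  have a4 : expR S * expR S = expR 24 * expR (2 * S - 24).
    by rewrite -!expRD; congr expR; lra.
  rewrite a2 -mulrA; have -> : 2 `^ (a + 1) * (expR 24 * expR 332) * expR (2 * S - 24) =
      2 `^ (a + 1) * (expR 332 * (expR S * expR S)) by rewrite a4; ring.
  apply: ler_wpM2l; first exact: powR_ge0.
  rewrite [leLHS]mulrA [leRHS]mulrA; apply: ler_wpM2r; first exact: expR_ge0.
  apply: le_trans hX; rewrite -a3.
  by apply: ler_wpM2l => //; exact: powR_ge0.
have DL : delta * cmod (D s) * L <= 5 * MU.
  apply: (@le_trans _ _ (delta * cmod (D s) * cmod (dpoly_eval F s))).
    by apply: ler_wpM2l => //; rewrite mulr_ge0 ?cmod_ge0 // ltW.
  rewrite -mulrA [cmod _ * cmod _]mulrC -cmodM.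
  apply: le_trans (ler_wpM2l (ltW d0) bound) _.
  by rewrite -mulrA mulrCA [delta * (_ * _)]mulrA mulfV ?mul1r // gt_eqF.
rewrite -(ler_pM2r L0); apply: le_trans DL _.
rewrite /MU /N0 (_ : 5 * _ = 5 * Bp * (`|CV| + 1) * Bt *
  ((delta / 2) `^ (- ((a + 1) / p)) * (k%:R `^ (- a) * expR S) `^ p^-1)); last by ring.
rewrite -[leRHS]mulrA; apply: ler_wpM2l => //.
by rewrite !mulr_ge0 ?addr_ge0 // ltW.
Unshelve. all: by end_near. Qed.

Lemma symbol_bloch : bloch g.
Proof.
have [cg [Q [hQ vQ cQ bQ]]] := symbol_approximation hm p1 al hV.
have W s : 1 / 2 < complex.Re s -> derivable (dsum g) s 1 /\
    (fun j => dpoly_eval (dderiv (Q j)) s) @ \oo --> derive1 (dsum g) s.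
  move=> hs; pose r := (complex.Re s - 1 / 2) / 2.
  have r0 : 0 < r by rewrite divr_gt0 // subr_gt0.
  pose d := Num.min r 2.
  have hd : 0 < d <= 2 by rewrite lt_min r0 ltr0n ge_min lexx orbT.
  have hz z : cmod z <= r -> 1 / 2 + d <= complex.Re (s + z).
    move=> hz; rewrite ReD; have := le_trans (Re_le_cmod z) hz.
    rewrite ler_norml => /andP[h _]; have : d <= r by rewrite ge_min lexx.
    by move: h; rewrite /r; lra.
  apply: (@weierstrass_dpoly _ Q (dsum g) s r) => //.
    by move=> z /hz h; apply: vQ; have /andP[d0 _] := hd; lra.
  move=> e e0; have [K hK] := cQ d e hd e0; exists K => k l hk hl z /hz h.
  exact: hK.
exists (dsum g); split.
- by move=> theta _ s _ _.
- by move=> s hs; have [] := W s hs.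
have [B hB] := @symbol_derivative_le Q (derive1 (dsum g)) hQ bQ (fun s hs => (W s hs).2).
have h12 : 0 < (1 / 2 : R) <= 2 by apply/andP; split; lra.
have [B1 hB1] := bQ _ h12.
have B10 : 0 <= B1.
  by apply: le_trans (hB1 0%N (1 / 2 + 1 / 2)%:C _) => //; exact: cmod_ge0.
exists (`|B| + 2 * B1) => _ [s /= hs <-].
(* [symbol_derivative_le] covers distances up to 2 from the line Re s = 1/2; further right, Cauchy's
   estimate with the bound [B1] on Re w >= 1 suffices. *)
have [s2|s2] := leP (complex.Re s) (5 / 2).
  have hd : 0 < complex.Re s - 1 / 2 <= 2 by apply/andP; split; lra.
  have := hB _ (complex.Im s) hd; rewrite (_ : 1 / 2 + (complex.Re s - 1 / 2) = complex.Re s) => [h|]; last by lra.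
  have E : (complex.Re s +i* complex.Im s) = s by case: (s).
  rewrite E in h; apply: le_trans h _; have := ler_norm B; lra.
have [_ lim] := W s hs.
have hB2 : cmod (derive1 (dsum g) s) <= B1 / (complex.Re s - 1).
  apply: (cvg_cmod_le lim); near=> j.
  have -> : 1 = 1 / 2 + 1 / 2 :> R by lra.
  by apply: dderiv_half_plane_le; [lra | exact: hB1].
have s1 : 0 < complex.Re s - 1 by lra.
have h0 := cmod_ge0 (derive1 (dsum g) s).
move: hB2; rewrite ler_pdivlMr // => hB2.
have := normr_ge0 B; nra.
Unshelve. all: by end_near. Qed.

End Symbol.

End BlochBound.

Unset Implicit Arguments.
Close Scope complex_scope.
Close Scope classical_set_scope.

Theorem theorem7p9 (R : realType) (m : probability (polytorus R) R)
    (p alpha : R) (g : nat -> Cplx R) :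
  is_haar m -> 1 <= p -> -1 < alpha -> dirichlet g ->
  volterra_bounded m p alpha g -> bloch g.
Proof. by move=> hm p1 al _ hV; exact: (symbol_bloch hm p1 al hV). Qed.
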